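(* Suppose $\epsilon$ is an even ordinal and there is a nontrivial elementary embedding from $V_{\epsilon+3}$ to itself. Then $\aleph(V_{\epsilon+2})=\theta_{\epsilon+2}$.
   Context: The background theory is ZF, without the Axiom of Choice. The Hartogs number $\aleph(X)$ of a set $X$ is the least ordinal that admits no injection into $X$. For sets $X,Y$, $X\leq^* Y$ means that there is a surjective partial function from $Y$ to $X$. $\aleph^*(X) = \sup\{\eta+1 : \eta \text{ an ordinal},\ \eta\leq^* X\}$, and for an ordinal $\alpha$, $\theta_\alpha = \sup_{x\in V_\alpha}\aleph^*(x)$; so $\theta_{\epsilon+2}=\aleph^*(V_{\epsilon+1})$. An ordinal is even if it is of the form $\gamma+2n$ for some limit ordinal $\gamma$ and natural number $n$. *)

(* Defs.v *)
From Stdlib Require Import Utf8 PeanoNat.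

Set Implicit Arguments.
Unset Strict Implicit.
Unset Printing Implicit Defensive.

(** ZF is the first-order theory: a theorem of ZF is a statement true in every
    [M : SetStructure] satisfying [ZF M].  Below, every notion of set theory is
    interpreted inside [M]: quantifiers range over the elements of [M], and the
    only primitives are membership and equality.  Separation and Replacement
    are schemas over first-order formulas; quantifying over all Rocq predicates
    on [M] instead would transfer the choice principles of the metatheory
    to [M]. *)

Record SetStructure : Type := {
  carrier :> Type;
  mem : carrier -> carrier -> Prop
}.

Arguments mem {M} x y : rename.

Notation "x ∈ y" := (mem x y) (at level 70, no associativity).
Notation "x ∉ y" := (~ mem x y) (at level 70, no associativity).

(** ** First-order formulas and the axioms of ZF *)

Inductive formula : Type :=
| fMem (i k : nat)
| fEq (i k : nat)
| fNot (p : formula)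
| fAnd (p q : formula)
| fEx (i : nat) (p : formula).

Definition upd {M : Type} (env : nat -> M) (i : nat) (a : M) : nat -> M :=
  fun k => if Nat.eqb k i then a else env k.

Fixpoint holds {M : SetStructure} (env : nat -> M) (p : formula) : Prop :=
  match p with
  | fMem i k => env i ∈ env k
  | fEq i k => env i = env k
  | fNot p => ~ holds env p
  | fAnd p q => holds env p /\ holds env q
  | fEx i p => exists a : M, holds (upd env i a) p
  end.

Definition subset {M : SetStructure} (x y : M) : Prop :=
  forall z, z ∈ x -> z ∈ y.

Definition is_empty {M : SetStructure} (x : M) : Prop := forall z, z ∉ x.

Definition is_succ {M : SetStructure} (x y : M) : Prop :=
  forall z, z ∈ y <-> (z ∈ x \/ z = x).

Definition is_pair {M : SetStructure} (x y p : M) : Prop :=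
  forall z, z ∈ p <-> (z = x \/ z = y).

Record ZF (M : SetStructure) : Prop := {
  zf_extensionality :
    forall x y : M, (forall z, z ∈ x <-> z ∈ y) -> x = y;
  zf_foundation :
    forall x : M, (exists y, y ∈ x) ->
      exists y, y ∈ x /\ ~ exists z, z ∈ x /\ z ∈ y;
  zf_pairing :
    forall x y : M, exists p, is_pair x y p;
  zf_union :
    forall x : M, exists u, forall z, z ∈ u <-> exists y, y ∈ x /\ z ∈ y;
  zf_powerset :
    forall x : M, exists w, forall z, z ∈ w <-> subset z x;
  zf_infinity :
    exists w : M,
      (exists e, is_empty e /\ e ∈ w) /\
      (forall x, x ∈ w -> exists y, is_succ x y /\ y ∈ w);
  (* Variable 0 is the element being tested, the others are parameters. *)
  zf_separation :
    forall (p : formula) (env : nat -> M) (a : M),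
      exists b, forall x, x ∈ b <-> (x ∈ a /\ holds (upd env 0 x) p);
  (* Variable 0 is the argument, variable 1 the value, the others are
     parameters. *)
  zf_replacement :
    forall (p : formula) (env : nat -> M) (a : M),
      (forall x, x ∈ a -> exists! y, holds (upd (upd env 0 x) 1 y) p) ->
      exists b, forall y,
        y ∈ b <-> exists x, x ∈ a /\ holds (upd (upd env 0 x) 1 y) p
}.

(** ** Relations and functions *)

(* Kuratowski pairs. *)
Definition is_opair {M : SetStructure} (x y p : M) : Prop :=
  exists a b, is_pair x x a /\ is_pair x y b /\ is_pair a b p.

Definition pair_in {M : SetStructure} (r x y : M) : Prop :=
  exists p, is_opair x y p /\ p ∈ r.

Definition is_function_on {M : SetStructure} (f a : M) : Prop :=
  (forall p, p ∈ f -> exists x y, x ∈ a /\ is_opair x y p) /\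
  (forall x, x ∈ a -> exists! y, pair_in f x y).

Definition is_function {M : SetStructure} (f a b : M) : Prop :=
  is_function_on f a /\ (forall x y, pair_in f x y -> y ∈ b).

Definition injects {M : SetStructure} (a b : M) : Prop :=
  exists f, is_function f a b /\
    forall x x' y, pair_in f x y -> pair_in f x' y -> x = x'.

(* [surj_le x y] is x ≤* y. *)
Definition surj_le {M : SetStructure} (x y : M) : Prop :=
  exists f d, subset d y /\ is_function f d x /\
    forall u, u ∈ x -> exists v, pair_in f v u.

(** ** Ordinals *)

Definition is_transitive {M : SetStructure} (x : M) : Prop :=
  forall y, y ∈ x -> subset y x.

Definition well_ordered_by_mem {M : SetStructure} (x : M) : Prop :=
  (forall y, y ∈ x -> y ∉ y) /\
  (forall y z u, y ∈ x -> z ∈ x -> u ∈ x -> y ∈ z -> z ∈ u -> y ∈ u) /\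
  (forall y z, y ∈ x -> z ∈ x -> y ∈ z \/ y = z \/ z ∈ y) /\
  (forall s, subset s x -> (exists y, y ∈ s) ->
     exists y, y ∈ s /\ forall z, z ∈ s -> y = z \/ y ∈ z).

Definition is_ordinal {M : SetStructure} (x : M) : Prop :=
  is_transitive x /\ well_ordered_by_mem x.

Definition ord_le {M : SetStructure} (a b : M) : Prop := a ∈ b \/ a = b.

(* 0 counts as a limit ordinal. *)
Definition is_limit {M : SetStructure} (a : M) : Prop :=
  is_ordinal a /\ ~ exists b, is_succ b a.

Definition is_natural {M : SetStructure} (n : M) : Prop :=
  is_ordinal n /\
  forall m, ord_le m n -> is_empty m \/ exists k, is_succ k m.

Definition is_omega {M : SetStructure} (w : M) : Prop :=
  forall x, x ∈ w <-> is_natural x.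

Fixpoint is_succ_iter {M : SetStructure} (n : nat) (x y : M) : Prop :=
  match n with
  | 0 => y = x
  | S n => exists z, is_succ_iter n x z /\ is_succ z y
  end.

(* c = a + b, by the recursion a + ξ = a ∪ {a + ζ : ζ < ξ} for ξ ≤ b. *)
Definition is_ord_sum {M : SetStructure} (a b c : M) : Prop :=
  exists f b1, is_succ b b1 /\ is_function_on f b1 /\
    (forall x y, pair_in f x y ->
       forall z, z ∈ y <-> (z ∈ a \/ exists u, u ∈ x /\ pair_in f u z)) /\
    pair_in f b c.

Definition is_even {M : SetStructure} (e : M) : Prop :=
  exists g n m, is_limit g /\ is_natural n /\
    is_ord_sum n n m /\ is_ord_sum g m e.

Definition is_sup {M : SetStructure} (P : M -> Prop) (s : M) : Prop :=
  is_ordinal s /\ (forall a, P a -> ord_le a s) /\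
  forall t, is_ordinal t -> (forall a, P a -> ord_le a t) -> ord_le s t.

(* v = V_a, by the recursion V_ξ = ⋃ {P(V_ζ) : ζ < ξ} for ξ ≤ a. *)
Definition is_V {M : SetStructure} (a v : M) : Prop :=
  exists f a1, is_succ a a1 /\ is_function_on f a1 /\
    (forall x y, pair_in f x y ->
       forall z, z ∈ y <-> exists u w, u ∈ x /\ pair_in f u w /\ subset z w) /\
    pair_in f a v.

(* k = ℵ(x) *)
Definition is_hartogs {M : SetStructure} (x k : M) : Prop :=
  is_ordinal k /\ ~ injects k x /\
  forall a, is_ordinal a -> ~ injects a x -> ord_le k a.

(* k = ℵ*(x) *)
Definition is_aleph_star {M : SetStructure} (x k : M) : Prop :=
  is_sup (fun b => exists a, is_ordinal a /\ surj_le a x /\ is_succ a b) k.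

(* t = θ_a *)
Definition is_theta {M : SetStructure} (a t : M) : Prop :=
  exists v, is_V a v /\
    is_sup (fun b => exists x, x ∈ v /\ is_aleph_star x b) t.

(** ** Satisfaction and elementary embeddings inside M

    An elementary embedding between sets of [M] refers to the formulas of [M],
    which are sets of [M]; if the ω of [M] is nonstandard, some of them
    correspond to no element of [formula].  The coding is
      v_i ∈ v_k : (0,(i,k))     v_i = v_k : (1,(i,k))     ¬p : (2,p)
      p ∧ q : (3,(p,q))         ∃v_i p : (4,(i,p)). *)

Definition is_tagged {M : SetStructure} (n : nat) (x t : M) : Prop :=
  exists e k, is_empty e /\ is_succ_iter n e k /\ is_opair k x t.

Definition is_tagged2 {M : SetStructure} (n : nat) (x y t : M) : Prop :=
  exists p, is_opair x y p /\ is_tagged n p t.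

Definition code_mem {M : SetStructure} (i k t : M) : Prop := is_tagged2 0 i k t.
Definition code_eq {M : SetStructure} (i k t : M) : Prop := is_tagged2 1 i k t.
Definition code_not {M : SetStructure} (p t : M) : Prop := is_tagged 2 p t.
Definition code_and {M : SetStructure} (p q t : M) : Prop := is_tagged2 3 p q t.
Definition code_ex {M : SetStructure} (i p t : M) : Prop := is_tagged2 4 i p t.

Definition formula_closed {M : SetStructure} (F : M) : Prop :=
  (forall i k t, is_natural i -> is_natural k -> code_mem i k t -> t ∈ F) /\
  (forall i k t, is_natural i -> is_natural k -> code_eq i k t -> t ∈ F) /\
  (forall p t, p ∈ F -> code_not p t -> t ∈ F) /\
  (forall p q t, p ∈ F -> q ∈ F -> code_and p q t -> t ∈ F) /\
  (forall i p t, is_natural i -> p ∈ F -> code_ex i p t -> t ∈ F).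

Definition is_formula {M : SetStructure} (p : M) : Prop :=
  forall F, formula_closed F -> p ∈ F.

Definition is_assignment {M : SetStructure} (A s : M) : Prop :=
  exists w, is_omega w /\ is_function s w A.

(* s' = s[i := a] *)
Definition is_update {M : SetStructure} (s i a s' : M) : Prop :=
  forall k y, pair_in s' k y <->
    ((k = i /\ y = a) \/ (k <> i /\ pair_in s k y)).

(* S is a satisfaction relation for the structure (A,∈): Tarski's clauses. *)
Definition is_satisfaction {M : SetStructure} (A S : M) : Prop :=
  forall s, is_assignment A s ->
    (forall i k t, is_natural i -> is_natural k -> code_mem i k t ->
       (pair_in S t s <->
        exists x y, pair_in s i x /\ pair_in s k y /\ x ∈ y)) /\
    (forall i k t, is_natural i -> is_natural k -> code_eq i k t ->
       (pair_in S t s <->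
        exists x y, pair_in s i x /\ pair_in s k y /\ x = y)) /\
    (forall p t, is_formula p -> code_not p t ->
       (pair_in S t s <-> ~ pair_in S p s)) /\
    (forall p q t, is_formula p -> is_formula q -> code_and p q t ->
       (pair_in S t s <-> pair_in S p s /\ pair_in S q s)) /\
    (forall i p t, is_natural i -> is_formula p -> code_ex i p t ->
       (pair_in S t s <->
        exists a s', a ∈ A /\ is_assignment A s' /\ is_update s i a s' /\
          pair_in S p s')).

(* (A,∈) ⊨ p[s] *)
Definition satisfies {M : SetStructure} (A p s : M) : Prop :=
  exists S, is_satisfaction A S /\ pair_in S p s.

Definition is_elementary_embedding {M : SetStructure} (j A B : M) : Prop :=
  is_function j A B /\
  forall p s s', is_formula p -> is_assignment A s -> is_assignment B s' ->
    (forall i x y, pair_in s i x -> pair_in s' i y -> pair_in j x y) ->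
    (satisfies A p s <-> satisfies B p s').

Definition is_nontrivial {M : SetStructure} (j : M) : Prop :=
  exists x y, pair_in j x y /\ x <> y.

(* Main.v *)
Require Import Defs.
From Stdlib Require Import Utf8 PeanoNat Lia Classical ClassicalEpsilon FunctionalExtensionality PropExtensionality.

(** Let X = V_{e+1} and θ = ℵ*(X). Taking preimages, every ordinal below θ injects into
    P(X) = V_{e+2}; suppose that f injects θ itself. If e is finite, j is trivial, so e is
    infinite. Coding sets by well-founded relations on V_{e+2} extends j to an elementary
    J : H → H, where H consists of the sets whose transitive closure is an image of V_{e+2}.
    Its critical point κ is below θ, and J(θ) = θ.

    As e is even, J restricted to X is coded by an element c of X, relative to a decoding D
    fixed by J. At a limit g one takes c = J restricted to V_g; a code for level x gives one for
    level x + 2, since y ∈ J(a) iff c ∈ J({s : {u : D(s,u) ∈ y} ∈ a}). Let B consist of the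
    pairs (β,b) such that f(b) = {u : D(s,u) ∈ J(f)(β)} for some s in X. As f is injective, each
    section B_β is canonically an image of X, and if J(γ') < β ≤ J(γ) then B_β meets (γ',γ].

    If a property definable in H holds of J with the parameters a and with J(a), then the
    common fixed points of all i in H with that property for a form a set K with J(K) = K on
    which J is the identity, so K has order type at most κ.

    There is no uniform sequence of surjections from X to the ordinals α < θ: a map i that
    moves such a sequence to its image under J, along a map coded in X, is determined by the
    code. So the values of these maps at any point are bounded below θ, their common fixed
    points are unbounded, and X would map onto θ. But such a sequence exists. If the order
    types of the B_β are unbounded, read it off from B. Otherwise define it by recursion on β:
    if β is not closed under J, apply J to the part already constructed; if it is, find a
    definable map from a smaller ordinal cofinally into β. Such a map comes from the values at
    points below β of the maps i in H that share the properties of J, or from their common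
    fixed points; if both fail, then unboundedly many g < β are elements or limits of B_β' for
    all large β' < β, and the bound on the order types of the B_β' yields the map. *)

Set Implicit Arguments.
Unset Strict Implicit.
Unset Printing Implicit Defensive.

(* A statement to which the embedding is applied cannot mention the embedding. It can mention the
   family of all maps i in H that share a recorded list of properties with J restricted to θ: the
   family is definable in H from a and J(a), and J sends it to the family defined from J(a) and
   J(J(a)), to which J restricted to θ belongs again. So a set of common fixed points is open to
   elementarity, while the set of fixed points of J alone is not. Continuity at suprema of
   ω-sequences is on the list because it produces fixed points.

   Two obstacles shape the rest. Successor levels of the hierarchy are not closed under Kuratowski
   pairs, hence flat pairs wherever relations on V_{e+1} or V_{e+2} are coded. And without choice
   the recursion on β needs a rule that finds a cofinal map from β alone, hence its case
   distinctions.

   Separation and Replacement hold only for formulas, so each set formed from a predicate comes with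
   a proof that the predicate is definable. *)
Existing Class ZF.

(** * De Bruijn formulas and definability *)

(** De Bruijn indices make definability stable under renaming and substitution; [to_named] leads
    back to the syntax in which the schemas of [ZF] are stated. *)
Inductive dform : Type :=
| dMem (i k : nat)
| dEq (i k : nat)
| dNot (p : dform)
| dAnd (p q : dform)
| dEx (p : dform).

Definition scons {T : Type} (a : T) (env : nat -> T) : nat -> T :=
  fun n => match n with 0 => a | S n => env n end.

Fixpoint dholds {M : SetStructure} (U : M -> Prop) (env : nat -> M) (p : dform) : Prop :=
  match p with
  | dMem i k => env i ∈ env k
  | dEq i k => env i = env k
  | dNot p => ~ dholds U env p
  | dAnd p q => dholds U env p /\ dholds U env q
  | dEx p => exists a : M, U a /\ dholds U (scons a env) p
  end.

Fixpoint holds_in {M : SetStructure} (U : M -> Prop) (env : nat -> M) (p : formula) : Prop :=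
  match p with
  | fMem i k => env i ∈ env k
  | fEq i k => env i = env k
  | fNot p => ~ holds_in U env p
  | fAnd p q => holds_in U env p /\ holds_in U env q
  | fEx i p => exists a : M, U a /\ holds_in U (upd env i a) p
  end.

Fixpoint rename (r : nat -> nat) (p : dform) : dform :=
  match p with
  | dMem i k => dMem (r i) (r k)
  | dEq i k => dEq (r i) (r k)
  | dNot p => dNot (rename r p)
  | dAnd p q => dAnd (rename r p) (rename r q)
  | dEx p => dEx (rename (fun n => match n with 0 => 0 | S n => S (r n) end) p)
  end.

Definition free_name (n : nat) : nat := match n with 0 => 0 | 1 => 1 | _ => 2 * n end.

(* Bound variables get odd names from 3 on, so that the names 0 and 1, special in
   the schemas of ZF, stay available for free variables. *)
Definition name (d i : nat) : nat :=
  if Nat.ltb i d then 2 * (d - 1 - i) + 3 else free_name (i - d).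

Fixpoint to_named (d : nat) (p : dform) : formula :=
  match p with
  | dMem i k => fMem (name d i) (name d k)
  | dEq i k => fEq (name d i) (name d k)
  | dNot p => fNot (to_named d p)
  | dAnd p q => fAnd (to_named d p) (to_named d q)
  | dEx p => fEx (2 * d + 3) (to_named (S d) p)
  end.

Section Formulas.
Context {M : SetStructure}.
Implicit Types (U Q : M -> Prop) (env : nat -> M).

Lemma dholds_ext U p env env' :
  (forall n, env n = env' n) -> dholds U env p <-> dholds U env' p.
Proof.
  intro H. replace env' with env by now apply functional_extensionality. tauto.
Qed.

Lemma dholds_rename U p : forall r env,
  dholds U env (rename r p) <-> dholds U (fun n => env (r n)) p.
Proof.
  induction p as [i k|i k|p IH|p IHp q IHq|p IH]; intros r env; simpl; try tauto.
  - rewrite IH; tauto.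
  - rewrite IHp, IHq; tauto.
  - split; intros [a [Ha H]]; exists a; (split; [exact Ha|]).
    + apply IH in H. eapply dholds_ext; [|exact H]. now intros [|n].
    + apply IH. eapply dholds_ext; [|exact H]. now intros [|n].
Qed.

Lemma holds_in_ext U p env env' :
  (forall n, env n = env' n) -> holds_in U env p <-> holds_in U env' p.
Proof.
  intro H. replace env' with env by now apply functional_extensionality. tauto.
Qed.

Lemma holds_in_all p : forall env, holds env p <-> holds_in (fun _ : M => True) env p.
Proof.
  induction p as [i k|i k|p IH|p IHp q IHq|i p IH]; intros env; simpl; try tauto.
  - now rewrite IH.
  - now rewrite IHp, IHq.
  - split; [intros [a H]; exists a | intros [a [_ H]]; exists a]; [split; auto|]; now apply IH.
Qed.

Lemma name_neq d i : name d i <> 2 * d + 3.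
Proof.
  unfold name, free_name. destruct (Nat.ltb_spec i d); [lia|].
  destruct (i - d) as [|[|n]]; lia.
Qed.

Lemma to_named_spec U p : forall d env env',
  (forall i, env i = env' (name d i)) ->
  dholds U env p <-> holds_in U env' (to_named d p).
Proof.
  induction p as [i k|i k|p IH|p IHp q IHq|p IH]; intros d env env' H; cbn [dholds holds_in to_named].
  - now rewrite !H.
  - now rewrite !H.
  - now rewrite (IH d env env').
  - now rewrite (IHp d env env'), (IHq d env env').
  - assert (E : forall a i, scons a env i = upd env' (2 * d + 3) a (name (S d) i)).
    { intros a [|i]; unfold upd; simpl scons.
      - replace (name (S d) 0) with (2 * d + 3); [now rewrite Nat.eqb_refl|].
        unfold name. simpl. lia.
      - replace (name (S d) (S i)) with (name d i).
        + destruct (Nat.eqb_spec (name d i) (2 * d + 3)) as [e|_]; [|apply H].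
          now apply name_neq in e.
        + unfold name. change (S i <? S d) with (i <? d).
          destruct (i <? d) eqn:L; [|reflexivity].
          apply Nat.ltb_lt in L. lia. }
    split; intros [a [Ha Hp]]; exists a; (split; [exact Ha|]).
    + now apply (IH _ _ _ (E a)).
    + now apply (IH _ _ _ (E a)) in Hp.
Qed.

(** Variables sit at even positions and parameters at odd ones, so both sequences may be
    infinite. *)
Definition mix env par : nat -> M :=
  fun n => if Nat.even n then env (Nat.div2 n) else par (Nat.div2 n).

Lemma mix_even env par n : mix env par (2 * n) = env n.
Proof. unfold mix. now rewrite Nat.even_mul, Nat.div2_double. Qed.

Lemma mix_odd env par n : mix env par (S (2 * n)) = par n.
Proof.
  unfold mix. rewrite Nat.even_succ, Nat.odd_mul, Nat.div2_succ_double. reflexivity.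
Qed.

(** [U] bounds the quantifiers and [Q] tells which elements may be parameters. With [Q] the fixed
    points of an elementary map, these are predicates that the map preserves. *)
Definition Dfn U Q (Phi : (nat -> M) -> Prop) : Prop :=
  exists p par, (forall n, Q (par n)) /\
    forall env, (forall n, U (env n)) -> (Phi env <-> dholds U (mix env par) p).

Lemma Dfn_ext U Q (Phi Psi : (nat -> M) -> Prop) :
  Dfn U Q Psi -> (forall env, (forall n, U (env n)) -> (Phi env <-> Psi env)) -> Dfn U Q Phi.
Proof.
  intros (p & par & Hp & H) E. exists p, par. split; [exact Hp|].
  intros env He. rewrite E by exact He. now apply H.
Qed.

Lemma Dfn_not U Q Phi : Dfn U Q Phi -> Dfn U Q (fun env => ~ Phi env).
Proof.
  intros (p & par & Hp & H). exists (dNot p), par. split; [exact Hp|].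
  intros env He. simpl. now rewrite H.
Qed.

Lemma even_or_odd n : {k | n = 2 * k} + {k | n = S (2 * k)}.
Proof.
  destruct (Nat.even n) eqn:E.
  - left. exists (Nat.div2 n). rewrite <- Nat.double_twice. apply Nat.Even_double.
    now apply Nat.even_spec.
  - right. exists (Nat.div2 n). rewrite <- Nat.double_twice. apply Nat.Odd_double.
    apply Nat.odd_spec. unfold Nat.odd. now rewrite E.
Qed.

Lemma Dfn_and U Q Phi Psi :
  Dfn U Q Phi -> Dfn U Q Psi -> Dfn U Q (fun env => Phi env /\ Psi env).
Proof.
  intros (p & par & Hp & H) (q & par' & Hq & H').
  (* The two parameter sequences are interleaved: [r b] sends parameter m to place 2m + b of the
     merged sequence. *)
  set (r := fun b n => if Nat.even n then n else S (2 * (2 * Nat.div2 n + b))).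
  exists (dAnd (rename (r 0) p) (rename (r 1) q)), (mix par par'). split.
  { intro n. unfold mix. destruct (Nat.even n); auto. }
  intros env He. cbn [dholds]. rewrite !dholds_rename, H, H' by exact He.
  assert (E : forall b k, b <= 1 -> mix env (mix par par') (r b k) =
     mix env (if b then par else par') k).
  { intros b k Hb. destruct (even_or_odd k) as [[m ->]|[m ->]]; unfold r.
    - rewrite Nat.even_mul. simpl negb. cbn [Nat.even orb]. now rewrite !mix_even.
    - rewrite Nat.even_succ, Nat.odd_mul. cbn [Nat.odd Nat.even negb andb].
      rewrite Nat.div2_succ_double, !mix_odd.
      destruct b as [|[|b]]; [|..|lia].
      + rewrite Nat.add_0_r. now rewrite mix_even.
      + rewrite Nat.add_1_r. now rewrite mix_odd. }
  rewrite (dholds_ext U p (fun k => E 0 k (Nat.le_0_l 1))).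
  rewrite (dholds_ext U q (fun k => E 1 k (le_n 1))). reflexivity.
Qed.

Lemma Dfn_or U Q Phi Psi :
  Dfn U Q Phi -> Dfn U Q Psi -> Dfn U Q (fun env => Phi env \/ Psi env).
Proof.
  intros A B. apply Dfn_ext with (fun env => ~ (~ Phi env /\ ~ Psi env)).
  - apply Dfn_not, Dfn_and; now apply Dfn_not.
  - intros env _. tauto.
Qed.

Lemma Dfn_imp U Q Phi Psi :
  Dfn U Q Phi -> Dfn U Q Psi -> Dfn U Q (fun env => Phi env -> Psi env).
Proof.
  intros A B. apply Dfn_ext with (fun env => ~ (Phi env /\ ~ Psi env)).
  - apply Dfn_not, Dfn_and; auto. now apply Dfn_not.
  - intros env _. tauto.
Qed.

Lemma Dfn_iff U Q Phi Psi :
  Dfn U Q Phi -> Dfn U Q Psi -> Dfn U Q (fun env => Phi env <-> Psi env).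
Proof. intros A B. apply Dfn_and; now apply Dfn_imp. Qed.

Lemma Dfn_rename U Q (r : nat -> nat) Phi :
  Dfn U Q Phi -> Dfn U Q (fun env => Phi (fun n => env (r n))).
Proof.
  intros (p & par & Hp & H).
  exists (rename (fun n => if Nat.even n then 2 * r (Nat.div2 n) else n) p), par.
  split; [exact Hp|]. intros env He. rewrite dholds_rename, H by auto.
  apply dholds_ext. intro n. destruct (even_or_odd n) as [[m ->]|[m ->]].
  - rewrite Nat.even_mul. cbn [Nat.even orb]. now rewrite Nat.div2_double, !mix_even.
  - rewrite Nat.even_succ, Nat.odd_mul. cbn [Nat.odd Nat.even negb andb]. now rewrite !mix_odd.
Qed.

Lemma Dfn_ex U Q (R : M -> (nat -> M) -> Prop) :
  Dfn U Q (fun env => R (env 0) (fun n => env (S n))) ->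
  Dfn U Q (fun env => exists y, U y /\ R y env).
Proof.
  intros (p & par & Hp & H).
  (* The formula expects the bound value in front of the variables, but the binder puts it in front
     of the interleaved sequence: position 2m + 2 is now found at 2m + 1, and position 2m + 1 at 2m
     + 2. *)
  exists (dEx (rename (fun n => match n with 0 => 0 | _ =>
      if Nat.even n then S (n - 2) else S n end) p)), par.
  split; [exact Hp|]. intros env He. cbn [dholds].
  assert (E : forall a, U a -> (R a env <-> dholds U (mix (scons a env) par) p)).
  { intros a Ha. rewrite <- H; [reflexivity|]. intros [|n]; simpl; auto. }
  assert (E' : forall a n, scons a (mix env par) (match n with 0 => 0 | _ =>
      if Nat.even n then S (n - 2) else S n end) = mix (scons a env) par n).
  { intros a n. destruct (even_or_odd n) as [[m ->]|[m ->]].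
    - destruct m as [|m]; [reflexivity|].
      replace (2 * S m) with (S (S (2 * m))) by lia. cbn [Nat.even].
      rewrite Nat.even_mul. cbn [Nat.even orb].
      replace (S (S (2 * m)) - 2) with (2 * m) by lia. cbn [scons].
      replace (S (S (2 * m))) with (2 * S m) by lia. now rewrite !mix_even.
    - rewrite Nat.even_succ, Nat.odd_mul. cbn [Nat.odd Nat.even negb andb scons].
      now rewrite !mix_odd. }
  split; intros [a [Ha Hr]]; exists a; (split; [exact Ha|]).
  - apply dholds_rename, (dholds_ext U p (E' a)). now apply E.
  - apply dholds_rename, (dholds_ext U p (E' a)) in Hr. now apply E.
Qed.

Lemma Dfn_all U Q (R : M -> (nat -> M) -> Prop) :
  Dfn U Q (fun env => R (env 0) (fun n => env (S n))) ->
  Dfn U Q (fun env => forall y, U y -> R y env).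
Proof.
  intro H. apply Dfn_ext with (fun env => ~ exists y, U y /\ ~ R y env).
  - now apply Dfn_not, (Dfn_ex (R := fun y env => ~ R y env)), Dfn_not.
  - intros env _. split; [intros A [y [B C]]; auto|].
    intros A y Hy. apply NNPP. intro. apply A. eauto.
Qed.

(** By excluded middle in the metatheory, a proposition without variables is equivalent to a
    trivially true or a trivially false formula, whatever it speaks of. *)
Lemma Dfn_const U Q (q : M) (A : Prop) : Q q -> Dfn U Q (fun _ => A).
Proof.
  intro Hq. destruct (classic A) as [H|H].
  - exists (dEq 0 0), (fun _ => q). split; [auto|]. intros. simpl. tauto.
  - exists (dNot (dEq 0 0)), (fun _ => q). split; [auto|]. intros. simpl. tauto.
Qed.

Definition DT U Q (t : (nat -> M) -> M) : Prop :=
  (forall env, (forall n, U (env n)) -> U (t env)) /\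
  Dfn U Q (fun env => env 0 = t (fun n => env (S n))).

Lemma Dfn_eqv U Q (q : M) i k : Q q -> Dfn U Q (fun env => env i = env k).
Proof.
  intro Hq. exists (dEq (2 * i) (2 * k)), (fun _ => q). split; [auto|].
  intros env _. cbn [dholds]. now rewrite !mix_even.
Qed.

Lemma Dfn_memv U Q (q : M) i k : Q q -> Dfn U Q (fun env => env i ∈ env k).
Proof.
  intro Hq. exists (dMem (2 * i) (2 * k)), (fun _ => q). split; [auto|].
  intros env _. cbn [dholds]. now rewrite !mix_even.
Qed.

Lemma DT_var U Q (q : M) k : Q q -> DT U Q (fun env => env k).
Proof. split; [auto|]. now apply (Dfn_eqv U 0 (S k) H). Qed.

Lemma DT_cst U Q c : Q c -> U c -> DT U Q (fun _ => c).
Proof.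
  split; [auto|]. exists (dEq 0 1), (fun _ => c). split; [auto|]. intros env _. simpl.
  unfold mix; simpl. tauto.
Qed.

Lemma DT_rename U Q (r : nat -> nat) t : DT U Q t -> DT U Q (fun env => t (fun n => env (r n))).
Proof.
  intros [A B]. split; [intros; apply A; auto|].
  exact (Dfn_rename (fun n => match n with 0 => 0 | S n => S (r n) end) B).
Qed.

(** Substituting a term amounts to quantifying over its value, which lies in [U]. *)
Lemma Dfn_sub U Q (Psi : M -> (nat -> M) -> Prop) t :
  DT U Q t -> Dfn U Q (fun env => Psi (env 0) (fun n => env (S n))) ->
  Dfn U Q (fun env => Psi (t env) env).
Proof.
  intros [A B] H. apply Dfn_ext with (fun env => exists y, U y /\ (y = t env /\ Psi y env)).
  - apply (Dfn_ex (R := fun y env => y = t env /\ Psi y env)). now apply Dfn_and.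
  - intros env He. split; [intro; exists (t env); auto|]. intros (y & _ & -> & P). exact P.
Qed.

Lemma Dfn_pred1 U Q (P : M -> Prop) s :
  Dfn U Q (fun env => P (env 0)) -> DT U Q s -> Dfn U Q (fun env => P (s env)).
Proof. intros H A. exact (Dfn_sub (Psi := fun y _ => P y) A H). Qed.

Lemma Dfn_pred2 U Q (P : M -> M -> Prop) s t :
  Dfn U Q (fun env => P (env 0) (env 1)) -> DT U Q s -> DT U Q t ->
  Dfn U Q (fun env => P (s env) (t env)).
Proof.
  intros H A B. apply (Dfn_sub (Psi := fun y env => P y (t env)) A).
  apply (Dfn_sub (Psi := fun y env => P (env 0) y) (DT_rename S B)).
  exact (Dfn_rename (fun n => match n with 0 => 1 | _ => 0 end) H).
Qed.

Lemma Dfn_pred3 U Q (P : M -> M -> M -> Prop) s t u :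
  Dfn U Q (fun env => P (env 0) (env 1) (env 2)) -> DT U Q s -> DT U Q t -> DT U Q u ->
  Dfn U Q (fun env => P (s env) (t env) (u env)).
Proof.
  intros H A B C. apply (Dfn_sub (Psi := fun y env => P y (t env) (u env)) A).
  apply (Dfn_sub (Psi := fun y env => P (env 0) y (u (fun n => env (S n)))) (DT_rename S B)).
  apply (Dfn_sub (Psi := fun y env => P (env 1) (env 0) y) (DT_rename (fun n => S (S n)) C)).
  exact (Dfn_rename (fun n => match n with 0 => 2 | 1 => 1 | _ => 0 end) H).
Qed.

Lemma Dfn_pred4 U Q (P : M -> M -> M -> M -> Prop) s t u v :
  Dfn U Q (fun env => P (env 0) (env 1) (env 2) (env 3)) ->
  DT U Q s -> DT U Q t -> DT U Q u -> DT U Q v ->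
  Dfn U Q (fun env => P (s env) (t env) (u env) (v env)).
Proof.
  intros H A B C D.
  apply (Dfn_sub (Psi := fun y env => P y (t env) (u env) (v env)) A).
  apply (Dfn_sub (Psi := fun y env => P (env 0) y (u (fun n => env (S n))) (v (fun n => env (S n)))) (DT_rename S B)).
  apply (Dfn_sub (Psi := fun y env => P (env 1) (env 0) y (v (fun n => env (S (S n))))) (DT_rename (fun n => S (S n)) C)).
  apply (Dfn_sub (Psi := fun y env => P (env 2) (env 1) (env 0) y) (DT_rename (fun n => S (S (S n))) D)).
  exact (Dfn_rename (fun n => match n with 0 => 3 | 1 => 2 | 2 => 1 | _ => 0 end) H).
Qed.

Lemma Dfn_pred5 U Q (P : M -> M -> M -> M -> M -> Prop) s t u v w :
  Dfn U Q (fun env => P (env 0) (env 1) (env 2) (env 3) (env 4)) ->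
  DT U Q s -> DT U Q t -> DT U Q u -> DT U Q v -> DT U Q w ->
  Dfn U Q (fun env => P (s env) (t env) (u env) (v env) (w env)).
Proof.
  intros H A B C D E.
  apply (Dfn_sub (Psi := fun y env => P y (t env) (u env) (v env) (w env)) A).
  apply (Dfn_sub (Psi := fun y env => P (env 0) y (u (fun n => env (S n))) (v (fun n => env (S n))) (w (fun n => env (S n)))) (DT_rename S B)).
  apply (Dfn_sub (Psi := fun y env => P (env 1) (env 0) y (v (fun n => env (S (S n)))) (w (fun n => env (S (S n))))) (DT_rename (fun n => S (S n)) C)).
  apply (Dfn_sub (Psi := fun y env => P (env 2) (env 1) (env 0) y (w (fun n => env (S (S (S n)))))) (DT_rename (fun n => S (S (S n))) D)).
  apply (Dfn_sub (Psi := fun y env => P (env 3) (env 2) (env 1) (env 0) y) (DT_rename (fun n => S (S (S (S n)))) E)).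
  exact (Dfn_rename (fun n => match n with 0 => 4 | 1 => 3 | 2 => 2 | 3 => 1 | _ => 0 end) H).
Qed.

Lemma DT_fun1 U Q (F : M -> M) s :
  DT U Q (fun env => F (env 0)) -> DT U Q s -> DT U Q (fun env => F (s env)).
Proof.
  intros [A B] S1. split.
  - intros env He. apply (A (fun _ => s env)). intros _. now apply S1.
  - apply (Dfn_sub (Psi := fun y env => env 0 = F y) (DT_rename S S1)).
    exact (Dfn_rename (fun n => match n with 0 => 1 | _ => 0 end) B).
Qed.

Lemma DT_fun2 U Q (F : M -> M -> M) s t :
  DT U Q (fun env => F (env 0) (env 1)) -> DT U Q s -> DT U Q t ->
  DT U Q (fun env => F (s env) (t env)).
Proof.
  intros [A B] S1 S2. split.
  - intros env He. apply (A (fun n => match n with 0 => s env | _ => t env end)).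
    intros [|n]; [now apply S1 | now apply S2].
  - apply (Dfn_pred3 (P := fun z x y => z = F x y) B).
    + split; [auto|]. destruct B as (_ & par & Hp & _). exact (Dfn_eqv U 0 1 (Hp 0)).
    + apply (DT_rename S S1).
    + apply (DT_rename S S2).
Qed.

Lemma DT_fun3 U Q (F : M -> M -> M -> M) s t u :
  DT U Q (fun env => F (env 0) (env 1) (env 2)) -> DT U Q s -> DT U Q t -> DT U Q u ->
  DT U Q (fun env => F (s env) (t env) (u env)).
Proof.
  intros [A B] S1 S2 S3. split.
  - intros env He. apply (A (fun n => match n with 0 => s env | 1 => t env | _ => u env end)).
    intros [|[|n]]; [now apply S1 | now apply S2 | now apply S3].
  - apply (Dfn_pred4 (P := fun z x y w => z = F x y w) B).
    + split; [auto|]. destruct B as (_ & par & Hp & _). exact (Dfn_eqv U 0 1 (Hp 0)).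
    + apply (DT_rename S S1).
    + apply (DT_rename S S2).
    + apply (DT_rename S S3).
Qed.

Lemma Dfn_mem U Q (q : M) s t :
  Q q -> DT U Q s -> DT U Q t -> Dfn U Q (fun env => s env ∈ t env).
Proof. intros Hq. apply (Dfn_pred2 (P := fun x y => x ∈ y) (Dfn_memv U 0 1 Hq)). Qed.

Lemma Dfn_eq U Q (q : M) s t :
  Q q -> DT U Q s -> DT U Q t -> Dfn U Q (fun env => s env = t env).
Proof. intros Hq. apply (Dfn_pred2 (P := fun x y => x = y) (Dfn_eqv U 0 1 Hq)). Qed.

Lemma Dfn_bex U Q t (R : M -> (nat -> M) -> Prop) :
  (forall x y, U x -> y ∈ x -> U y) -> DT U Q t ->
  Dfn U Q (fun env => R (env 0) (fun n => env (S n))) ->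
  Dfn U Q (fun env => exists y, y ∈ t env /\ R y env).
Proof.
  intros tr T H. apply Dfn_ext with (fun env => exists y, U y /\ (y ∈ t env /\ R y env)).
  - apply (Dfn_ex (R := fun y env => y ∈ t env /\ R y env)). apply Dfn_and; [|exact H].
    assert (exists q, Q q) as [q Hq] by (destruct H as (_ & par & Hp & _); exists (par 0); auto).
    apply (Dfn_mem Hq (DT_var U 0 Hq) (DT_rename S T)).
  - intros env He. split.
    + intros (y & A & B). exists y. split; [|auto]. apply (tr (t env)); [now apply T|exact A].
    + intros (y & _ & A). eauto.
Qed.

Lemma Dfn_ball U Q t (R : M -> (nat -> M) -> Prop) :
  (forall x y, U x -> y ∈ x -> U y) -> DT U Q t ->
  Dfn U Q (fun env => R (env 0) (fun n => env (S n))) ->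
  Dfn U Q (fun env => forall y, y ∈ t env -> R y env).
Proof.
  intros tr T H. apply Dfn_ext with (fun env => ~ exists y, y ∈ t env /\ ~ R y env).
  - apply Dfn_not, (Dfn_bex (R := fun y env => ~ R y env)); auto. now apply Dfn_not.
  - intros env _. split; [intros A [y [B C]]; auto|].
    intros A y Hy. apply NNPP. intro. apply A. eauto.
Qed.

End Formulas.

Definition everything (M : SetStructure) : M -> Prop := fun _ => True.
Notation Dfm := (Dfn (everything (M := _)) (everything (M := _))).
Notation DTm := (DT (everything (M := _)) (everything (M := _))).
Arguments everything {M} _.

Lemma Dfm_ex {M : SetStructure} (R : M -> (nat -> M) -> Prop) :
  Dfn everything everything (fun env => R (env 0) (fun n => env (S n))) ->
  Dfn everything everything (fun env => exists y, R y env).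
Proof.
  intro H. eapply Dfn_ext; [exact (Dfn_ex H)|]. intros env _. unfold everything.
  split; intros [y A]; exists y; tauto.
Qed.

Lemma Dfm_all {M : SetStructure} (R : M -> (nat -> M) -> Prop) :
  Dfn everything everything (fun env => R (env 0) (fun n => env (S n))) ->
  Dfn everything everything (fun env => forall y, R y env).
Proof.
  intro H. eapply Dfn_ext; [exact (Dfn_all H)|]. intros env _. unfold everything. firstorder.
Qed.

(* What the tactic [dfn] needs of the class [U] and of the constants [Q]. *)
Class Universe {M : SetStructure} (U Q : M -> Prop) : Prop := {
  univ_trans : forall x y : M, U x -> y ∈ x -> U y;
  univ_const : exists q, Q q
}.

Section Tactic.
Context {M : SetStructure} (U Q : M -> Prop) {HU : Universe U Q}.

Lemma Dconst (A : Prop) : Dfn U Q (fun _ => A).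
Proof. destruct (univ_const (U := U)) as [q Hq]. exact (Dfn_const U A Hq). Qed.
Lemma Dvar k : DT U Q (fun env => env k).
Proof. destruct (univ_const (U := U)) as [q Hq]. exact (DT_var U k Hq). Qed.
Lemma Dmem s t : DT U Q s -> DT U Q t -> Dfn U Q (fun env => s env ∈ t env).
Proof. destruct (univ_const (U := U)) as [q Hq]. exact (Dfn_mem Hq). Qed.
Lemma Deq s t : DT U Q s -> DT U Q t -> Dfn U Q (fun env => s env = t env).
Proof. destruct (univ_const (U := U)) as [q Hq]. exact (Dfn_eq Hq). Qed.
Lemma Dbex t (R : M -> (nat -> M) -> Prop) : DT U Q t ->
  Dfn U Q (fun env => R (env 0) (fun n => env (S n))) ->
  Dfn U Q (fun env => exists y, y ∈ t env /\ R y env).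
Proof. apply Dfn_bex. apply univ_trans. Qed.
Lemma Dball t (R : M -> (nat -> M) -> Prop) : DT U Q t ->
  Dfn U Q (fun env => R (env 0) (fun n => env (S n))) ->
  Dfn U Q (fun env => forall y, y ∈ t env -> R y env).
Proof. apply Dfn_ball. apply univ_trans. Qed.
End Tactic.

Ltac dfn_const := first [exact I | assumption].
Ltac dfn_hook0 := fail.
Ltac dfn_hook1 := fail.
Ltac dfn_hook2 := fail.
Ltac dfn_hook3 := fail.

(** Definability by recursion on the shape of the predicate. A quantifier is read as ranging over
    [U], failing that as bounded by a term, failing that as ranging over all of [M]. *)
Ltac dfn1 :=
  cbv beta;
  lazymatch goal with
  | |- Universe _ _ => typeclasses eauto
  | |- DT _ _ (fun _ => ?c) => apply DT_cst; dfn_const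
  | |- DT _ _ (fun env => env _) => apply Dvar
  | |- Dfn _ _ (fun _ => ?c) => apply Dconst
  | |- Dfn _ _ (fun env => @?A env /\ @?B env) => apply (@Dfn_and _ _ _ A B)
  | |- Dfn _ _ (fun env => @?A env \/ @?B env) => apply (@Dfn_or _ _ _ A B)
  | |- Dfn _ _ (fun env => ~ @?A env) => apply (@Dfn_not _ _ _ A)
  | |- Dfn _ _ (fun env => @?A env <-> @?B env) => apply (@Dfn_iff _ _ _ A B)
  | |- Dfn _ _ (fun env => exists y, (@?A env y) /\ (@?R env y)) =>
      first [ apply (@Dfn_ex _ _ _ (fun y env => R env y))
            | apply (@Dbex _ _ _ _ _ (fun y env => R env y))
            | apply (@Dfm_ex _ (fun y env => A env y /\ R env y)) ]
  | |- Dfn _ _ (fun env => exists y, @?R env y) => apply (@Dfm_ex _ (fun y env => R env y))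
  | |- Dfn _ _ (fun env => @?A env -> @?B env) => apply (@Dfn_imp _ _ _ A B)
  | |- Dfn _ _ (fun env => forall y, (@?A env y) -> (@?R env y)) =>
      first [ apply (@Dfn_all _ _ _ (fun y env => R env y))
            | apply (@Dball _ _ _ _ _ (fun y env => R env y))
            | apply (@Dfm_all _ (fun y env => A env y -> R env y)) ]
  | |- Dfn _ _ (fun env => forall y, @?R env y) => apply (@Dfm_all _ (fun y env => R env y))
  | |- Dfn _ _ (fun env => @?A env = @?B env) => apply (@Deq _ _ _ _ A B)
  | |- Dfn _ _ (fun env => @?A env ∈ @?B env) => apply (@Dmem _ _ _ _ A B)
  | |- _ => first [dfn_hook0 | dfn_hook1 | dfn_hook2 | dfn_hook3]
  end; cbv beta.
Ltac dfn := repeat dfn1.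

(** * Basic sets *)

(** Every element of [M] may be a parameter, so some variables can be frozen to given values; [r]
    tells which ones stay variable and where they are read. *)
Lemma Dfm_inst {M : SetStructure} (r : nat -> option nat) (e : nat -> M) (Psi : (nat -> M) -> Prop) :
  Dfn everything everything Psi ->
  Dfn everything everything
    (fun env => Psi (fun n => match r n with Some k => env k | None => e n end)).
Proof.
  intros (p & par & _ & Hp).
  exists (rename (fun n => if Nat.even n then
      match r (Nat.div2 n) with Some k => 2 * k | None => S (2 * n) end
    else S (2 * n)) p), (mix e par).
  split; [intro; exact I|]. intros env _. rewrite Hp by (intro; exact I).
  rewrite dholds_rename. apply dholds_ext. intro n.
  destruct (even_or_odd n) as [[m ->]|[m ->]].
  - rewrite mix_even, Nat.even_mul, Nat.div2_double. cbn [Nat.even orb].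
    destruct (r m) as [k|]; [now rewrite mix_even|]. now rewrite mix_odd, mix_even.
  - rewrite Nat.even_succ, Nat.odd_mul. cbn [Nat.odd Nat.even negb andb]. now rewrite !mix_odd.
Qed.

Section Sets.
Context {M : SetStructure} {HZF : ZF M}.
Implicit Types x y z a b f p : M.

Lemma ext x y : (forall z, z ∈ x <-> z ∈ y) -> x = y.
Proof. apply zf_extensionality; auto. Qed.

Lemma inhabited_M : inhabited M.
Proof. destruct (zf_infinity HZF) as [w _]. exact (inhabits w). Qed.

#[export] Instance Universe_everything : Universe (@everything M) (@everything M).
Proof.
  destruct inhabited_M as [q]. split; [unfold everything; auto | exists q; exact I].
Qed.

(** The choice operator of the metatheory names single sets. It yields no choice function inside
    [M]: its dependence on variables is shown to be definable only for properties with at most one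
    solution. *)
Definition eps (P : M -> Prop) : M := epsilon inhabited_M P.
Lemma epsP P : (exists x, P x) -> P (eps P).
Proof. apply epsilon_spec. Qed.

Definition upair x y := eps (is_pair x y).
Definition Un x := eps (fun u => forall z, z ∈ u <-> exists y, y ∈ x /\ z ∈ y).
Definition Pow x := eps (fun u => forall z, z ∈ u <-> subset z x).
Definition sep a (P : M -> Prop) := eps (fun b => forall x, x ∈ b <-> x ∈ a /\ P x).
Definition repl a (F : M -> M) := eps (fun b => forall y, y ∈ b <-> exists x, x ∈ a /\ y = F x).
Definition emp := eps (@is_empty M).
Definition sing x := upair x x.
Definition cup x y := Un (upair x y).
Definition opair x y := upair (sing x) (upair x y).
Definition succ x := cup x (sing x).

Lemma upairE x y z : z ∈ upair x y <-> z = x \/ z = y.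
Proof. exact (epsP (zf_pairing HZF x y) z). Qed.
Lemma UnE x z : z ∈ Un x <-> exists y, y ∈ x /\ z ∈ y.
Proof. exact (epsP (zf_union HZF x) z). Qed.
Lemma PowE x z : z ∈ Pow x <-> subset z x.
Proof. exact (epsP (zf_powerset HZF x) z). Qed.

Lemma sep_exists a (P : M -> Prop) : Dfn everything everything (fun env => P (env 0)) ->
  exists b, forall x, x ∈ b <-> x ∈ a /\ P x.
Proof.
  intros (p & par & _ & H).
  set (den := fun x => mix (scons x (fun _ => a)) par).
  (* From 2 on, the free variable n has the name 2n, hence the halving; the names 0 and 1 are
     kept. *)
  destruct (zf_separation HZF (to_named 0 p)
     (fun n => den a (if Nat.ltb n 2 then n else Nat.div2 n)) a) as [b Hb].
  exists b. intro x. rewrite Hb.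
  apply and_iff_compat_l. rewrite holds_in_all.
  etransitivity; [|symmetry; exact (H (scons x (fun _ => a)) (fun _ => I))].
  symmetry. apply to_named_spec. intros [|[|n]]; try reflexivity.
  change (name 0 (S (S n))) with (2 * S (S n)). unfold upd.
  destruct (Nat.eqb_spec (2 * S (S n)) 0); [lia|].
  destruct (Nat.ltb_spec (2 * S (S n)) 2); [lia|]. rewrite Nat.div2_double.
  unfold den, mix. destruct (Nat.even (S (S n))); reflexivity.
Qed.

Lemma sepE a (P : M -> Prop) : Dfn everything everything (fun env => P (env 0)) ->
  forall x, x ∈ sep a P <-> x ∈ a /\ P x.
Proof. intro H. exact (epsP (sep_exists a H)). Qed.

Lemma replE a (F : M -> M) : DT everything everything (fun env => F (env 0)) ->
  forall y, y ∈ repl a F <-> exists x, x ∈ a /\ y = F x.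
Proof.
  intros (_ & p & par & _ & H).
  refine (epsP (P := fun b => forall y, y ∈ b <-> exists x, x ∈ a /\ y = F x) _).
  (* In the definability of [F] the value stands at position 0 and the argument at position 2; the
     replacement schema wants them at 1 and 0. *)
  set (r := fun n => match n with 0 => 1 | 2 => 0 | n => S n end).
  set (den := fun x y => mix (scons y (scons x (fun _ => a))) par).
  set (d := fun n => den a a (n - 1)).
  assert (E : forall x y, y = F x <->
     holds (upd (upd (fun n => d (if Nat.ltb n 2 then n else Nat.div2 n)) 0 x) 1 y)
       (to_named 0 (rename r p))).
  { intros x y. rewrite holds_in_all.
    etransitivity; [exact (H (scons y (scons x (fun _ => a))) (fun _ => I))|].
    set (e := fun n => match n with 0 => x | 1 => y | _ => d n end).
    rewrite <- (to_named_spec everything (rename r p) (d := 0) (env := e)).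
    - rewrite dholds_rename. apply dholds_ext. intros [|[|[|n]]]; try reflexivity.
      cbn [r e d]. unfold d, den. replace (S (S (S (S n))) - 1) with (S (S (S n))) by lia.
      unfold mix. destruct (Nat.even (S (S (S n)))) eqn:V; [|reflexivity].
      destruct n; [discriminate|]. reflexivity.
    - intros [|[|n]]; try reflexivity.
      change (name 0 (S (S n))) with (2 * S (S n)). unfold upd.
      destruct (Nat.eqb_spec (2 * S (S n)) 0); [lia|].
      destruct (Nat.eqb_spec (2 * S (S n)) 1); [lia|].
      destruct (Nat.ltb_spec (2 * S (S n)) 2); [lia|]. now rewrite Nat.div2_double. }
  destruct (zf_replacement HZF (p := to_named 0 (rename r p)) (a := a)
    (env := fun n => d (if Nat.ltb n 2 then n else Nat.div2 n))) as [b Hb].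
  - intros x _. exists (F x). split; [now apply E|]. intros y Hy. symmetry. now apply E.
  - exists b. intro y. rewrite Hb. split; intros [x [A B]]; exists x; split; auto; now apply E.
Qed.

Lemma empE z : z ∉ emp.
Proof.
  refine (epsP (P := @is_empty M) _ z). destruct (sep_exists (P:=fun _ => False) (eps (fun _ => True)) (Dconst (U:=everything) (Q:=everything) False)) as [b Hb].
  exists b. intros u Hu. now apply Hb in Hu.
Qed.
Lemma singE x z : z ∈ sing x <-> z = x.
Proof. unfold sing. rewrite upairE. tauto. Qed.
Lemma cupE x y z : z ∈ cup x y <-> z ∈ x \/ z ∈ y.
Proof.
  unfold cup. rewrite UnE. split.
  - intros [u [A B]]. apply upairE in A as [->| ->]; auto.
  - intros [A|A]; [exists x|exists y]; (split; [apply upairE|]); auto.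
Qed.
Lemma succE x z : z ∈ succ x <-> z ∈ x \/ z = x.
Proof. unfold succ. now rewrite cupE, singE. Qed.

Lemma opair_inj x y x' y' : opair x y = opair x' y' -> x = x' /\ y = y'.
Proof.
  intro E. unfold opair in E.
  assert (A : forall u, u ∈ upair (sing x) (upair x y) <-> u ∈ upair (sing x') (upair x' y'))
    by (intro; now rewrite E).
  assert (X : x = x').
  { assert (B : sing x ∈ upair (sing x') (upair x' y')) by (apply A, upairE; auto).
    assert (x ∈ sing x) as Hx by now apply singE.
    assert (x' ∈ sing x) as Hx' by (apply upairE in B as [B|B]; rewrite B; [now apply singE|apply upairE; auto]).
    apply singE in Hx'. auto. }
  subst x'. split; [reflexivity|].
  assert (B : upair x y ∈ upair (sing x) (upair x y')) by (apply A, upairE; auto).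
  assert (C : upair x y' ∈ upair (sing x) (upair x y)) by (apply A, upairE; auto).
  assert (D : y ∈ upair x y) by (apply upairE; auto).
  assert (D' : y' ∈ upair x y') by (apply upairE; auto).
  apply upairE in B as [B|B]; apply upairE in C as [C|C].
  - rewrite B in D. rewrite C in D'. apply singE in D, D'. congruence.
  - rewrite B in D, C. rewrite C in D'. apply singE in D, D'. congruence.
  - rewrite C in D', B. rewrite B in D. apply singE in D, D'. congruence.
  - rewrite B in D. rewrite C in D'. apply upairE in D as [D|D]; apply upairE in D' as [D'|D']; congruence.
Qed.

(** The union of all values at x: it makes sense for arbitrary f and x, is the value when there is
    exactly one, and is empty when there is none. *)
Definition app f x := sep (Un (Un (Un f))) (fun z => exists y, opair x y ∈ f /\ z ∈ y).
Definition prod a b := sep (Pow (Pow (cup a b))) (fun p => exists x, x ∈ a /\ exists y, y ∈ b /\ p = opair x y).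
Definition lam a (F : M -> M) := repl a (fun x => opair x (F x)).
(** What makes pairs, unions, separation and application come out the same in [U] as in [M]. It is
    applied to [M] itself and to the hull H. *)
Definition Rich (U : M -> Prop) (Q : M -> Prop) : Prop :=
  (forall x y, U x -> U y -> U (upair x y)) /\ (forall x, U x -> U (Un x)) /\
  (forall x y, U x -> subset y x -> U y) /\
  Dfn everything everything (fun env => U (env 0)).
Existing Class Rich.
#[export] Instance Rich_everything : Rich everything everything.
Proof. repeat split; auto. exact (Dconst (U:=everything) (Q:=everything) True). Qed.

Section Rich.
Context (U Q : M -> Prop) {HU : Universe U Q} {HR : Rich U Q}.

(** Quantifiers over [U] are relativized, [U] being definable; separation then applies to predicates
    over [U]. *)
Lemma Dfn_to_everything Phi : Dfn U Q Phi -> exists Psi, Dfn everything everything Psi /\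
  forall env, (forall n, U (env n)) -> (Phi env <-> Psi env).
Proof.
  intros (p & par & Hp & H). destruct HR as (_ & _ & _ & D).
  assert (E : forall p : dform, Dfn everything everything (fun env => dholds U env p)).
  { clear p H. induction p as [i k|i k|p IH|p IHp q IHq|p IH]; cbn [dholds].
    - dfn.
    - dfn.
    - now apply Dfn_not.
    - now apply Dfn_and.
    - apply Dfm_ex. apply Dfn_and; [exact D|]. eapply Dfn_ext; [exact IH|].
      intros env _. apply dholds_ext. now intros [|n]. }
  destruct (E p) as (q & par' & _ & Hq).
  exists (fun env => dholds U (mix env par) p). split; [|exact H].
  exists (rename (fun n => if Nat.even n then (if Nat.even (Nat.div2 n) then 2 * Nat.div2 (Nat.div2 n)
      else S (2 * (2 * Nat.div2 (Nat.div2 n)))) else S (2 * n)) q), (mix par par').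
  split; [intro; exact I|]. intros env He. rewrite Hq by (intro; exact I).
  rewrite dholds_rename. apply dholds_ext. intro n.
  destruct (even_or_odd n) as [[m ->]|[m ->]].
  - rewrite Nat.even_mul. cbn [Nat.even orb]. rewrite mix_even, Nat.div2_double.
    destruct (even_or_odd m) as [[k ->]|[k ->]].
    + rewrite Nat.even_mul. cbn [Nat.even orb]. rewrite mix_even, Nat.div2_double. now rewrite mix_even.
    + rewrite Nat.even_succ, Nat.odd_mul. cbn [Nat.odd Nat.even negb andb].
      rewrite !mix_odd, Nat.div2_succ_double. now rewrite mix_even.
  - rewrite Nat.even_succ, Nat.odd_mul. cbn [Nat.odd Nat.even negb andb].
    now rewrite !mix_odd.
Qed.

Lemma DT_upair s t : DT U Q s -> DT U Q t -> DT U Q (fun env => upair (s env) (t env)).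
Proof.
  apply (DT_fun2 (F := upair)). split.
  - intros env He. now apply HR.
  - apply Dfn_ext with (fun env => env 1 ∈ env 0 /\ env 2 ∈ env 0 /\
      forall w, w ∈ env 0 -> w = env 1 \/ w = env 2); [dfn|].
    intros env _. split.
    + intros ->. split; [|split]; [apply upairE; auto ..|]. intros w Hw. now apply upairE.
    + intros (A & B & C). apply ext. intro z. rewrite upairE. split; [apply C|].
      intros [->| ->]; auto.
Qed.
Lemma DT_Un s : DT U Q s -> DT U Q (fun env => Un (s env)).
Proof.
  apply (DT_fun1 (F := Un)). split.
  - intros env He. now apply HR.
  - apply Dfn_ext with (fun env => (forall w, w ∈ env 0 -> exists y, y ∈ env 1 /\ w ∈ y) /\
      forall y, y ∈ env 1 -> forall w, w ∈ y -> w ∈ env 0); [dfn|].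
    intros env _. split.
    + intros ->. split; intro w; [apply UnE|]. intros A z B. apply UnE. eauto.
    + intros (A & B). apply ext. intro z. rewrite UnE. split; [apply A|]. intros (y & C & D). eauto.
Qed.
Lemma DT_sing s : DT U Q s -> DT U Q (fun env => sing (s env)).
Proof. intro. now apply DT_upair. Qed.
Lemma DT_opair s t : DT U Q s -> DT U Q t -> DT U Q (fun env => opair (s env) (t env)).
Proof. intros. now repeat apply DT_upair. Qed.
Lemma DT_cup s t : DT U Q s -> DT U Q t -> DT U Q (fun env => cup (s env) (t env)).
Proof. intros. now apply DT_Un, DT_upair. Qed.
Lemma DT_succ s : DT U Q s -> DT U Q (fun env => succ (s env)).
Proof. intros. now apply DT_cup; [|apply DT_sing]. Qed.

Lemma sep_richE s (P : M -> (nat -> M) -> Prop) : DT U Q s ->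
  Dfn U Q (fun env => P (env 0) (fun n => env (S n))) ->
  forall env, (forall n, U (env n)) -> forall x,
    x ∈ sep (s env) (fun x => P x env) <-> x ∈ s env /\ P x env.
Proof.
  intros S1 HP env He. destruct (Dfn_to_everything HP) as (Psi & D & HPsi).
    refine (epsP (P := fun b => forall x, x ∈ b <-> x ∈ s env /\ P x env) _).
    destruct (sep_exists (s env) (P := fun x => (U x /\ Psi (scons x env)))) as [b Hb].
    - apply Dfn_and; [apply HR|]. eapply Dfn_ext; [exact (Dfm_inst (fun n => match n with 0 => Some 0 | _ => None end) (fun n => env (pred n)) D)|].
        intros en _. enough (E : scons (en 0) env = fun n => match n with 0 => en 0 | _ => env (pred n) end)
          by (rewrite E; enough (E' : (fun n => match (match n with 0 => Some 0 | _ => None end) with Some k => en k | None => env (pred n) end) = (fun n => match n with 0 => en 0 | _ => env (pred n) end)) by (rewrite E'; reflexivity); apply functional_extensionality; now intros [|n]).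
        apply functional_extensionality; now intros [|n].
    - exists b. intro x. rewrite Hb.
      assert (Hs : U (s env)) by now apply S1.
      split; intros (A & B); (split; [exact A|]).
      + destruct B as [B C]. apply (HPsi (scons x env)); [|exact C]. now intros [|n]; simpl.
      + assert (Ux : U x) by exact (univ_trans Hs A). split; [exact Ux|].
        apply (HPsi (scons x env)); [|exact B]. now intros [|n]; simpl.
Qed.

Lemma DT_sep s (P : M -> (nat -> M) -> Prop) : DT U Q s ->
  Dfn U Q (fun env => P (env 0) (fun n => env (S n))) ->
  DT U Q (fun env => sep (s env) (fun x => P x env)).
Proof.
  intros S1 HP. assert (E := sep_richE S1 HP).
  split.
  - intros env He. apply HR with (s env); [now apply S1|]. intros z Hz. now apply E in Hz.
  - apply Dfn_ext with (fun env => (forall w, w ∈ env 0 -> w ∈ s (fun n => env (S n)) /\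
        P w (fun n => env (S n))) /\ forall w, w ∈ s (fun n => env (S n)) ->
        P w (fun n => env (S n)) -> w ∈ env 0).
    + apply (DT_rename S) in S1.
      apply (Dfn_rename (fun n => match n with 0 => 0 | S n => S (S n) end)) in HP.
      apply Dfn_and; apply Dball; dfn; try assumption; now apply (DT_rename S) in S1.
    + intros env He. specialize (E (fun n => env (S n))). split.
      * intros ->. split; intros w; rewrite E; auto.
      * intros (A & B). apply ext. intro z. rewrite E by auto. split; [apply A|].
        intros (C & D). auto.
Qed.

Lemma DT_app s t : DT U Q s -> DT U Q t -> DT U Q (fun env => app (s env) (t env)).
Proof.
  intros A B.
  (* The existential quantifier in [app] ranges over [M]; bounding it by a term makes the definition
     meaningful over [U]. *)
  assert (C : DT U Q (fun env => sep (Un (Un (Un (s env))))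
    (fun z => exists y, y ∈ Un (Un (s env)) /\ (opair (t env) y ∈ s env /\ z ∈ y)))).
  { apply (DT_sep (P := fun z env => exists y, y ∈ Un (Un (s env)) /\ (opair (t env) y ∈ s env /\ z ∈ y))).
    - now repeat (apply DT_Un; [typeclasses eauto..|]).
    - apply (@Dbex _ _ _ _ _ (fun y env => opair (t (fun n => env (S n))) y ∈ s (fun n => env (S n)) /\ env 0 ∈ y)); [|].
      + do 2 (apply DT_Un; [typeclasses eauto..|]). exact (DT_rename S A).
      + apply Dfn_and; [|dfn]. apply Dmem; [typeclasses eauto| |exact (DT_rename (fun n => S (S n)) A)].
        apply DT_opair; [typeclasses eauto..| |]; [exact (DT_rename (fun n => S (S n)) B)|dfn]. }
  enough (E : forall f x, app f x = sep (Un (Un (Un f)))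
    (fun z => exists y, y ∈ Un (Un f) /\ (opair x y ∈ f /\ z ∈ y))).
  { destruct C as [C1 C2]. split; [intros; rewrite E; now apply C1|].
    eapply Dfn_ext; [exact C2|]. intros. now rewrite E. }
  intros f x. unfold app. f_equal. apply functional_extensionality. intro z.
  apply propositional_extensionality. split; intros (y & D); exists y; [|tauto].
  split; [|exact D]. destruct D as [D _]. apply UnE. exists (upair x y).
  split; [apply UnE; exists (opair x y); split; [exact D|]|]; apply upairE; auto.
Qed.
End Rich.

Lemma DTm_repl s (F : M -> (nat -> M) -> M) : DT everything everything s ->
  DT everything everything (fun env => F (env 0) (fun n => env (S n))) ->
  DT everything everything (fun env => repl (s env) (fun x => F x env)).
Proof.
  intros S1 [_ D]. split; [intros; exact I|].
  apply Dfn_ext with (fun env => forall z, z ∈ env 0 <-> exists x, x ∈ s (fun n => env (S n)) /\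
    z = F x (fun n => env (S n))).
  - apply (DT_rename (fun n => S (S n))) in S1. apply Dfm_all, Dfn_iff; [dfn|].
    apply Dbex; [typeclasses eauto|exact S1|].
    exact (Dfn_rename (fun n => match n with 0 => 1 | 1 => 0 | _ => S n end) D).
  - intros env _. set (e := fun n => env (S n)).
    assert (E : forall z, z ∈ repl (s e) (fun x => F x e) <-> exists x, x ∈ s e /\ z = F x e).
    { apply replE. split; [intros; exact I|].
      eapply Dfn_ext; [exact (Dfm_inst (fun n => match n with 0 => Some 0 | 1 => Some 1 | _ => None end)
        (fun n => e (pred (pred n))) D)|]. intros en _. simpl. reflexivity. }
    split; [intros ->; exact E|]. intro H. apply ext. intro z. now rewrite H, E.
Qed.

Lemma DTm_Pow s : DT everything everything s -> DT everything everything (fun env => Pow (s env)).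
Proof.
  apply (DT_fun1 (F := Pow)). split; [intros; exact I|].
  apply Dfn_ext with (fun env => forall z, z ∈ env 0 <-> (forall w, w ∈ z -> w ∈ env 1)); [dfn|].
  intros env _. split; [intros -> z; apply PowE|]. intro H. apply ext. intro z. now rewrite PowE.
Qed.

End Sets.

Ltac dfn_hook0 ::= lazymatch goal with
  | |- Rich _ _ => typeclasses eauto
  | |- DT _ _ (fun env => upair (@?a env) (@?b env)) => apply (@DT_upair _ _ _ _ _ _ a b)
  | |- DT _ _ (fun env => opair (@?a env) (@?b env)) => apply (@DT_opair _ _ _ _ _ _ a b)
  | |- DT _ _ (fun env => cup (@?a env) (@?b env)) => apply (@DT_cup _ _ _ _ _ _ a b)
  | |- DT _ _ (fun env => app (@?a env) (@?b env)) => apply (@DT_app _ _ _ _ _ _ a b)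
  | |- DT _ _ (fun env => sing (@?a env)) => apply (@DT_sing _ _ _ _ _ _ a)
  | |- DT _ _ (fun env => succ (@?a env)) => apply (@DT_succ _ _ _ _ _ _ a)
  | |- DT _ _ (fun env => Un (@?a env)) => apply (@DT_Un _ _ _ _ _ _ a)
  | |- DT _ _ (fun env => repl (@?a env) (fun x => @?F env x)) =>
      apply (@DTm_repl _ _ a (fun x env => F env x))
  | |- DT _ _ (fun env => Pow (@?a env)) => apply (@DTm_Pow _ _ a)
  | |- DT _ _ (fun env => sep (@?a env) (fun x => @?P env x)) =>
      apply (@DT_sep _ _ _ _ _ _ a (fun x env => P env x))
  end.

(** * Functions and well-founded recursion *)

Section Functions.
Context {M : SetStructure} {HZF : ZF M}.
Implicit Types x y z a b f g : M.

Lemma subset_antisym x y : subset x y -> subset y x -> x = y.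
Proof. intros A B. apply ext. intro z. split; [apply A|apply B]. Qed.

Lemma subset_trans x y z : subset x y -> subset y z -> subset x z.
Proof. intros A B u Hu. auto. Qed.

(** Where there is no solution, extensionality identifies the property with the empty one, so the
    operator returns one fixed set. The definition by cases includes this default. *)
Lemma DTm_eps (P : M -> (nat -> M) -> Prop) :
  Dfn everything everything (fun env => P (env 0) (fun n => env (S n))) ->
  (forall env y y', P y env -> P y' env -> y = y') ->
  DT everything everything (fun env => eps (fun y => P y env)).
Proof.
  intros D U. split; [intros; exact I|].
  apply Dfn_ext with (fun env => P (env 0) (fun n => env (S n)) \/
    (~ exists y, P y (fun n => env (S n))) /\ env 0 = eps (fun _ => False)).
  - apply Dfn_or; [exact D|]. apply Dfn_and; [|dfn]. apply Dfn_not.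
    apply (Dfm_ex (R := fun y env => P y (fun n => env (S n)))).
    exact (Dfn_rename (fun n => match n with 0 => 0 | S n => S (S n) end) D).
  - intros env _. set (e := fun n => env (S n)). split.
    + intros ->. destruct (classic (exists y, P y e)) as [E|E].
      * left. exact (epsP E).
      * right. split; [exact E|]. f_equal. apply functional_extensionality. intro y.
        apply propositional_extensionality. split; [|tauto]. intro. apply E. eauto.
    + intros [A|[A ->]].
      * apply (U e); [exact A|]. apply epsP. eauto.
      * f_equal. apply functional_extensionality. intro y.
        apply propositional_extensionality. split; [tauto|]. intro. apply A. eauto.
Qed.

Lemma prodE a b p : p ∈ prod a b <-> exists x, x ∈ a /\ exists y, y ∈ b /\ p = opair x y.
Proof.
  unfold prod. rewrite sepE by dfn. split; [tauto|]. intro H. split; [|exact H].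
  destruct H as (x & Hx & y & Hy & ->). apply PowE. intros z Hz. apply PowE. intros w Hw.
  apply cupE. apply upairE in Hz as [->| ->]; [apply singE in Hw|apply upairE in Hw as [Hw|Hw]];
  subst; auto.
Qed.

Lemma opair_prod a b x y : opair x y ∈ prod a b <-> x ∈ a /\ y ∈ b.
Proof.
  rewrite prodE. split.
  - intros (x' & A & y' & B & E). apply opair_inj in E as [-> ->]. auto.
  - intros [A B]. eauto 6.
Qed.

Lemma app_val f x y : opair x y ∈ f -> (forall y', opair x y' ∈ f -> y' = y) -> app f x = y.
Proof.
  intros A B. apply ext. intro z. unfold app. rewrite sepE by dfn. split.
  - intros [_ (y' & C & D)]. now rewrite <- (B _ C).
  - intro Hz. split; [|eauto]. apply UnE. exists y. split; [|exact Hz]. apply UnE.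
    exists (upair x y). split; [apply UnE; exists (opair x y); split; [exact A|]|]; apply upairE; auto.
Qed.

(** Writing every pair with [app] expresses the domain and single-valuedness at once. *)
Definition isfn f a : Prop := forall p, p ∈ f <-> exists x, x ∈ a /\ p = opair x (app f x).

Lemma isfn_pair f a x y : isfn f a -> opair x y ∈ f <-> x ∈ a /\ y = app f x.
Proof.
  intro H. rewrite (H _). split.
  - intros (x' & A & E). apply opair_inj in E as [-> ->]. auto.
  - intros [A ->]. eauto.
Qed.

Lemma isfn_intro f a :
  (forall p, p ∈ f -> exists x y, x ∈ a /\ p = opair x y) ->
  (forall x, x ∈ a -> exists y, opair x y ∈ f) ->
  (forall x y y', opair x y ∈ f -> opair x y' ∈ f -> y = y') -> isfn f a.
Proof.
  intros A B C p. split.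
  - intro Hp. destruct (A p Hp) as (x & y & Hx & ->). exists x. split; [exact Hx|].
    f_equal. symmetry. apply app_val; eauto.
  - intros (x & Hx & ->). destruct (B x Hx) as [y Hy]. rewrite (app_val Hy); eauto.
Qed.

Lemma isfn_ext f g a : isfn f a -> isfn g a -> (forall x, x ∈ a -> app f x = app g x) -> f = g.
Proof.
  intros F G E. apply ext. intro p. rewrite (F p), (G p).
  split; intros (x & Hx & ->); exists x; (split; [exact Hx|]); now rewrite E.
Qed.

Lemma lamE a (F : M -> M) : DT everything everything (fun env => F (env 0)) ->
  forall p, p ∈ lam a F <-> exists x, x ∈ a /\ p = opair x (F x).
Proof. intros H p. unfold lam. rewrite replE; [reflexivity|]. dfn. exact H. Qed.

Lemma lam_fn a (F : M -> M) : DT everything everything (fun env => F (env 0)) ->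
  isfn (lam a F) a /\ forall x, x ∈ a -> app (lam a F) x = F x.
Proof.
  intro H.
  assert (E : forall x, x ∈ a -> app (lam a F) x = F x).
  { intros x Hx. apply app_val.
    - apply lamE; eauto.
    - intros y Hy. apply lamE in Hy as (x' & _ & E); [|exact H].
      now apply opair_inj in E as [-> ->]. }
  split; [|exact E]. intro p. rewrite lamE by exact H.
  split; intros (x & Hx & ->); exists x; rewrite E; auto.
Qed.

Section Recursion.
Variables (A : M) (R : M -> M -> Prop) (G : M -> M -> M).
Hypothesis DR : Dfn everything everything (fun env => R (env 0) (env 1)).
Hypothesis DG : DT everything everything (fun env => G (env 0) (env 1)).
Hypothesis wf : forall Z, subset Z A -> (exists z, z ∈ Z) ->
  exists z, z ∈ Z /\ forall y, y ∈ Z -> ~ R y z.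

Let DR' s t : DT everything everything s -> DT everything everything t ->
  Dfn everything everything (fun env => R (s env) (t env)).
Proof. apply (Dfn_pred2 DR). Qed.
Let DG' s t : DT everything everything s -> DT everything everything t ->
  DT everything everything (fun env => G (s env) (t env)).
Proof. apply (DT_fun2 DG). Qed.
Ltac dfr := repeat first [dfn1 | apply DR' | apply DG'].

Definition res f x : M := sep f (fun p => exists y, R y x /\ exists z, p = opair y z).

Let DTres s t : DT everything everything s -> DT everything everything t ->
  DT everything everything (fun env => res (s env) (t env)).
Proof. apply (DT_fun2 (F := res)). unfold res. dfr. Qed.

Lemma resE f x p : p ∈ res f x <-> p ∈ f /\ exists y, R y x /\ exists z, p = opair y z.
Proof. unfold res. rewrite sepE; [reflexivity|]. dfr. Qed.

Let approx f B : Prop := isfn f B /\ subset B A /\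
  (forall x y, x ∈ B -> y ∈ A -> R y x -> y ∈ B) /\
  (forall x, x ∈ B -> (forall y, R y x -> y ∈ B -> y ∈ A) /\ app f x = G x (res f x)).

Let approx_unique f B f' B' x : approx f B -> approx f' B' -> x ∈ B -> x ∈ B' -> app f x = app f' x.
Proof.
  intros (F & S1 & D1 & E1) (F' & S2 & D2 & E2) Hx Hx'. apply NNPP. intro N.
  set (Z := sep B (fun x => x ∈ B' /\ app f x <> app f' x)).
  assert (HZ : forall z, z ∈ Z <-> z ∈ B /\ z ∈ B' /\ app f z <> app f' z)
    by (intro; unfold Z; rewrite sepE; [reflexivity|dfn]).
  destruct (wf (Z := Z)) as (z & Hz & Min).
  - intros z Hz. apply HZ in Hz. now apply S1.
  - exists x. apply HZ. auto.
  - apply HZ in Hz as (Hz & Hz' & Ne). apply Ne.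
    rewrite (proj2 (E1 _ Hz)), (proj2 (E2 _ Hz')). f_equal.
    assert (K : forall y, y ∈ A -> R y z -> app f y = app f' y).
    { intros y Hy Ry. apply NNPP. intro N'. apply (Min y); [|exact Ry]. apply HZ.
      repeat split; eauto. }
    apply ext. intro p. rewrite !resE.
    split; intros (Hp & y & Ry & w & ->); (split; [|eauto]).
    + apply (isfn_pair _ _ F) in Hp as [Hy ->]. apply (isfn_pair _ _ F').
      split; [apply (D2 z); auto|apply K; auto].
    + apply (isfn_pair _ _ F') in Hp as [Hy ->]. apply (isfn_pair _ _ F).
      split; [apply (D1 z); auto|]. symmetry. apply K; auto.
Qed.

(** Approximations live on subsets of A closed under predecessors. Any two agree where both are
    defined, so they glue to a largest one; at a minimal point outside its domain it could be
    extended. *)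
Theorem wf_recursion : exists F, isfn F A /\ forall x, x ∈ A -> app F x = G x (res F x).
Proof.
  set (P := fun y x => exists f B, approx f B /\ x ∈ B /\ y = app f x).
  set (v := fun x => eps (fun y => P y x)).
  assert (DP : Dfn everything everything (fun env => P (env 0) (env 1))).
  { unfold P, approx, isfn, subset. repeat first [dfn1 | apply DR' | apply DG' | apply DTres]. }
  assert (Dv : DT everything everything (fun env => v (env 0))).
  { unfold v. apply (@DTm_eps (fun y env => P y (env 0))).
    - exact DP.
    - intros env y y' (f & B & H & Hx & ->) (f' & B' & H' & Hx' & ->).
      now apply (approx_unique H H'). }
  set (O := sep A (fun x => exists y, P y x)).
  assert (HO : forall x, x ∈ O <-> x ∈ A /\ exists y, P y x).
  { intro x. unfold O. rewrite sepE; [reflexivity|]. apply Dfm_ex. exact DP. }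
  assert (Hv : forall f B x, approx f B -> x ∈ B -> v x = app f x).
  { intros f B x H Hx. assert (E : P (v x) x) by (apply epsP; exists (app f x), f, B; auto).
    destruct E as (f' & B' & H' & Hx' & ->). now apply (approx_unique H' H). }
  assert (HA : forall f B x, approx f B -> x ∈ B -> x ∈ O).
  { intros f B x H Hx. apply HO. split; [now apply H|]. exists (app f x), f, B. auto. }
  destruct (lam_fn O Dv) as [F0 E0]. set (f0 := lam O v) in *.
  assert (DO : forall x y, x ∈ O -> y ∈ A -> R y x -> y ∈ O).
  { intros x y Hx Hy Ry. apply HO in Hx as [Hx (w & f & B & H & HxB & ->)].
    apply (HA f B); [exact H|]. apply H with x; auto. }
  assert (A0 : approx f0 O).
  { split; [exact F0|]. split; [intros x Hx; now apply HO in Hx|]. split; [exact DO|].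
    intros x Hx. split; [intros y _ Hy; now apply HO in Hy|].
    rewrite (E0 x Hx). assert (Hx' := Hx). apply HO in Hx as [Hx (w & f & B & H & HxB & _)].
    rewrite (Hv f B x H HxB). rewrite (proj2 (proj2 (proj2 (proj2 H)) x HxB)). f_equal.
    apply ext. intro p. rewrite !resE.
    split; intros (Hp & y & Ry & z & ->); (split; [|eauto]).
    - apply (isfn_pair _ _ (proj1 H)) in Hp as [Hy ->]. apply (isfn_pair _ _ F0).
      assert (HyO : y ∈ O) by eauto. split; [exact HyO|]. rewrite E0 by exact HyO.
      symmetry. eapply Hv; eauto.
    - apply (isfn_pair _ _ F0) in Hp as [Hy ->]. apply (isfn_pair _ _ (proj1 H)).
      assert (HyB : y ∈ B) by (apply H with x; auto; now apply HO in Hy).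
      split; [exact HyB|]. rewrite E0 by exact Hy. eapply Hv; eauto. }
  exists f0. assert (EO : O = A).
  { apply ext. intro x. split; [intro Hx; now apply HO in Hx|]. intro Hx. apply NNPP. intro N.
    set (Z := sep A (fun x => x ∉ O)).
    assert (HZ : forall z, z ∈ Z <-> z ∈ A /\ z ∉ O)
      by (intro; unfold Z; rewrite sepE; [reflexivity|dfn]).
    destruct (wf (Z := Z)) as (z & Hz & Min).
    - intros z Hz. now apply HZ in Hz.
    - exists x. now apply HZ.
    - apply HZ in Hz as [Hz NO]. apply NO.
      set (f1 := cup f0 (sing (opair z (G z (res f0 z))))).
      assert (B1 : forall p, p ∈ f1 <-> p ∈ f0 \/ p = opair z (G z (res f0 z)))
        by (intro; unfold f1; now rewrite cupE, singE).
      assert (V1 : forall y, y ∈ O -> app f1 y = app f0 y).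
      { intros y Hy. apply app_val.
        - apply B1. left. now apply (isfn_pair _ _ F0).
        - intros y' Hy'. apply B1 in Hy' as [Hy'|E].
          + now apply (isfn_pair _ _ F0) in Hy' as [_ ->].
          + apply opair_inj in E as [-> _]. contradiction. }
      assert (V2 : app f1 z = G z (res f0 z)).
      { apply app_val.
        - apply B1. auto.
        - intros y' Hy'. apply B1 in Hy' as [Hy'|E].
          + apply (isfn_pair _ _ F0) in Hy' as [Hy' _]. contradiction.
          + now apply opair_inj in E as [_ ->]. }
      assert (NR : forall y, (y ∈ O \/ y = z) -> ~ R z y).
      { intros y [Hy| ->] Rz; [apply NO; eauto|]. apply (Min z); [apply HZ; auto|exact Rz]. }
      assert (RS : forall y, (y ∈ O \/ y = z) -> res f1 y = res f0 y).
      { intros y Hy. apply ext. intro p. rewrite !resE, B1.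
        split; intros (Hp & y' & Ry & w & ->); (split; [|eauto]); [|auto].
        destruct Hp as [Hp|E]; [exact Hp|]. apply opair_inj in E as [-> _].
        now apply NR in Ry. }
      apply (HA f1 (cup O (sing z))); [|apply cupE; right; now apply singE].
      assert (C1 : forall y, y ∈ cup O (sing z) <-> y ∈ O \/ y = z)
        by (intro; now rewrite cupE, singE).
      split; [|split; [|split]].
      + intro p. rewrite B1, (F0 p). split.
        * intros [(y & Hy & ->)| ->]; [exists y|exists z]; (split; [apply C1; auto|]).
          -- now rewrite V1.
          -- now rewrite V2.
        * intros (y & Hy & ->). apply C1 in Hy as [Hy| ->].
          -- left. exists y. now rewrite V1.
          -- right. now rewrite V2.
      + intros y Hy. apply C1 in Hy as [Hy| ->]; [now apply HO in Hy|exact Hz].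
      + intros y y' Hy Hy' Ry. apply C1. left. apply C1 in Hy as [Hy| ->]; [eauto|].
        apply NNPP. intro NO'. apply (Min y'); [now apply HZ|exact Ry].
      + intros y Hy. apply C1 in Hy. split.
        * intros y' _ Hy'. apply C1 in Hy' as [Hy'| ->]; [now apply HO in Hy'|exact Hz].
        * rewrite RS by exact Hy. destruct Hy as [Hy| ->]; [|exact V2].
          rewrite V1 by exact Hy. now apply A0. }
  rewrite <- EO. split; [exact F0|]. intros x Hx. now apply A0.
Qed.

End Recursion.
End Functions.
Arguments res {M HZF} R f x.

(** * Ordinals, natural numbers, collapses *)

Section Ordinals.
Context {M : SetStructure} {HZF : ZF M}.
Implicit Types x y z a b c f g : M.

Lemma foundation x : (exists y, y ∈ x) -> exists y, y ∈ x /\ forall z, z ∈ x -> z ∉ y.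
Proof.
  intro H. destruct (zf_foundation HZF H) as (y & A & B). exists y. split; [exact A|].
  intros z C D. apply B. eauto.
Qed.

Lemma mem_irrefl x : x ∉ x.
Proof.
  intro H. destruct (foundation (x := sing x)) as (y & A & B); [exists x; now apply singE|].
  apply singE in A as ->. apply (B x); [now apply singE|exact H].
Qed.

Lemma mem_asym x y : x ∈ y -> y ∉ x.
Proof.
  intros H K. destruct (foundation (x := upair x y)) as (z & A & B); [exists x; apply upairE; auto|].
  apply upairE in A as [->| ->]; [apply (B y)|apply (B x)]; auto; apply upairE; auto.
Qed.

(** By foundation, a transitive set of transitive sets is an ordinal. All quantifiers are bounded,
    so the notion is absolute for transitive classes. *)
Definition Ord a : Prop :=
  (forall x, x ∈ a -> forall y, y ∈ x -> y ∈ a) /\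
  (forall x, x ∈ a -> forall y, y ∈ x -> forall z, z ∈ y -> z ∈ x).

Lemma Dfn_Ord U Q {HU : Universe U Q} s : DT U Q s -> Dfn U Q (fun env => Ord (s env)).
Proof. apply (Dfn_pred1 (P := Ord)). unfold Ord. dfn. Qed.

Lemma Ord_trans a x y : Ord a -> x ∈ a -> y ∈ x -> y ∈ a.
Proof. intros [A _] B C. eapply A; eauto. Qed.

Lemma Ord_sub a x : Ord a -> x ∈ a -> subset x a.
Proof. intros A B z C. eapply Ord_trans; eauto. Qed.

Lemma Ord_elem a x : Ord a -> x ∈ a -> Ord x.
Proof.
  intros [A B] H. split; [exact (B x H)|]. intros y Hy. apply B. eapply A; eauto.
Qed.

Lemma Ord_min (P : M -> Prop) : Dfn everything everything (fun env => P (env 0)) ->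
  (exists a, Ord a /\ P a) -> exists a, Ord a /\ P a /\ forall b, b ∈ a -> ~ P b.
Proof.
  intros D (a & Oa & Pa).
  destruct (classic (exists b, b ∈ a /\ P b)) as [E|E]; [|exists a; split; [exact Oa|]; split; [exact Pa|]; intros b Hb Pb; apply E; eauto].
  destruct (foundation (x := sep a P)) as (b & Hb & Min).
  - destruct E as (b & Hb). exists b. now apply sepE.
  - apply sepE in Hb as [Hb Pb]; [|exact D]. exists b. split; [eapply Ord_elem; eauto|].
    split; [exact Pb|]. intros c Hc Pc. apply (Min c); [|exact Hc].
    apply sepE; [exact D|]. split; [eapply Ord_trans; eauto|exact Pc].
Qed.

Lemma ord_ind (P : M -> Prop) : Dfn everything everything (fun env => P (env 0)) ->
  (forall a, Ord a -> (forall b, b ∈ a -> P b) -> P a) -> forall a, Ord a -> P a.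
Proof.
  intros D H a Oa. apply NNPP. intro N.
  destruct (Ord_min (P := fun x => ~ P x)) as (b & Ob & Nb & Min); [now apply Dfn_not|eauto|].
  apply Nb, H; [exact Ob|]. intros c Hc. apply NNPP. now apply Min.
Qed.

Lemma Ord_succ a : Ord a -> Ord (succ a).
Proof.
  intro O. split.
  - intros x Hx y Hy. apply succE. apply succE in Hx as [Hx| ->]; [|auto].
    left. eapply Ord_trans; eauto.
  - intros x Hx. apply succE in Hx as [Hx| ->]; [exact (proj2 O x Hx)|exact (proj1 O)].
Qed.

Lemma Ord_emp : Ord emp.
Proof. split; intros x Hx; now apply empE in Hx. Qed.

Lemma Ord_trich a b : Ord a -> Ord b -> a ∈ b \/ a = b \/ b ∈ a.
Proof.
  intros Oa. revert b. revert a Oa.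
  apply (ord_ind (P := fun a => forall b, Ord b -> a ∈ b \/ a = b \/ b ∈ a)).
  { dfn. apply Dfn_Ord; dfn. }
  intros a Oa IH. apply (ord_ind (P := fun b => a ∈ b \/ a = b \/ b ∈ a)); [dfn|].
  intros b Ob IH'. apply NNPP. intro N. apply N. right. left. apply subset_antisym.
  - intros x Hx. destruct (IH x Hx b Ob) as [E|[E|E]]; [exact E|subst; tauto|].
    exfalso. apply N. right; right. eapply Ord_trans; eauto.
  - intros y Hy. destruct (IH' y Hy) as [E|[E|E]]; [|subst; tauto|exact E].
    exfalso. apply N. left. eapply Ord_trans; eauto.
Qed.

Lemma Ord_subset a b : Ord a -> Ord b -> subset a b <-> a ∈ b \/ a = b.
Proof.
  intros Oa Ob. split.
  - intro H. destruct (Ord_trich Oa Ob) as [E|[E|E]]; auto. apply H in E. now apply mem_irrefl in E.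
  - intros [E| ->]; [now apply Ord_sub|intros z; auto].
Qed.

Lemma Ord_le_or a b : Ord a -> Ord b -> subset a b \/ b ∈ a.
Proof.
  intros Oa Ob. destruct (Ord_trich Oa Ob) as [E|[E|E]]; auto; left; apply Ord_subset; auto.
Qed.

Lemma Ord_sub_mem a b c : Ord a -> Ord b -> Ord c -> subset a b -> b ∈ c -> a ∈ c.
Proof.
  intros Oa Ob Oc H Hb. apply Ord_subset in H as [H| ->]; auto. eapply Ord_trans; eauto.
Qed.

Lemma succ_sub a b : Ord a -> Ord b -> a ∈ b <-> subset (succ a) b.
Proof.
  intros Oa Ob. split.
  - intros H z Hz. apply succE in Hz as [Hz| ->]; [eapply Ord_trans; eauto|exact H].
  - intro H. apply H, succE. auto.
Qed.

Lemma succ_inj a b : succ a = succ b -> a = b.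
Proof.
  intro E. assert (A : a ∈ succ b) by (rewrite <- E; apply succE; auto).
  assert (B : b ∈ succ a) by (rewrite E; apply succE; auto).
  apply succE in A as [A|A]; [|auto]. apply succE in B as [B|B]; [|auto]. now apply mem_asym in A.
Qed.

Lemma succ_mono a b : Ord a -> Ord b -> a ∈ b -> succ a ∈ succ b.
Proof.
  intros Oa Ob H. apply succE. apply (succ_sub Oa Ob) in H. apply Ord_subset in H; auto.
  now apply Ord_succ.
Qed.

Lemma succ_not_emp a : succ a <> emp.
Proof. intro E. apply (@empE _ _ a). rewrite <- E. apply succE. auto. Qed.

Lemma Un_succ a : Ord a -> Un (succ a) = a.
Proof.
  intro O. apply ext. intro z. rewrite UnE. split.
  - intros (y & Hy & Hz). apply succE in Hy as [Hy| ->]; [eapply Ord_trans; eauto|exact Hz].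
  - intro Hz. exists a. split; [apply succE; auto|exact Hz].
Qed.

(* The least element of the class P of elements of the ordinal a, and a if there is none. *)
Definition mu a (P : M -> Prop) : M := sep a (fun z => forall y, y ∈ a -> P y -> z ∈ y).

Lemma muP a (P : M -> Prop) : Dfn everything everything (fun env => P (env 0)) -> Ord a ->
  (exists y, y ∈ a /\ P y) ->
  mu a P ∈ a /\ P (mu a P) /\ forall y, y ∈ a -> P y -> subset (mu a P) y.
Proof.
  intros D Oa (y & Hy & Py).
  destruct (Ord_min (P := fun y => y ∈ a /\ P y)) as (b & Ob & [Hb Pb] & Min).
  - apply Dfn_and; [dfn|exact D].
  - exists y. split; [eapply Ord_elem; eauto|auto].
  - assert (L : forall z, z ∈ a -> P z -> subset b z).
    { intros z Hz Pz. destruct (Ord_le_or Ob (Ord_elem Oa Hz)) as [E|E]; [exact E|].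
      now destruct (Min z E). }
    assert (E : mu a P = b); [|rewrite E; auto].
    apply ext. intro z. unfold mu. rewrite sepE.
    + split; [intros [_ H]; auto|]. intro Hz. split; [eapply Ord_trans; eauto|].
      intros w Hw Pw. now apply (L w).
    + dfn. exact (Dfn_rename (fun _ => 0) D).
Qed.

(** * Natural numbers and recursion along ω *)

Definition Nat_ n : Prop := Ord n /\ forall m, m ∈ succ n -> m = emp \/ exists k, m = succ k.

Lemma Dfm_Nat s : DT everything everything s -> Dfn everything everything (fun env => Nat_ (s env)).
Proof. apply (Dfn_pred1 (P := Nat_)). unfold Nat_. dfn. apply Dfn_Ord; dfn. Qed.

Lemma omega_exists : exists w, forall n, n ∈ w <-> Nat_ n.
Proof.
  destruct (zf_infinity HZF) as (w & (e & He & Hew) & Hs).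
  assert (Ee : e = emp) by (apply ext; intro z; split; intro H; [now apply He in H|now apply empE in H]).
  subst e.
  assert (Hsucc : forall x, x ∈ w -> succ x ∈ w).
  { intros x Hx. destruct (Hs x Hx) as (y & Hy & Hyw). replace (succ x) with y; [exact Hyw|].
    apply ext. intro z. rewrite succE. apply Hy. }
  exists (sep w Nat_). intro n. rewrite sepE by (apply Dfm_Nat; dfn). split; [tauto|].
  intro Hn. split; [|exact Hn]. destruct Hn as [On Hn].
  assert (G : forall m, Ord m -> m ∈ succ n -> m ∈ w).
  { apply (ord_ind (P := fun m => m ∈ succ n -> m ∈ w)); [dfn|].
    intros m Om IH Hm. destruct (Hn m Hm) as [->|[k ->]]; [exact Hew|].
    apply Hsucc, IH; [apply succE; auto|]. apply Ord_trans with (succ k); [now apply Ord_succ|exact Hm|].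
    apply succE; auto. }
  apply G; [exact On|apply succE; auto].
Qed.

Definition omega : M := eps (fun w => forall n, n ∈ w <-> Nat_ n).
Lemma omegaE n : n ∈ omega <-> Nat_ n.
Proof. exact (epsP omega_exists n). Qed.

Lemma omega_emp : emp ∈ omega.
Proof.
  apply omegaE. split; [exact Ord_emp|]. intros m Hm. left. apply succE in Hm as [Hm|Hm]; [|exact Hm].
  now apply empE in Hm.
Qed.

Lemma omega_succ n : n ∈ omega -> succ n ∈ omega.
Proof.
  rewrite !omegaE. intros [On Hn]. split; [now apply Ord_succ|]. intros m Hm.
  apply succE in Hm as [Hm| ->]; eauto.
Qed.

Lemma Ord_omega : Ord omega.
Proof.
  split.
  - intros x Hx y Hy. apply omegaE in Hx as [Ox Hx]. apply omegaE. split; [eapply Ord_elem; eauto|].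
    intros m Hm. apply Hx. apply succE. left. apply succE in Hm as [Hm| ->]; [|exact Hy].
    eapply Ord_trans; eauto.
  - intros x Hx. apply omegaE in Hx as [Ox _]. exact (proj1 Ox).
Qed.

Lemma nat_cases n : n ∈ omega -> n = emp \/ exists k, k ∈ omega /\ n = succ k.
Proof.
  intro Hn. assert (H := Hn). apply omegaE in H as [On H].
  destruct (H n) as [E|[k ->]]; [apply succE; auto|auto|]. right. exists k. split; [|reflexivity].
  apply Ord_trans with (succ k); [exact Ord_omega|exact Hn|apply succE; auto].
Qed.

Lemma nat_ind_ (P : M -> Prop) : Dfn everything everything (fun env => P (env 0)) ->
  P emp -> (forall n, n ∈ omega -> P n -> P (succ n)) -> forall n, n ∈ omega -> P n.
Proof.
  intros D P0 PS n Hn. assert (On : Ord n) by (eapply Ord_elem; [exact Ord_omega|exact Hn]).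
  revert Hn. revert n On. apply (ord_ind (P := fun n => n ∈ omega -> P n)).
  - apply Dfn_imp; [dfn|exact D].
  - intros n On IH Hn. destruct (nat_cases Hn) as [->|(k & Hk & ->)]; [exact P0|].
    apply PS; [exact Hk|]. apply IH; [apply succE; auto|exact Hk].
Qed.

Definition Lim a : Prop := Ord a /\ emp ∈ a /\ forall b, b ∈ a -> succ b ∈ a.

Lemma Ord_cases a : Ord a -> a = emp \/ (exists b, Ord b /\ a = succ b) \/ Lim a.
Proof.
  intro Oa. destruct (classic (a = emp)) as [E|E]; [auto|]. right.
  destruct (classic (exists b, Ord b /\ a = succ b)) as [F|F]; [auto|]. right.
  split; [exact Oa|]. split.
  - destruct (Ord_trich Ord_emp Oa) as [H|[H|H]]; [exact H|congruence|now apply empE in H].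
  - intros b Hb. assert (Ob := Ord_elem Oa Hb).
    destruct (Ord_trich (Ord_succ Ob) Oa) as [H|[H|H]]; [exact H| |].
    + exfalso. eauto.
    + apply succE in H as [H| ->]; [now apply mem_asym in H|now apply mem_irrefl in Hb].
Qed.

Lemma Lim_omega a : Lim a -> subset omega a.
Proof.
  intros (Oa & A & B) n. apply (nat_ind_ (P := fun n => n ∈ a)); [dfn|exact A|auto].
Qed.

Lemma wf_mem A Z : subset Z A -> (exists z, z ∈ Z) -> exists z, z ∈ Z /\ forall y, y ∈ Z -> ~ y ∈ z.
Proof. intros _. apply foundation. Qed.

Lemma omega_rec a (F : M -> M) : DT everything everything (fun env => F (env 0)) ->
  exists h, isfn h omega /\ app h emp = a /\ forall n, n ∈ omega -> app h (succ n) = F (app h n).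
Proof.
  intro D.
  (* The predecessor of a successor n is its union. *)
  set (P := fun n g y => (n = emp /\ y = a) \/ (n <> emp /\ y = F (app g (Un n)))).
  assert (Fun : forall n g y y', P n g y -> P n g y' -> y = y').
  { intros n g y y' [[A ->]|[A ->]] [[B ->]|[B ->]]; congruence. }
  destruct (@wf_recursion _ _ omega (fun y x => y ∈ x) (fun n g => eps (fun y => P n g y))) as (h & Hh & E).
  - dfn.
  - apply (DTm_eps (P := fun y env => P (env 0) (env 1) y)); [|eauto].
    unfold P. dfn. apply (DT_fun1 (F := F) D). dfn.
  - apply wf_mem.
  - assert (K : forall n g y, P n g y -> eps (fun y => P n g y) = y).
    { intros n g y H. apply (Fun n g); [|exact H]. apply epsP. eauto. }
    exists h. split; [exact Hh|]. split.
    + rewrite E by apply omega_emp. apply K. left. auto.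
    + intros n Hn. assert (Hs := omega_succ Hn). rewrite E by exact Hs. apply K. right.
      split; [apply succ_not_emp|]. f_equal.
      rewrite Un_succ by (eapply Ord_elem; [exact Ord_omega|exact Hn]).
      symmetry. apply app_val.
      * rewrite resE by dfn. split; [now apply (isfn_pair _ _ Hh)|]. exists n. split; [apply succE; auto|eauto].
      * intros y Hy. rewrite resE in Hy by dfn. destruct Hy as [Hy _].
        now apply (isfn_pair _ _ Hh) in Hy as [_ ->].
Qed.

(* [col A r] is the Mostowski collapse of (A, r), when r is well-founded on A. *)

Definition wfr A r : Prop := forall Z, subset Z A -> (exists z, z ∈ Z) ->
  exists z, z ∈ Z /\ forall y, y ∈ Z -> opair y z ∉ r.
Definition iscol A r F : Prop := isfn F A /\
  forall x, x ∈ A -> forall z, z ∈ app F x <-> exists y, y ∈ A /\ opair y x ∈ r /\ z = app F y.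
Definition col A r : M := eps (fun F => wfr A r /\ iscol A r F).

Lemma iscol_unique A r F F' : wfr A r -> iscol A r F -> iscol A r F' -> F = F'.
Proof.
  intros W [H E] [H' E']. apply (isfn_ext H H'). intros x Hx. apply NNPP. intro N.
  set (Z := sep A (fun x => app F x <> app F' x)).
  assert (HZ : forall z, z ∈ Z <-> z ∈ A /\ app F z <> app F' z)
    by (intro; unfold Z; rewrite sepE; [reflexivity|dfn]).
  destruct (W Z) as (z & Hz & Min).
  - intros z Hz. now apply HZ in Hz.
  - exists x. now apply HZ.
  - apply HZ in Hz as [Hz Ne]. apply Ne.
    assert (K : forall y, y ∈ A -> opair y z ∈ r -> app F y = app F' y).
    { intros y Hy Ry. apply NNPP. intro. apply (Min y); [now apply HZ|exact Ry]. }
    apply ext. intro w. rewrite (E z Hz), (E' z Hz).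
    split; intros (y & Hy & Ry & ->); exists y; (split; [exact Hy|split; [exact Ry|]]);
      [|symmetry]; now apply K.
Qed.

Lemma Dfm_wfr s t : DT everything everything s -> DT everything everything t ->
  Dfn everything everything (fun env => wfr (s env) (t env)).
Proof. apply (Dfn_pred2 (P := wfr)). unfold wfr, subset. dfn. Qed.

Lemma Dfm_isfn s t : DT everything everything s -> DT everything everything t ->
  Dfn everything everything (fun env => isfn (s env) (t env)).
Proof. apply (Dfn_pred2 (P := isfn)). unfold isfn. dfn. Qed.

Lemma DTm_col s t : DT everything everything s -> DT everything everything t ->
  DT everything everything (fun env => col (s env) (t env)).
Proof.
  apply (DT_fun2 (F := col)). unfold col.
  apply (DTm_eps (P := fun F env => wfr (env 0) (env 1) /\ iscol (env 0) (env 1) F)).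
  - apply Dfn_and; [apply Dfm_wfr; dfn|]. unfold iscol. apply Dfn_and; [apply Dfm_isfn; dfn|dfn].
  - intros env F F' [W H] [_ H']. eapply iscol_unique; eauto.
Qed.

Lemma colP A r : wfr A r -> iscol A r (col A r).
Proof.
  intro W. enough (exists F, wfr A r /\ iscol A r F) as H by exact (proj2 (epsP H)).
  assert (D : DT everything everything (fun env =>
     repl (sep A (fun y => opair y (env 0) ∈ r)) (fun y => app (env 1) y))).
  { split; [intros; exact I|].
    apply Dfn_ext with (fun env => forall z, z ∈ env 0 <-> exists y, y ∈ A /\ opair y (env 1) ∈ r /\ z = app (env 2) y);
      [dfn|].
    intros env _. split.
    - intros -> z. rewrite replE by dfn. split.
      + intros (y & Hy & ->). rewrite sepE in Hy by dfn. exists y. tauto.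
      + intros (y & Hy & Ry & ->). exists y. rewrite sepE by dfn. auto.
    - intro H. apply ext. intro z. rewrite H, replE by dfn. split.
      + intros (y & Hy & Ry & ->). exists y. rewrite sepE by dfn. auto.
      + intros (y & Hy & ->). rewrite sepE in Hy by dfn. exists y. tauto. }
  destruct (@wf_recursion _ _ A (fun y x => opair y x ∈ r)
     (fun x g => repl (sep A (fun y => opair y x ∈ r)) (fun y => app g y))) as (F & HF & E).
  - dfn.
  - exact D.
  - exact W.
  - exists F. split; [exact W|]. split; [exact HF|]. intros x Hx z. rewrite E by exact Hx.
    rewrite replE by dfn.
    assert (K : forall y, y ∈ A -> opair y x ∈ r -> app (res (fun y x => opair y x ∈ r) F x) y = app F y).
    { intros y Hy Ry. apply app_val.
      - rewrite resE by dfn. split; [now apply (isfn_pair _ _ HF)|eauto].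
      - intros y' Hy'. rewrite resE in Hy' by dfn. destruct Hy' as [Hy' _].
        now apply (isfn_pair _ _ HF) in Hy' as [_ ->]. }
    split.
    + intros (y & Hy & ->). rewrite sepE in Hy by dfn. exists y. rewrite K by tauto. tauto.
    + intros (y & Hy & Ry & ->). exists y. rewrite sepE by dfn. rewrite K; auto.
Qed.

(** * Order types of sets of ordinals *)

Definition memrel (Y : M) : M := sep (prod Y Y) (fun p => exists x, x ∈ Y /\ exists y, y ∈ Y /\ (p = opair x y /\ x ∈ y)).
(** For a set Y of ordinals the value at x is the order type of the part of Y below x. *)
Definition rk (Y : M) : M := col Y (memrel Y).

Lemma memrelE (Y : M) x y : opair x y ∈ memrel Y <-> x ∈ Y /\ y ∈ Y /\ x ∈ y.
Proof.
  unfold memrel. rewrite sepE by dfn. rewrite opair_prod. split.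
  - intros [_ (x' & Hx & y' & Hy & E & H)]. apply opair_inj in E as [-> ->]. auto.
  - intros (A & B & C). eauto 8.
Qed.

Lemma memrel_wf (Y : M) : wfr Y (memrel Y).
Proof.
  intros Z HZ E. destruct (foundation E) as (z & Hz & Min). exists z. split; [exact Hz|].
  intros y Hy H. apply memrelE in H as (_ & _ & H). now apply (Min y).
Qed.

Lemma rkE (Y : M) x z : x ∈ Y -> z ∈ app (rk Y) x <-> exists y, y ∈ Y /\ y ∈ x /\ z = app (rk Y) y.
Proof.
  intro Hx. destruct (colP (@memrel_wf Y)) as [_ E]. fold (rk Y) in E. rewrite E by exact Hx.
  split; intros (y & Hy & A & ->); exists y; [apply memrelE in A|rewrite memrelE]; tauto.
Qed.

Lemma rk_fn (Y : M) : isfn (rk Y) Y.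
Proof. apply (colP (@memrel_wf Y)). Qed.

Lemma memrel_prod : DT everything everything (fun env => memrel (env 0)).
Proof.
  split; [intros; exact I|].
  apply Dfn_ext with (fun env => forall p, p ∈ env 0 <->
     exists x, x ∈ env 1 /\ exists y, y ∈ env 1 /\ (p = opair x y /\ x ∈ y)); [dfn|].
  intros env _.
  assert (E : forall p, p ∈ memrel (env 1) <-> exists x, x ∈ env 1 /\ exists y, y ∈ env 1 /\ (p = opair x y /\ x ∈ y)).
  { intro p. unfold memrel. rewrite sepE by dfn. split; [tauto|]. intro H. split; [|exact H].
    destruct H as (x & Hx & y & Hy & -> & _). now apply opair_prod. }
  split; [intros -> p; apply E|]. intro H. apply ext. intro p. now rewrite H, E.
Qed.

Lemma DTm_rk s : DT everything everything s -> DT everything everything (fun env => rk (s env)).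
Proof.
  apply (DT_fun1 (F := rk)). apply DTm_col; [dfn|]. apply (DT_fun1 (F := memrel)); [|dfn].
  exact memrel_prod.
Qed.

Section Rank.
Context (Y : M) (HY : forall y, y ∈ Y -> Ord y).

Lemma rk_Ord x : x ∈ Y -> Ord (app (rk Y) x).
Proof.
  intro Hx. assert (Ox := HY Hx). revert Hx. revert x Ox.
  apply (ord_ind (P := fun x => x ∈ Y -> Ord (app (rk Y) x))).
  { dfn. apply Dfn_Ord; dfn. }
  intros x Ox IH Hx. split.
  - intros z Hz w Hw. apply rkE in Hz as (y & Hy & Hyx & ->); [|exact Hx].
    apply rkE in Hw as (u & Hu & Huy & ->); [|exact Hy]. apply rkE; [exact Hx|].
    exists u. repeat split; auto. eapply Ord_trans; eauto.
  - intros z Hz. apply rkE in Hz as (y & Hy & Hyx & ->); [|exact Hx]. now apply IH.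
Qed.

Lemma rk_mono x y : x ∈ Y -> y ∈ Y -> x ∈ y -> app (rk Y) x ∈ app (rk Y) y.
Proof. intros Hx Hy H. apply rkE; eauto. Qed.

Lemma rk_inj x y : x ∈ Y -> y ∈ Y -> app (rk Y) x = app (rk Y) y -> x = y.
Proof.
  intros Hx Hy E. destruct (Ord_trich (HY Hx) (HY Hy)) as [H|[H|H]]; [|exact H|];
  apply rk_mono in H; auto; rewrite E in H; now apply mem_irrefl in H.
Qed.

Lemma rk_sub x : x ∈ Y -> subset (app (rk Y) x) x.
Proof.
  intro Hx. assert (Ox := HY Hx). revert Hx. revert x Ox.
  apply (ord_ind (P := fun x => x ∈ Y -> subset (app (rk Y) x) x)); [unfold subset; dfn|].
  intros x Ox IH Hx z Hz. apply rkE in Hz as (y & Hy & Hyx & ->); [|exact Hx].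
  eapply Ord_sub_mem; [apply rk_Ord| |exact Ox|apply IH|exact Hyx]; auto.
Qed.

Lemma rk_initial x z : x ∈ Y -> z ∈ app (rk Y) x -> exists y, y ∈ Y /\ y ∈ x /\ app (rk Y) y = z.
Proof. intros Hx Hz. apply rkE in Hz as (y & A & B & ->); eauto. Qed.

End Rank.
End Ordinals.

Ltac dfn_hook1 ::= lazymatch goal with
  | |- Dfn _ _ (fun env => Ord (@?a env)) => apply (@Dfn_Ord _ _ _ _ a)
  | |- Dfn _ _ (fun env => wfr (@?a env) (@?b env)) => apply (@Dfm_wfr _ _ a b)
  | |- Dfn _ _ (fun env => isfn (@?a env) (@?b env)) => apply (@Dfm_isfn _ _ a b)
  | |- DT _ _ (fun env => col (@?a env) (@?b env)) => apply (@DTm_col _ _ a b)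
  | |- DT _ _ (fun env => rk (@?a env)) => apply (@DTm_rk _ _ a)
  | |- DT _ _ (fun env => mu (@?a env) (fun x => @?P env x)) => unfold mu
  | |- Dfn _ _ (fun env => subset _ _) => unfold subset
  | |- Dfn _ _ (fun env => Lim _) => unfold Lim
  end.

(** * The notions of the statement as functions *)

Section Interface.
Context {M : SetStructure} {HZF : ZF M}.
Implicit Types x y z a b c f g e p r s v w n k : M.

Lemma is_pair_iff x y p : is_pair x y p <-> p = upair x y.
Proof.
  split; [|intros -> z; apply upairE]. intro H. apply ext. intro z. now rewrite (H z), upairE.
Qed.

Lemma is_opair_iff x y p : is_opair x y p <-> p = opair x y.
Proof.
  split.
  - intros (a & b & A & B & C). apply is_pair_iff in A, B, C. now subst.
  - intros ->. exists (sing x), (upair x y). rewrite !is_pair_iff. auto.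
Qed.

Lemma pair_in_iff r x y : pair_in r x y <-> opair x y ∈ r.
Proof.
  split; [intros (p & A & B); apply is_opair_iff in A as ->; exact B|].
  intro H. exists (opair x y). now rewrite is_opair_iff.
Qed.

Lemma is_succ_iff x y : is_succ x y <-> y = succ x.
Proof.
  split; [|intros -> z; apply succE]. intro H. apply ext. intro z. now rewrite (H z), succE.
Qed.

Lemma is_empty_iff x : is_empty x <-> x = emp.
Proof.
  split; [|intros -> z; apply empE]. intro H. apply ext. intro z.
  split; intro A; [now apply H in A|now apply empE in A].
Qed.

Lemma is_function_on_iff f a : is_function_on f a <-> isfn f a.
Proof.
  split.
  - intros [A B]. apply isfn_intro.
    + intros p Hp. destruct (A p Hp) as (x & y & Hx & E). apply is_opair_iff in E. eauto.
    + intros x Hx. destruct (B x Hx) as (y & Hy & _). apply pair_in_iff in Hy. eauto.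
    + intros x y y' H H'. destruct (A _ H) as (x' & y0 & Hx & E).
      apply is_opair_iff, opair_inj in E as [-> _]. destruct (B x' Hx) as (u & _ & U).
      rewrite <- (U y), <- (U y'); auto; now apply pair_in_iff.
  - intro F. split.
    + intros p Hp. apply F in Hp as (x & Hx & ->). exists x, (app f x). now rewrite is_opair_iff.
    + intros x Hx. exists (app f x). split; [apply pair_in_iff, (isfn_pair _ _ F); auto|].
      intros y Hy. apply pair_in_iff, (isfn_pair _ _ F) in Hy. now destruct Hy.
Qed.

Lemma is_function_iff f a b : is_function f a b <-> isfn f a /\ forall x, x ∈ a -> app f x ∈ b.
Proof.
  unfold is_function. rewrite is_function_on_iff. split; intros [F H]; (split; [exact F|]).
  - intros x Hx. apply (H x). apply pair_in_iff, (isfn_pair _ _ F). auto.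
  - intros x y Hy. apply pair_in_iff, (isfn_pair _ _ F) in Hy as [Hx ->]. auto.
Qed.

Lemma is_ordinal_iff a : is_ordinal a <-> Ord a.
Proof.
  split.
  - intros (T & _ & Tr & Li & _). split.
    + intros x Hx y Hy. now apply (T x).
    + intros x Hx y Hy z Hz. apply (Tr z y x); auto; [|apply (T x)..]; auto.
      apply (T y); auto. now apply (T x).
  - intro O. split; [intros y Hy; now apply Ord_sub|]. split; [|split; [|split]].
    + intros y _. apply mem_irrefl.
    + intros y z u _ _ Hu A B. exact (Ord_trans (Ord_elem O Hu) B A).
    + intros y z Hy Hz. apply Ord_trich; eapply Ord_elem; eauto.
    + intros s Hs E. destruct (foundation E) as (y & Hy & Min). exists y. split; [exact Hy|].
      intros z Hz. destruct (Ord_trich (Ord_elem O (Hs _ Hy)) (Ord_elem O (Hs _ Hz))) as [H|[H|H]]; auto.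
      now apply Min in H.
Qed.

Lemma ord_le_iff a b : Ord a -> Ord b -> ord_le a b <-> subset a b.
Proof. intros. unfold ord_le. now rewrite Ord_subset. Qed.

Lemma is_natural_iff n : is_natural n <-> n ∈ omega.
Proof.
  rewrite omegaE. unfold is_natural, Nat_. rewrite is_ordinal_iff.
  split; intros [A B]; (split; [exact A|]); intros m Hm.
  - apply succE in Hm. destruct (B m Hm) as [E|[k E]].
    + left. now apply is_empty_iff.
    + right. exists k. now apply is_succ_iff.
  - apply succE in Hm. destruct (B m Hm) as [E|[k E]].
    + left. now apply is_empty_iff.
    + right. exists k. now apply is_succ_iff.
Qed.

Lemma is_omega_iff w : is_omega w <-> w = omega.
Proof.
  split; [|intros -> n; symmetry; apply is_natural_iff].
  intro H. apply ext. intro n. now rewrite (H n), is_natural_iff.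
Qed.

Lemma is_limit_cases a : is_limit a -> a = emp \/ Lim a.
Proof.
  intros [O N]. apply is_ordinal_iff in O. destruct (Ord_cases O) as [E|[(b & _ & E)|E]]; auto.
  destruct N. exists b. now apply is_succ_iff.
Qed.

Definition functional g : Prop := forall x y y', opair x y ∈ g -> opair x y' ∈ g -> y = y'.
(* T ≤* a, without requirements on the pairs of g outside a and T *)
Definition sle T a : Prop := exists g, functional g /\ forall y, y ∈ T -> exists x, x ∈ a /\ opair x y ∈ g.

Lemma surj_le_iff x y : surj_le x y <-> sle x y.
Proof.
  split.
  - intros (f & d & D & F & S). apply is_function_iff in F as [F V]. exists f. split.
    + intros u v v' A B. apply (isfn_pair _ _ F) in A as [_ ->], B as [_ ->]. reflexivity.
    + intros u Hu. destruct (S u Hu) as [v Hv]. apply pair_in_iff in Hv. exists v. split; [|exact Hv].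
      apply D. now apply (isfn_pair _ _ F) in Hv.
  - intros (g & Fg & S).
    set (f := sep g (fun p => exists u v, u ∈ y /\ v ∈ x /\ p = opair u v)).
    assert (Hf : forall u v, opair u v ∈ f <-> opair u v ∈ g /\ u ∈ y /\ v ∈ x).
    { intros u v. unfold f. rewrite sepE by dfn. split; intros [A B]; (split; [exact A|]).
      - destruct B as (u' & v' & Hu & Hv & E). apply opair_inj in E as [-> ->]. auto.
      - exists u, v. tauto. }
    set (d := sep y (fun u => exists v, opair u v ∈ f)).
    assert (Hd : forall u, u ∈ d <-> u ∈ y /\ exists v, opair u v ∈ f)
      by (intro u; unfold d; rewrite sepE; [reflexivity|dfn]).
    assert (F : isfn f d).
    { apply isfn_intro.
      - intros p Hp. assert (Hp' := Hp). unfold f in Hp. rewrite sepE in Hp by dfn.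
        destruct Hp as (_ & u & v & Hu & Hv & ->). exists u, v. split; [|reflexivity]. apply Hd. eauto.
      - intros u Hu. now apply Hd in Hu.
      - intros u v v' A B. apply Hf in A, B. apply (Fg u); tauto. }
    exists f, d. split; [intros u Hu; now apply Hd in Hu|]. split.
    + apply is_function_iff. split; [exact F|]. intros u Hu.
      assert (H : opair u (app f u) ∈ f) by (apply (isfn_pair _ _ F); auto). now apply Hf in H.
    + intros u Hu. destruct (S u Hu) as (v & Hv & A). exists v. apply pair_in_iff, Hf. auto.
Qed.

Lemma sle_sub T T' a : subset T T' -> sle T' a -> sle T a.
Proof. intros H (g & F & S). exists g. split; [exact F|]. auto. Qed.

Lemma sle_sub_r T a a' : subset a a' -> sle T a -> sle T a'.
Proof.
  intros H (g & F & S). exists g. split; [exact F|]. intros y Hy. destruct (S y Hy) as (x & A & B). eauto.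
Qed.

Lemma sle_refl a : sle a a.
Proof.
  destruct (@lam_fn _ _ a (fun x => x)) as [F E]; [dfn|]. exists (lam a (fun x => x)). split.
  - intros x y y' A B. apply (isfn_pair _ _ F) in A as [_ ->], B as [_ ->]. reflexivity.
  - intros y Hy. exists y. split; [exact Hy|]. apply (isfn_pair _ _ F). now rewrite E.
Qed.

Lemma sle_repl a (F : M -> M) : DT everything everything (fun env => F (env 0)) -> sle (repl a F) a.
Proof.
  intro D. destruct (lam_fn a D) as [H E]. exists (lam a F). split.
  - intros x y y' A B. apply (isfn_pair _ _ H) in A as [_ ->], B as [_ ->]. reflexivity.
  - intros y Hy. apply replE in Hy as (x & Hx & ->); [|exact D]. exists x. split; [exact Hx|].
    apply (isfn_pair _ _ H). now rewrite E.
Qed.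

(** * The cumulative hierarchy *)

Definition VF f a : Prop := isfn f (succ a) /\ forall x, x ∈ succ a ->
  forall z, z ∈ app f x <-> exists u, u ∈ x /\ subset z (app f u).

Lemma is_V_VF a v : is_V a v -> Ord a -> exists f, VF f a /\ v = app f a.
Proof.
  intros (f & a1 & E & F & H & P) Oa. apply is_succ_iff in E as ->. apply is_function_on_iff in F.
  apply pair_in_iff, (isfn_pair _ _ F) in P as [_ ->]. exists f. split; [|reflexivity].
  split; [exact F|]. intros x Hx z.
  assert (Q : pair_in f x (app f x)) by (apply pair_in_iff, (isfn_pair _ _ F); auto).
  rewrite (H _ _ Q z). split.
  - intros (u & w & Hu & P & S). apply pair_in_iff, (isfn_pair _ _ F) in P as [_ ->]. eauto.
  - intros (u & Hu & S). exists u, (app f u). split; [exact Hu|]. split; [|exact S].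
    apply pair_in_iff, (isfn_pair _ _ F). split; [|reflexivity].
    eapply Ord_trans; eauto. now apply Ord_succ.
Qed.

Lemma VF_unique f a f' a' : Ord a -> Ord a' -> VF f a -> VF f' a' ->
  forall x, Ord x -> x ∈ succ a -> x ∈ succ a' -> app f x = app f' x.
Proof.
  intros Oa Oa' [_ H] [_ H'].
  apply (ord_ind (P := fun x => x ∈ succ a -> x ∈ succ a' -> app f x = app f' x)); [dfn|].
  intros x Ox IH Hx Hx'. apply ext. intro z. rewrite (H x Hx), (H' x Hx').
  assert (K : forall u, u ∈ x -> app f u = app f' u).
  { intros u Hu. apply IH; [exact Hu| |]; eapply Ord_trans; eauto; now apply Ord_succ. }
  split; intros (u & Hu & S); exists u; (split; [exact Hu|]); [rewrite <- K|rewrite K]; auto.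
Qed.

Section Levels.
Context (f a : M) (Oa : Ord a) (HV : VF f a).
Let V x := app f x.

Lemma VF_E x z : x ∈ succ a -> z ∈ V x <-> exists u, u ∈ x /\ subset z (V u).
Proof. intro Hx; exact (proj2 HV x Hx z). Qed.

Lemma VF_mono x y : x ∈ succ a -> y ∈ succ a -> subset x y -> subset (V x) (V y).
Proof.
  intros Hx Hy S z Hz. apply VF_E in Hz as (u & Hu & A); [|exact Hx]. apply VF_E; [exact Hy|]. eauto.
Qed.

Let in_a x y : x ∈ succ a -> y ∈ x -> y ∈ succ a.
Proof. exact (Ord_trans (Ord_succ Oa)). Qed.

Lemma VF_trans x y z : x ∈ succ a -> y ∈ V x -> z ∈ y -> z ∈ V x.
Proof.
  intro Hx. assert (Ox := Ord_elem (Ord_succ Oa) Hx).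
  revert y z Hx. revert x Ox.
  apply (ord_ind (P := fun x => forall y z, x ∈ succ a -> y ∈ V x -> z ∈ y -> z ∈ V x));
    [unfold V; dfn|].
  intros x Ox IH y z Hx Hy Hz. apply VF_E in Hy as (u & Hu & S); [|exact Hx].
  assert (A : z ∈ V u) by now apply S. apply VF_E; [exact Hx|]. exists u. split; [exact Hu|].
  intros w Hw. apply (IH u Hu z); auto. now apply in_a with x.
Qed.

Lemma VF_succ x z : succ x ∈ succ a -> z ∈ V (succ x) <-> subset z (V x).
Proof.
  intro Hx. assert (Hx' : x ∈ succ a) by (apply in_a with (succ x); [exact Hx|apply succE; auto]).
  rewrite VF_E by exact Hx. split.
  - intros (u & Hu & S) w Hw. apply S in Hw. revert Hw. apply VF_mono; auto.
    + apply in_a with (succ x); auto.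
    + apply succE in Hu as [Hu| ->]; [|intros q; auto]. apply Ord_sub; [|exact Hu].
      exact (Ord_elem (Ord_succ Oa) Hx').
  - intro S. exists x. split; [apply succE; auto|exact S].
Qed.

Lemma VF_ord x : x ∈ succ a -> forall y, Ord y -> y ∈ V x <-> y ∈ x.
Proof.
  intro Hx. assert (Ox := Ord_elem (Ord_succ Oa) Hx).
  revert Hx. revert x Ox.
  apply (ord_ind (P := fun x => x ∈ succ a -> forall y, Ord y -> y ∈ V x <-> y ∈ x)); [unfold V; dfn|].
  intros x Ox IH Hx y Oy. rewrite VF_E by exact Hx. split.
  - intros (u & Hu & S).
    assert (S' : subset y u).
    { intros w Hw. apply (IH u Hu); [now apply in_a with x|now apply Ord_elem with y|now apply S]. }
    apply Ord_sub_mem with u; auto. now apply Ord_elem with x.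
  - intro Hy. exists y. split; [exact Hy|]. intros w Hw.
    apply (IH y Hy); [now apply in_a with x|now apply Ord_elem with y|exact Hw].
Qed.

Lemma VF_level_mem x y : x ∈ succ a -> y ∈ x -> V y ∈ V x.
Proof. intros Hx Hy. apply VF_E; [exact Hx|]. exists y. split; [exact Hy|]. intros z; auto. Qed.

Lemma VF_lim x z : x ∈ succ a -> Lim x -> z ∈ V x <-> exists u, u ∈ x /\ z ∈ V u.
Proof.
  intros Hx (Ox & L1 & L2). split.
  - intro H. apply VF_E in H as (u & Hu & S); [|exact Hx]. exists (succ u). split; [auto|].
    apply VF_succ; [|exact S]. apply in_a with x; auto.
  - intros (u & Hu & H). revert H. apply VF_mono; auto; [now apply in_a with x|now apply Ord_sub].
Qed.

Lemma VF_upair x y z : x ∈ succ a -> Lim x -> y ∈ V x -> z ∈ V x -> upair y z ∈ V x.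
Proof.
  intros Hx L Hy Hz. assert (L' := L). destruct L' as (Ox & L1 & L2).
  apply VF_lim in Hy as (u & Hu & Hy), Hz as (v & Hv & Hz); auto.
  assert (exists w, w ∈ x /\ subset u w /\ subset v w) as (w & Hw & A & B).
  { destruct (Ord_le_or (Ord_elem Ox Hu) (Ord_elem Ox Hv)) as [E|E].
    - exists v. split; [exact Hv|]. split; [exact E|intros q; auto].
    - exists u. split; [exact Hu|]. split; [intros q; auto|apply Ord_sub; [eapply Ord_elem; eauto|exact E]]. }
  apply VF_lim; auto. exists (succ w). split; [auto|]. apply VF_succ; [apply in_a with x; auto|].
  intros q Hq. apply upairE in Hq as [->| ->].
  - revert Hy. apply VF_mono; auto; apply in_a with x; auto.
  - revert Hz. apply VF_mono; auto; apply in_a with x; auto.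
Qed.

Lemma VF_opair x y z : x ∈ succ a -> Lim x -> y ∈ V x -> z ∈ V x -> opair y z ∈ V x.
Proof. intros. unfold opair, sing. now repeat apply VF_upair. Qed.

End Levels.

(** * Addition of natural numbers and parity *)

Lemma is_ord_sum_spec a b c : b ∈ omega -> is_ord_sum a b c -> exists f,
  app f emp = a /\ (forall k, k ∈ b -> app f (succ k) = succ (app f k)) /\ app f b = c.
Proof.
  intros Hb (f & b1 & E & F & H & P). apply is_succ_iff in E as ->. apply is_function_on_iff in F.
  assert (Ob : Ord b) by (eapply Ord_elem; eauto; apply Ord_omega).
  apply pair_in_iff, (isfn_pair _ _ F) in P as [_ ->]. exists f.
  assert (H' : forall x, x ∈ succ b -> forall z, z ∈ app f x <-> z ∈ a \/ exists u, u ∈ x /\ z = app f u).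
  { intros x Hx z. rewrite (H x (app f x)) by (apply pair_in_iff, (isfn_pair _ _ F); auto).
    apply or_iff_compat_l. split; intros (u & Hu & A); exists u; (split; [exact Hu|]).
    - now apply pair_in_iff, (isfn_pair _ _ F) in A.
    - apply pair_in_iff, (isfn_pair _ _ F). split; [|exact A].
      eapply Ord_trans; eauto. now apply Ord_succ. }
  split; [|split; [|reflexivity]].
  - apply ext. intro z. rewrite H'.
    + split; [|auto]. intros [A|(u & Hu & _)]; [exact A|now apply empE in Hu].
    + destruct (Ord_trich Ord_emp (Ord_succ Ob)) as [A|[A|A]]; [exact A|now symmetry in A; apply succ_not_emp in A|now apply empE in A].
  - intros k Hk. assert (Ok := Ord_elem Ob Hk). apply ext. intro z. rewrite succE, !H'.
    + split.
      * intros [A|(u & Hu & ->)]; [auto|]. apply succE in Hu as [Hu| ->]; eauto 6.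
      * intros [[A|(u & Hu & ->)]| ->]; [auto| |]; right; [exists u|exists k]; (split; [apply succE|]); auto.
    + apply succE; auto.
    + now apply succ_mono.
Qed.

Lemma parity_exists : exists c, app c emp = emp /\
  forall n, n ∈ omega -> app c (succ n) = sep (sing emp) (fun z => z ∉ app c n).
Proof.
  destruct (@omega_rec _ _ emp (fun x => sep (sing emp) (fun z => z ∉ x))) as (h & _ & A & B); [dfn|].
  eauto.
Qed.

(** The characteristic function of the odd numbers: each step takes 1 minus the previous value. As a
    set of [M] it also decides the parity of nonstandard naturals. *)
Definition parity : M := eps (fun c => app c emp = emp /\
  forall n, n ∈ omega -> app c (succ n) = sep (sing emp) (fun z => z ∉ app c n)).
Definition Even n : Prop := app parity n = emp.

Lemma Even_emp : Even emp.
Proof. exact (proj1 (epsP parity_exists)). Qed.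

Lemma Even_succ n : n ∈ omega -> Even (succ n) <-> ~ Even n.
Proof.
  intro Hn. destruct (epsP parity_exists) as [A B]. fold parity in A, B. unfold Even.
  assert (E := B n Hn).
  assert (S : forall m, m ∈ omega -> app parity m = emp \/ app parity m = sing emp).
  { intros m Hm. destruct (nat_cases Hm) as [->|(k & Hk & ->)]; [auto|]. rewrite (B k Hk).
    destruct (classic (emp ∈ app parity k)) as [K|K]; [left|right]; apply ext; intro z;
      rewrite sepE by dfn; rewrite singE; split.
    - intros [-> Q]. contradiction.
    - intro Q. now apply empE in Q.
    - tauto.
    - intros ->. auto. }
  split.
  - intros F G. assert (X : emp ∈ app parity (succ n)).
    { rewrite E, sepE by dfn. rewrite singE, G. split; [reflexivity|apply empE]. }
    rewrite F in X. now apply empE in X.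
  - intro N. destruct (S n Hn) as [F|F]; [contradiction|]. rewrite E, F. apply ext. intro z.
    rewrite sepE by dfn. rewrite singE. split; [tauto|]. intro Q. now apply empE in Q.
Qed.

Lemma is_even_spec e : is_even e -> exists g m h, (g = emp \/ Lim g) /\ m ∈ omega /\ Even m /\
  app h emp = g /\ (forall k, k ∈ m -> app h (succ k) = succ (app h k)) /\ app h m = e.
Proof.
  intros (g & n & m & Lg & Hn & S1 & S2). apply is_natural_iff in Hn. apply is_limit_cases in Lg.
  destruct (is_ord_sum_spec Hn S1) as (f & F0 & FS & Fn).
  assert (On : Ord n) by (eapply Ord_elem; eauto; apply Ord_omega).
  (* [app f k] is n + k, even exactly when n and k have the same parity; the case k = n shows that m
     is even. *)
  assert (K : forall k, k ∈ omega -> k ∈ succ n -> app f k ∈ omega /\ (Even (app f k) <-> (Even n <-> Even k))).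
  { apply (nat_ind_ (P := fun k => k ∈ succ n -> app f k ∈ omega /\ (Even (app f k) <-> (Even n <-> Even k)))).
    - unfold Even. dfn.
    - intros _. rewrite F0. split; [exact Hn|]. assert (E := Even_emp). tauto.
    - intros k Hk IH Hs. assert (Hkn : k ∈ n).
      { apply succE in Hs as [Hs|Hs].
        - apply (Ord_trans On Hs). apply succE; auto.
        - rewrite <- Hs. apply succE; auto. }
      destruct IH as [A B]; [apply succE; auto|]. rewrite FS by exact Hkn.
      split; [now apply omega_succ|]. rewrite !Even_succ by auto. destruct (classic (Even k)); tauto. }
  destruct (K n Hn) as [Hm Em]; [apply succE; auto|]. rewrite Fn in Hm, Em.
  destruct (is_ord_sum_spec Hm S2) as (h & H0 & HS & Hh).
  exists g, m, h. repeat split; auto. tauto.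
Qed.

End Interface.

(** * Satisfaction inside the model *)

Section Satisfaction.
Context {M : SetStructure} {HZF : ZF M}.
Implicit Types x y z a b c f g e r s v w k i t : M.

Fixpoint num (n : nat) : M := match n with 0 => emp | S n => succ (num n) end.

Lemma num_omega n : num n ∈ omega.
Proof. induction n; [apply omega_emp|now apply omega_succ]. Qed.

Lemma num_inj m n : num m = num n -> m = n.
Proof.
  revert n. induction m as [|m IH]; intros [|n] E; auto; simpl in E.
  - symmetry in E. now apply succ_not_emp in E.
  - now apply succ_not_emp in E.
  - f_equal. apply IH. now apply succ_inj.
Qed.

Lemma is_succ_iter_iff n x y : is_succ_iter n x y <-> y = Nat.iter n succ x.
Proof.
  revert y. induction n as [|n IH]; intro y; simpl; [reflexivity|]. split.
  - intros (z & A & B). apply IH in A as ->. now apply is_succ_iff.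
  - intros ->. exists (Nat.iter n succ x). split; [now apply IH|now apply is_succ_iff].
Qed.

Lemma num_iter n : num n = Nat.iter n succ emp.
Proof. induction n as [|n IH]; simpl; congruence. Qed.

Lemma is_tagged_iff n x t : is_tagged n x t <-> t = opair (num n) x.
Proof.
  split.
  - intros (e & k & A & B & C). apply is_empty_iff in A as ->. apply is_succ_iter_iff in B as ->.
    apply is_opair_iff in C. now rewrite num_iter.
  - intros ->. exists emp, (num n). rewrite is_empty_iff, is_succ_iter_iff, is_opair_iff, num_iter. auto.
Qed.

Lemma is_tagged2_iff n x y t : is_tagged2 n x y t <-> t = opair (num n) (opair x y).
Proof.
  split.
  - intros (p & A & B). apply is_opair_iff in A as ->. now apply is_tagged_iff.
  - intros ->. exists (opair x y). now rewrite is_opair_iff, is_tagged_iff.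
Qed.

Definition cMem i k := opair (num 0) (opair i k).
Definition cEq i k := opair (num 1) (opair i k).
Definition cNot x := opair (num 2) x.
Definition cAnd x y := opair (num 3) (opair x y).
Definition cEx i x := opair (num 4) (opair i x).

(** Iterating the power set ω times, cumulatively, above ω gives a set closed under pairs: two
    elements of some stage have their pair in the next stage. *)
Lemma formula_closed_exists : exists F : M, formula_closed F.
Proof.
  destruct (@omega_rec _ _ omega (fun x => cup x (Pow x))) as (h & _ & H0 & HS); [dfn|].
  set (T := Un (repl omega (fun n => app h n))).
  assert (HT : forall x, x ∈ T <-> exists n, n ∈ omega /\ x ∈ app h n).
  { intro x. unfold T. rewrite UnE. split.
    - intros (y & Hy & Hx). apply replE in Hy as (n & Hn & ->); [eauto|dfn].
    - intros (n & Hn & Hx). exists (app h n). split; [apply replE; [dfn|eauto]|exact Hx]. }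
  assert (mono : forall n, n ∈ omega -> forall m, m ∈ n -> subset (app h m) (app h n)).
  { apply (nat_ind_ (P := fun n => forall m, m ∈ n -> subset (app h m) (app h n))); [dfn| |].
    - intros m Hm. now apply empE in Hm.
    - intros n Hn IH m Hm z Hz. rewrite HS by exact Hn. apply cupE. left.
      apply succE in Hm as [Hm| ->]; [now apply (IH m)|exact Hz]. }
  assert (P : forall x y, x ∈ T -> y ∈ T -> upair x y ∈ T).
  { assert (K : forall x y n m, n ∈ omega -> m ∈ omega -> subset n m -> x ∈ app h n -> y ∈ app h m -> upair x y ∈ T).
    { intros x y n m Hn Hm S Hx Hy. apply HT. exists (succ m). split; [now apply omega_succ|].
      rewrite HS by exact Hm. apply cupE. right. apply PowE. intros z Hz.
      apply upairE in Hz as [->| ->]; [|exact Hy].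
      apply Ord_subset in S as [S| ->]; [now apply (mono m Hm n)|exact Hx|..]; eapply Ord_elem; eauto; apply Ord_omega. }
    intros x y Hx Hy. apply HT in Hx as (n & Hn & Hx), Hy as (m & Hm & Hy).
    assert (On := Ord_elem Ord_omega Hn). assert (Om := Ord_elem Ord_omega Hm).
    destruct (Ord_le_or On Om) as [S|S]; [now apply (K x y n m)|].
    replace (upair x y) with (upair y x) by (apply ext; intro; rewrite !upairE; tauto).
    apply (K y x m n); auto. now apply Ord_sub. }
  assert (N : forall n, n ∈ omega -> n ∈ T).
  { intros n Hn. apply HT. exists emp. split; [apply omega_emp|]. now rewrite H0. }
  assert (O : forall x y, x ∈ T -> y ∈ T -> opair x y ∈ T).
  { intros x y Hx Hy. unfold opair, sing. auto. }
  assert (NN := fun n => N _ (num_omega n)).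
  exists T. repeat split; intros;
    repeat match goal with
    | H : is_natural _ |- _ => apply is_natural_iff in H
    | H : code_mem _ _ _ |- _ => apply is_tagged2_iff in H as ->
    | H : code_eq _ _ _ |- _ => apply is_tagged2_iff in H as ->
    | H : code_and _ _ _ |- _ => apply is_tagged2_iff in H as ->
    | H : code_ex _ _ _ |- _ => apply is_tagged2_iff in H as ->
    | H : code_not _ _ |- _ => apply is_tagged_iff in H as ->
    end; auto 10.
Qed.

Definition closedF (F : M) : Prop :=
  (forall i k, i ∈ omega -> k ∈ omega -> cMem i k ∈ F) /\
  (forall i k, i ∈ omega -> k ∈ omega -> cEq i k ∈ F) /\
  (forall x, x ∈ F -> cNot x ∈ F) /\
  (forall x y, x ∈ F -> y ∈ F -> cAnd x y ∈ F) /\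
  (forall i x, i ∈ omega -> x ∈ F -> cEx i x ∈ F).

Lemma formula_closed_iff F : formula_closed F <-> closedF F.
Proof.
  split.
  - intros (A & B & C & D & E). split; [|split; [|split; [|split]]].
    + intros i k Hi Hk. apply (A i k); try now apply is_natural_iff. now apply is_tagged2_iff.
    + intros i k Hi Hk. apply (B i k); try now apply is_natural_iff. now apply is_tagged2_iff.
    + intros x Hx. apply (C x); [exact Hx|]. now apply is_tagged_iff.
    + intros x y Hx Hy. apply (D x y); auto. now apply is_tagged2_iff.
    + intros i x Hi Hx. apply (E i x); auto; [now apply is_natural_iff|]. now apply is_tagged2_iff.
  - intros (A & B & C & D & E). split; [|split; [|split; [|split]]].
    + intros i k t Hi Hk Ht. apply is_tagged2_iff in Ht as ->. apply A; now apply is_natural_iff.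
    + intros i k t Hi Hk Ht. apply is_tagged2_iff in Ht as ->. apply B; now apply is_natural_iff.
    + intros x t Hx Ht. apply is_tagged_iff in Ht as ->. now apply C.
    + intros x y t Hx Hy Ht. apply is_tagged2_iff in Ht as ->. now apply D.
    + intros i x t Hi Hx Ht. apply is_tagged2_iff in Ht as ->. apply E; auto. now apply is_natural_iff.
Qed.

Lemma Dfm_closedF (s : (nat -> M) -> M) : DT everything everything s -> Dfn everything everything (fun env => closedF (s env)).
Proof. apply (Dfn_pred1 (P := closedF)). unfold closedF, cMem, cEq, cNot, cAnd, cEx. dfn. Qed.

Definition Fm : M := eps (fun F => forall x, x ∈ F <-> is_formula x).
Lemma FmE x : x ∈ Fm <-> is_formula x.
Proof.
  refine (epsP (P := fun F => forall x, x ∈ F <-> is_formula x) _ x).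
  destruct formula_closed_exists as [F0 H0].
  exists (sep F0 (fun x => forall F, closedF F -> x ∈ F)). intro y.
  assert (D : Dfn everything everything (fun env : nat -> M => forall F, closedF F -> env 0 ∈ F)).
  { dfn. apply Dfm_closedF. dfn. }
  rewrite sepE by exact D. unfold is_formula. split.
  - intros [_ H] F HF. apply H. now apply formula_closed_iff.
  - intro H. split; [now apply H|]. intros F HF. apply H. now apply formula_closed_iff.
Qed.

Lemma Fm_closed : closedF Fm.
Proof.
  assert (K : forall x, x ∈ Fm <-> forall F, closedF F -> x ∈ F).
  { intro x. rewrite FmE. unfold is_formula. split; intros H F HF; apply H; now apply formula_closed_iff. }
  split; [|split; [|split; [|split]]]; intros; apply K; intros F HF.
  - now apply HF.
  - now apply HF.
  - apply HF. now apply (proj1 (K x)).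
  - apply HF; [now apply (proj1 (K x))|now apply (proj1 (K y))].
  - apply HF; [assumption|now apply (proj1 (K x))].
Qed.

Lemma Fm_least F : closedF F -> subset Fm F.
Proof. intros H x Hx. apply FmE in Hx. apply Hx. now apply formula_closed_iff. Qed.

Section Structure.
Context (A : M).

Definition isass s : Prop := isfn s omega /\ forall n, n ∈ omega -> app s n ∈ A.

Lemma is_assignment_iff s : is_assignment A s <-> isass s.
Proof.
  split.
  - intros (w & W & F). apply is_omega_iff in W as ->. now apply is_function_iff.
  - intro H. exists omega. split; [now apply is_omega_iff|now apply is_function_iff].
Qed.

(** The distinction whether k = i is pushed into the elements of the value, which keeps the term
    definable by separation. *)
Definition up s i a : M := lam omega (fun k => sep (cup a (app s k))
  (fun z => (k = i /\ z ∈ a) \/ (k <> i /\ z ∈ app s k))).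

Lemma up_fn s i a : isfn (up s i a) omega /\ forall k, k ∈ omega ->
  app (up s i a) k = sep (cup a (app s k)) (fun z => (k = i /\ z ∈ a) \/ (k <> i /\ z ∈ app s k)).
Proof. unfold up. apply (lam_fn omega (F := fun k => _)). dfn. Qed.

Lemma up_eq s i a : i ∈ omega -> app (up s i a) i = a.
Proof.
  intro Hi. rewrite (proj2 (up_fn s i a) i Hi). apply ext. intro z. rewrite sepE by dfn.
  rewrite cupE. tauto.
Qed.

Lemma up_neq s i a k : k ∈ omega -> k <> i -> app (up s i a) k = app s k.
Proof.
  intros Hk N. rewrite (proj2 (up_fn s i a) k Hk). apply ext. intro z. rewrite sepE by dfn.
  rewrite cupE. tauto.
Qed.

Lemma up_ass s i a : isass s -> i ∈ omega -> a ∈ A -> isass (up s i a).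
Proof.
  intros [F H] Hi Ha. split; [apply up_fn|]. intros n Hn. destruct (classic (n = i)) as [->|N].
  - now rewrite up_eq.
  - rewrite up_neq; auto.
Qed.

Lemma is_update_iff s i a s' : isass s -> i ∈ omega -> isass s' -> is_update s i a s' <-> s' = up s i a.
Proof.
  intros [F H] Hi [F' H']. assert (U := up_fn s i a). split.
  - intro E. apply (isfn_ext F' (proj1 U)). intros k Hk.
    assert (K : pair_in s' k (app s' k)) by (apply pair_in_iff, (isfn_pair _ _ F'); auto).
    apply E in K as [[-> ->]|[N K]]; [now rewrite up_eq|].
    rewrite up_neq by auto. now apply pair_in_iff, (isfn_pair _ _ F) in K.
  - intros -> k y. rewrite !pair_in_iff, (isfn_pair _ _ F), (isfn_pair _ _ (proj1 U)).
    destruct (classic (k = i)) as [->|N].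
    + rewrite up_eq by exact Hi. tauto.
    + split; [intros [Hk ->]; right|intros [[? _]|[_ [Hk ->]]]; [contradiction|]]; rewrite up_neq; auto.
Qed.

Let Ass := sep (Pow (prod omega A)) isass.
Let AssE s : s ∈ Ass <-> isass s.
Proof.
  unfold Ass. rewrite sepE by (unfold isass; dfn). split; [tauto|]. intro H. split; [|exact H].
  apply PowE. intros p Hp. destruct H as [F H]. apply F in Hp as (x & Hx & ->). apply opair_prod. auto.
Qed.

Let sub x t : Prop := t = cNot x \/ (exists y, t = cAnd x y \/ t = cAnd y x) \/ exists i, t = cEx i x.
Let step t g : M := sep Ass (fun s =>
  (exists i k, t = cMem i k /\ app s i ∈ app s k) \/
  (exists i k, t = cEq i k /\ app s i = app s k) \/
  (exists x, t = cNot x /\ s ∉ app g x) \/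
  (exists x y, t = cAnd x y /\ s ∈ app g x /\ s ∈ app g y) \/
  (exists i x, t = cEx i x /\ exists a, a ∈ A /\ up s i a ∈ app g x)).

Let Dup (s t u : (nat -> M) -> M) : DT everything everything s -> DT everything everything t -> DT everything everything u ->
  DT everything everything (fun env => up (s env) (t env) (u env)).
Proof.
  apply (DT_fun3 (F := up)). split; [intros; exact I|].
  apply Dfn_ext with (fun env => isfn (env 0) omega /\ forall k, k ∈ omega ->
    app (env 0) k = sep (cup (env 3) (app (env 1) k)) (fun z => (k = env 2 /\ z ∈ env 3) \/ (k <> env 2 /\ z ∈ app (env 1) k)));
    [dfn|].
  intros env _. split; [intros ->; apply up_fn|]. intros [F E].
  apply (isfn_ext F (proj1 (up_fn _ _ _))). intros k Hk. rewrite E by exact Hk.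
  symmetry. now apply up_fn.
Qed.

Let num_neq m n : Nat.eqb m n = false -> num m <> num n.
Proof. intros E F. apply num_inj in F. subst. now rewrite Nat.eqb_refl in E. Qed.

Ltac codes := unfold cMem, cEq, cNot, cAnd, cEx in *;
  repeat match goal with
  | E : opair _ _ = opair _ _ |- _ => apply opair_inj in E as [? ?]
  | E : num ?m = num ?n |- _ => first [ exfalso; exact (@num_neq m n eq_refl E) | clear E ]
  end; subst.

(** If Z had no minimal element, the formulas outside Z would be closed under the formation rules
    and hence be all formulas. *)
Let wf_sub Z : subset Z Fm -> (exists z, z ∈ Z) -> exists z, z ∈ Z /\ forall y, y ∈ Z -> ~ sub y z.
Proof.
  intros HZ (z0 & Hz0). apply NNPP. intro N.
  assert (N' : forall z, z ∈ Z -> exists y, y ∈ Z /\ sub y z).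
  { intros z Hz. apply NNPP. intro N'. apply N. exists z. split; [exact Hz|]. intros y Hy Hs. eauto. }
  set (F := sep Fm (fun x => x ∉ Z)).
  assert (HF : forall x, x ∈ F <-> x ∈ Fm /\ x ∉ Z) by (intro; unfold F; rewrite sepE; [reflexivity|dfn]).
  assert (C : closedF F).
  { destruct Fm_closed as (C1 & C2 & C3 & C4 & C5).
    split; [|split; [|split; [|split]]]; intros; rewrite HF in *.
    - split; [auto|]. intro K. destruct (N' _ K) as (y & Hy & [E|[(u & [E|E])|(u & E)]]); codes.
    - split; [auto|]. intro K. destruct (N' _ K) as (y & Hy & [E|[(u & [E|E])|(u & E)]]); codes.
    - split; [apply C3; tauto|]. intro K. destruct (N' _ K) as (y & Hy & [E|[(u & [E|E])|(u & E)]]); codes; tauto.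
    - split; [apply C4; tauto|]. intro K. destruct (N' _ K) as (z & Hz & [E|[(u & [E|E])|(u & E)]]); codes; tauto.
    - split; [apply C5; tauto|]. intro K. destruct (N' _ K) as (z & Hz & [E|[(u & [E|E])|(u & E)]]); codes; tauto. }
  assert (K := Fm_least C (HZ _ Hz0)). apply HF in K. tauto.
Qed.

(** Elementarity is stated through the existence of a satisfaction relation, so it has content only
    once there is one. Recursion on subformulas assigns to each formula the set of assignments that
    satisfy it. *)
Theorem satisfaction_exists : exists S, is_satisfaction A S.
Proof.
  destruct (@wf_recursion _ _ Fm sub step) as (V & HV & E).
  - unfold sub, cNot, cAnd, cEx. dfn.
  - unfold step, cMem, cEq, cNot, cAnd, cEx. repeat first [dfn1 | apply Dup].
  - exact wf_sub.
  - assert (DS : Dfn everything everything (fun env => sub (env 0) (env 1)))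
      by (unfold sub, cNot, cAnd, cEx; dfn).
    assert (stepE : forall t g s, s ∈ step t g <-> isass s /\ (
      (exists i k, t = cMem i k /\ app s i ∈ app s k) \/
      (exists i k, t = cEq i k /\ app s i = app s k) \/
      (exists x, t = cNot x /\ s ∉ app g x) \/
      (exists x y, t = cAnd x y /\ s ∈ app g x /\ s ∈ app g y) \/
      (exists i x, t = cEx i x /\ exists a, a ∈ A /\ up s i a ∈ app g x))).
    { intros t g s. unfold step. rewrite sepE.
      - now rewrite AssE.
      - unfold cMem, cEq, cNot, cAnd, cEx. repeat first [dfn1 | apply Dup]. }
    assert (R : forall x t, x ∈ Fm -> sub x t -> app (res sub V t) x = app V x).
    { intros x t Hx Hs. apply app_val.
      - rewrite resE by exact DS. split; [now apply (isfn_pair _ _ HV)|]. eauto.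
      - intros y Hy. rewrite resE in Hy by exact DS. destruct Hy as [Hy _].
        now apply (isfn_pair _ _ HV) in Hy as [_ ->]. }
    set (S := sep (prod Fm Ass) (fun p => exists t s, p = opair t s /\ s ∈ app V t)).
    assert (HS : forall t s, t ∈ Fm -> isass s -> (pair_in S t s <-> s ∈ app V t)).
    { intros t s Ht Hs. rewrite pair_in_iff. unfold S. rewrite sepE by dfn. split.
      - intros [_ (t' & s' & Ep & H)]. now apply opair_inj in Ep as [-> ->].
      - intro H. split; [apply opair_prod; now rewrite AssE|eauto]. }
    destruct Fm_closed as (C1 & C2 & C3 & C4 & C5).
    exists S. intros s Hs. apply is_assignment_iff in Hs. assert (Hs' := Hs). destruct Hs' as [Fs _].
    assert (PI : forall i y, i ∈ omega -> pair_in s i y <-> y = app s i).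
    { intros i y Hi. rewrite pair_in_iff, (isfn_pair _ _ Fs). tauto. }
    split; [|split; [|split; [|split]]].
    + intros i k t Hi Hk Ht. apply is_natural_iff in Hi, Hk. apply is_tagged2_iff in Ht. fold (cMem i k) in Ht. subst t.
      rewrite HS, E, stepE by auto. split.
      * intros (_ & [(i' & k' & H & K)|[(i' & k' & H & K)|[(x & H & K)|[(x & y & H & K)|(x & y & H & K)]]]]); codes.
        exists (app s i'), (app s k'). rewrite !PI by auto. auto.
      * intros (x & y & Hx & Hy & K). apply PI in Hx as ->, Hy as ->; auto. split; [exact Hs|]. left. eauto.
    + intros i k t Hi Hk Ht. apply is_natural_iff in Hi, Hk. apply is_tagged2_iff in Ht. fold (cEq i k) in Ht. subst t.
      rewrite HS, E, stepE by auto. split.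
      * intros (_ & [(i' & k' & H & K)|[(i' & k' & H & K)|[(x & H & K)|[(x & y & H & K)|(x & y & H & K)]]]]); codes.
        exists (app s i'), (app s k'). rewrite !PI by auto. auto.
      * intros (x & y & Hx & Hy & K). apply PI in Hx as ->, Hy as ->; auto. split; [exact Hs|]. right; left. eauto.
    + intros x t Hx Ht. apply FmE in Hx. apply is_tagged_iff in Ht. fold (cNot x) in Ht. subst t.
      assert (Hsub : sub x (cNot x)) by (left; reflexivity).
      rewrite (HS (cNot x)), E, stepE, HS by auto. split.
      * intros (_ & [(i' & k' & H & K)|[(i' & k' & H & K)|[(x' & H & K)|[(x' & y & H & K)|(x' & y & H & K)]]]]); codes.
        now rewrite R in K by auto.
      * intro K. split; [exact Hs|]. right; right; left. exists x. rewrite R by auto. auto.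
    + intros x y t Hx Hy Ht. apply FmE in Hx, Hy. apply is_tagged2_iff in Ht. fold (cAnd x y) in Ht. subst t.
      assert (Hsub : sub x (cAnd x y)) by (right; left; exists y; auto).
      assert (Hsub' : sub y (cAnd x y)) by (right; left; exists x; auto).
      rewrite (HS (cAnd x y)), E, stepE, !HS by auto. split.
      * intros (_ & [(i' & k' & H & K)|[(i' & k' & H & K)|[(x' & H & K)|[(x' & y' & H & K)|(x' & y' & H & K)]]]]); codes.
        rewrite !R in K by auto. exact K.
      * intro K. split; [exact Hs|]. right; right; right; left. exists x, y. rewrite !R by auto. auto.
    + intros i x t Hi Hx Ht. apply is_natural_iff in Hi. apply FmE in Hx. apply is_tagged2_iff in Ht. fold (cEx i x) in Ht. subst t.
      assert (Hsub : sub x (cEx i x)) by (right; right; exists i; auto).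
      rewrite (HS (cEx i x)), E, stepE by auto. split.
      * intros (_ & [(i' & k' & H & K)|[(i' & k' & H & K)|[(x' & H & K)|[(x' & y' & H & K)|(i' & x' & H & a & Ha & K)]]]]); codes.
        rewrite R in K by auto. assert (Hu : isass (up s i' a)) by now apply up_ass.
        exists a, (up s i' a). split; [exact Ha|]. rewrite is_assignment_iff. split; [exact Hu|].
        split; [now apply is_update_iff|]. now apply HS.
      * intros (a & s' & Ha & Hs' & U & K). apply is_assignment_iff in Hs'. apply HS in K; auto.
        apply is_update_iff in U as ->; auto. split; [exact Hs|]. right; right; right; right.
        exists i, x. split; [reflexivity|]. exists a. rewrite R by auto. auto.
Qed.

Fixpoint code (p : formula) : M :=
  match p with
  | fMem i k => cMem (num i) (num k)
  | fEq i k => cEq (num i) (num k)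
  | fNot p => cNot (code p)
  | fAnd p q => cAnd (code p) (code q)
  | fEx i p => cEx (num i) (code p)
  end.

Lemma code_Fm p : code p ∈ Fm.
Proof.
  destruct Fm_closed as (C1 & C2 & C3 & C4 & C5).
  induction p; simpl; auto using num_omega.
Qed.

(** Internal and external truth can be compared only for formulas of the metatheory; these suffice
    for everything below. *)
Lemma satisfaction_code S p : is_satisfaction A S -> forall s, isass s ->
  pair_in S (code p) s <-> holds_in (fun x => x ∈ A) (fun n => app s (num n)) p.
Proof.
  intro HS. induction p as [i k|i k|p IH|p IHp q IHq|i p IH]; intros s Hs;
    destruct (HS s (proj2 (is_assignment_iff s) Hs)) as (T1 & T2 & T3 & T4 & T5); simpl.
  - rewrite (T1 (num i) (num k)) by (try apply is_natural_iff, num_omega; now apply is_tagged2_iff).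
    destruct Hs as [F _]. split.
    + intros (x & y & Hx & Hy & K). apply pair_in_iff, (isfn_pair _ _ F) in Hx as [_ ->], Hy as [_ ->]. exact K.
    + intro K. exists (app s (num i)), (app s (num k)).
      rewrite !pair_in_iff, !(isfn_pair _ _ F). auto using num_omega.
  - rewrite (T2 (num i) (num k)) by (try apply is_natural_iff, num_omega; now apply is_tagged2_iff).
    destruct Hs as [F _]. split.
    + intros (x & y & Hx & Hy & K). apply pair_in_iff, (isfn_pair _ _ F) in Hx as [_ ->], Hy as [_ ->]. exact K.
    + intro K. exists (app s (num i)), (app s (num k)).
      rewrite !pair_in_iff, !(isfn_pair _ _ F). auto using num_omega.
  - rewrite (T3 (code p)) by (try apply FmE, code_Fm; now apply is_tagged_iff). now rewrite IH.
  - rewrite (T4 (code p) (code q)) by (try apply FmE, code_Fm; now apply is_tagged2_iff).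
    now rewrite IHp, IHq.
  - rewrite (T5 (num i) (code p)) by (try apply FmE, code_Fm; try apply is_natural_iff, num_omega; now apply is_tagged2_iff).
    assert (K : forall a n, app (up s (num i) a) (num n) = upd (fun n => app s (num n)) i a n).
    { intros a n. unfold upd. destruct (Nat.eqb_spec n i) as [->|N].
      - apply up_eq, num_omega.
      - apply up_neq; [apply num_omega|]. intro E. now apply num_inj in E. }
    split.
    + intros (a & s' & Ha & Hs' & U & P). apply is_assignment_iff in Hs'.
      apply is_update_iff in U as ->; auto using num_omega. exists a. split; [exact Ha|].
      apply IH in P; [|exact Hs']. now apply (holds_in_ext _ p (K a)) in P.
    + intros (a & Ha & P). assert (Hu := up_ass Hs (num_omega i) Ha).
      exists a, (up s (num i) a). split; [exact Ha|]. rewrite is_assignment_iff. split; [exact Hu|].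
      split; [apply is_update_iff; auto using num_omega|]. apply IH; [exact Hu|].
      now apply (holds_in_ext _ p (K a)).
Qed.

Fixpoint fbound (p : formula) : nat :=
  match p with
  | fMem i k => S (i + k)
  | fEq i k => S (i + k)
  | fNot p => fbound p
  | fAnd p q => fbound p + fbound q
  | fEx i p => fbound p
  end.

Lemma holds_in_bound U p : forall env env' : nat -> M, (forall n, n < fbound p -> env n = env' n) ->
  holds_in U env p <-> holds_in U env' p.
Proof.
  induction p as [i k|i k|p IH|p IHp q IHq|i p IH]; intros env env' H; simpl in *.
  - rewrite !H by lia. reflexivity.
  - rewrite !H by lia. reflexivity.
  - now rewrite (IH env env').
  - rewrite (IHp env env'), (IHq env env'); [reflexivity|..]; intros; apply H; lia.
  - split; intros [a [Ha P]]; exists a; (split; [exact Ha|]); revert P; apply IH;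
      intros n Hn; unfold upd; destruct (Nat.eqb n i); auto; symmetry; auto.
Qed.

(** The sequence belongs to the metatheory and need not be represented in [M], but each finite part
    of it is, and a formula reads only a finite part. *)
Lemma assignment_extends (env : nat -> M) : (forall n, env n ∈ A) -> forall N, exists s, isass s /\
  forall n, n < N -> app s (num n) = env n.
Proof.
  intros He. induction N as [|N (s & Hs & E)].
  - destruct (@lam_fn _ _ omega (fun _ => env 0)) as [F V]; [dfn|]. exists (lam omega (fun _ => env 0)).
    split; [split; [exact F|]|lia]. intros n Hn. now rewrite V.
  - exists (up s (num N) (env N)). split; [apply up_ass; auto using num_omega|]. intros n Hn.
    destruct (Nat.eq_dec n N) as [->|K].
    + apply up_eq, num_omega.
    + rewrite up_neq; [apply E; lia|apply num_omega|]. intro F. now apply num_inj in F.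
Qed.

Theorem elementary_formulas j : is_elementary_embedding j A A ->
  isfn j A /\ (forall x, x ∈ A -> app j x ∈ A) /\
  forall p (env : nat -> M), (forall n, env n ∈ A) ->
    dholds (fun x => x ∈ A) env p <-> dholds (fun x => x ∈ A) (fun n => app j (env n)) p.
Proof.
  intros [Fj H]. apply is_function_iff in Fj as [Fj Vj]. split; [exact Fj|]. split; [exact Vj|].
  intros p env He.
  assert (T : forall e : nat -> M, dholds (fun x => x ∈ A) e p <->
    holds_in (fun x => x ∈ A) (fun n => e (if Nat.ltb n 2 then n else Nat.div2 n)) (to_named 0 p)).
  { intro e. apply to_named_spec. intros [|[|i]]; try reflexivity.
    change (name 0 (S (S i))) with (2 * S (S i)).
    destruct (Nat.ltb_spec (2 * S (S i)) 2); [lia|]. now rewrite Nat.div2_double. }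
  rewrite (T env), (T (fun n => app j (env n))).
  set (q := to_named 0 p). set (e := fun n => env (if Nat.ltb n 2 then n else Nat.div2 n)).
  change (fun n => app j (env (if Nat.ltb n 2 then n else Nat.div2 n))) with (fun n => app j (e n)).
  assert (He' : forall n, e n ∈ A) by (intro; apply He).
  destruct (assignment_extends He' (fbound q)) as (s & Hs & E).
  destruct (@lam_fn _ _ omega (fun n => app j (app s n))) as [F V]; [dfn|].
  set (s' := lam omega (fun n => app j (app s n))) in *.
  assert (Hs' : isass s').
  { split; [exact F|]. intros n Hn. rewrite V by exact Hn. apply Vj. now apply Hs. }
  destruct satisfaction_exists as [S HS].
  assert (K : forall s, isass s -> satisfies A (code q) s <->
    holds_in (fun x => x ∈ A) (fun n => app s (num n)) q).
  { intros u Hu. split.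
    - intros (S' & HS' & P). now apply (satisfaction_code q HS' Hu).
    - intro P. exists S. split; [exact HS|]. now apply satisfaction_code. }
  rewrite <- (holds_in_bound _ (p := q) (env := fun n => app s (num n))) by (intros; now apply E).
  rewrite <- (holds_in_bound _ (p := q) (env := fun n => app s' (num n)) (env' := fun n => app j (e n))).
  - rewrite <- !K by auto. apply H.
    + apply FmE, code_Fm.
    + now apply is_assignment_iff.
    + now apply is_assignment_iff.
    + intros i x y Hx Hy. rewrite pair_in_iff in *. apply (isfn_pair _ _ (proj1 Hs)) in Hx as [Hi ->].
      apply (isfn_pair _ _ F) in Hy as [_ ->]. rewrite V by exact Hi. apply (isfn_pair _ _ Fj).
      split; [now apply Hs|reflexivity].
  - intros n Hn. rewrite V by apply num_omega. now rewrite E.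
Qed.

End Structure.
End Satisfaction.

(** * Flat pairs and elementary maps *)

Section Flat.
Context {M : SetStructure} {HZF : ZF M}.
Implicit Types x y z a b c u w : M.

(* [sg] shifts the natural numbers in a set by one, which leaves room for the
   marker [emp]; [fp] is the Quine-Rosser pair. *)
Definition sg x : M := cup (sep x (fun n => n ∉ omega)) (repl (sep x (fun n => n ∈ omega)) (fun n => succ n)).
Definition sg0 x : M := cup (sg x) (sing emp).
Definition fp a b : M := cup (repl a (fun x => sg x)) (repl b (fun x => sg0 x)).

Lemma sgE x z : z ∈ sg x <-> (z ∈ x /\ z ∉ omega) \/ exists n, n ∈ x /\ (n ∈ omega /\ z = succ n).
Proof.
  unfold sg. rewrite cupE, sepE by dfn. apply or_iff_compat_l. rewrite replE by dfn.
  split; intros (n & H); exists n; rewrite sepE in * by dfn; tauto.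
Qed.

Lemma emp_sg x : emp ∉ sg x.
Proof.
  rewrite sgE. intros [[_ H]|(n & _ & _ & H)]; [apply H, omega_emp|].
  symmetry in H. now apply succ_not_emp in H.
Qed.

Lemma sg_inj x y : sg x = sg y -> x = y.
Proof.
  assert (K : forall x n, n ∈ x <-> (n ∉ omega /\ n ∈ sg x) \/ (n ∈ omega /\ succ n ∈ sg x)).
  { clear. intros x n. rewrite !sgE. split.
    - intro H. destruct (classic (n ∈ omega)) as [N|N]; [right|left; auto].
      split; [exact N|]. right. eauto.
    - intros [[N [H|(m & H & Hm & ->)]]|[N [[H K]|(m & H & Hm & E)]]].
      + tauto.
      + now apply omega_succ in Hm.
      + now apply omega_succ in N.
      + apply succ_inj in E. now subst. }
  intro E. apply ext. intro n. rewrite (K x), (K y), E. tauto.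
Qed.

Lemma sg0E x z : z ∈ sg0 x <-> z ∈ sg x \/ z = emp.
Proof. unfold sg0. now rewrite cupE, singE. Qed.

Lemma sg0_inj x y : sg0 x = sg0 y -> x = y.
Proof.
  intro E. apply sg_inj. apply ext. intro z.
  assert (K : forall x, z ∈ sg x <-> z ∈ sg0 x /\ z <> emp).
  { intro u. rewrite sg0E. split; [|tauto]. intro H. split; [auto|]. intros ->. now apply emp_sg in H. }
  now rewrite !K, E.
Qed.

Lemma sg_sg0 x y : sg x <> sg0 y.
Proof. intro E. apply (@emp_sg x). rewrite E. apply sg0E. auto. Qed.

Lemma DTm_sg s : DT everything everything s -> DT everything everything (fun env => sg (s env)).
Proof. apply (DT_fun1 (F := sg)). unfold sg. dfn. Qed.

Lemma DTm_sg0 s : DT everything everything s -> DT everything everything (fun env => sg0 (s env)).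
Proof. apply (DT_fun1 (F := sg0)). unfold sg0. dfn. apply DTm_sg. dfn. Qed.

Lemma DTm_fp s t : DT everything everything s -> DT everything everything t ->
  DT everything everything (fun env => fp (s env) (t env)).
Proof.
  apply (DT_fun2 (F := fp)). unfold fp. dfn; [apply DTm_sg|apply DTm_sg0]; dfn.
Qed.

Lemma fpE a b z : z ∈ fp a b <-> (exists x, x ∈ a /\ z = sg x) \/ exists x, x ∈ b /\ z = sg0 x.
Proof.
  unfold fp. rewrite cupE, !replE; [reflexivity|apply DTm_sg0; dfn|apply DTm_sg; dfn].
Qed.

Lemma fp_inj a b a' b' : fp a b = fp a' b' -> a = a' /\ b = b'.
Proof.
  assert (K : forall a b x, (x ∈ a <-> sg x ∈ fp a b) /\ (x ∈ b <-> sg0 x ∈ fp a b)).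
  { clear. intros a b x. rewrite !fpE. split; split.
    - eauto.
    - intros [(y & Hy & E)|(y & _ & E)]; [apply sg_inj in E; now subst|now apply sg_sg0 in E].
    - eauto.
    - intros [(y & _ & E)|(y & Hy & E)]; [symmetry in E; now apply sg_sg0 in E|apply sg0_inj in E; now subst]. }
  intro E. split; apply ext; intro x; [rewrite (proj1 (K a b x)), (proj1 (K a' b' x))|
    rewrite (proj2 (K a b x)), (proj2 (K a' b' x))]; now rewrite E.
Qed.

(** Bounded formulas for the successor, the shifts and the flat pair, with ω as a parameter. The
    power set of a level is not closed under unordered pairs, so its first-order language must
    express these notions without terms. *)
Definition isSucc m n : Prop := m ∈ n /\ (forall w, w ∈ m -> w ∈ n) /\ forall w, w ∈ n -> w ∈ m \/ w = m.
Definition isSg w0 x z : Prop :=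
  (forall n, n ∈ z -> (n ∈ x /\ n ∉ w0) \/ exists m, m ∈ x /\ (m ∈ w0 /\ isSucc m n)) /\
  forall n, n ∈ x -> (n ∉ w0 -> n ∈ z) /\ (n ∈ w0 -> exists m, m ∈ z /\ isSucc n m).
Definition isSg0 w0 x z : Prop :=
  (forall n, n ∈ z -> (forall w, w ∈ n -> w ∉ n) \/ (n ∈ x /\ n ∉ w0) \/ exists m, m ∈ x /\ (m ∈ w0 /\ isSucc m n)) /\
  (exists n, n ∈ z /\ forall w, w ∈ n -> w ∉ n) /\
  forall n, n ∈ x -> (n ∉ w0 -> n ∈ z) /\ (n ∈ w0 -> exists m, m ∈ z /\ isSucc n m).
Definition isFp w0 a b z : Prop :=
  (forall n, n ∈ z -> (exists x, x ∈ a /\ isSg w0 x n) \/ exists x, x ∈ b /\ isSg0 w0 x n) /\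
  (forall x, x ∈ a -> exists n, n ∈ z /\ isSg w0 x n) /\
  (forall x, x ∈ b -> exists n, n ∈ z /\ isSg0 w0 x n).

Lemma isSucc_iff m n : isSucc m n <-> n = succ m.
Proof.
  split.
  - intros (A & B & C). apply ext. intro z. rewrite succE. split; [apply C|]. intros [H| ->]; auto.
  - intros ->. split; [apply succE; auto|]. split; intros w; rewrite succE; tauto.
Qed.

Lemma isSg_iff x z : isSg omega x z <-> z = sg x.
Proof.
  split.
  - intros [A B]. apply ext. intro n. rewrite sgE. split.
    + intro Hn. destruct (A n Hn) as [H|(m & H & Hm & E)]; [auto|]. apply isSucc_iff in E. eauto.
    + intros [[H K]|(m & H & Hm & ->)]; [now apply (B n)|].
      destruct (proj2 (B m H) Hm) as (n & Hn & E). apply isSucc_iff in E. now subst.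
  - intros ->. split.
    + intros n Hn. apply sgE in Hn as [H|(m & H & Hm & E)]; [auto|]. right. exists m.
      rewrite isSucc_iff. auto.
    + intros n Hn. split; intro K; [apply sgE; auto|]. exists (succ n). rewrite isSucc_iff, sgE. eauto 6.
Qed.

Lemma empty_iff n : (forall w, w ∈ n -> w ∉ n) <-> n = emp.
Proof.
  split; [|intros -> w Hw; now apply empE in Hw]. intro H. apply ext. intro z. split; intro K.
  - now destruct (H z K).
  - now apply empE in K.
Qed.

Lemma isSg0_iff x z : isSg0 omega x z <-> z = sg0 x.
Proof.
  split.
  - intros (A & (e & He & Ee) & B). apply empty_iff in Ee as ->. apply ext. intro n. rewrite sg0E, sgE. split.
    + intro Hn. destruct (A n Hn) as [H|[H|(m & H & Hm & E)]]; [apply empty_iff in H; auto|auto|].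
      apply isSucc_iff in E. eauto 6.
    + intros [[[H K]|(m & H & Hm & ->)]| ->]; [now apply (B n)| |exact He].
      destruct (proj2 (B m H) Hm) as (n & Hn & E). apply isSucc_iff in E. now subst.
  - intros ->. split; [|split].
    + intros n Hn. apply sg0E in Hn as [Hn| ->]; [right|left; now apply empty_iff].
      apply sgE in Hn as [H|(m & H & Hm & E)]; [auto|]. right. exists m. rewrite isSucc_iff. auto.
    + exists emp. rewrite empty_iff, sg0E. auto.
    + intros n Hn. split; intro K; [apply sg0E; left; apply sgE; auto|]. exists (succ n).
      rewrite isSucc_iff, sg0E, sgE. eauto 7.
Qed.

Lemma isFp_iff a b z : isFp omega a b z <-> z = fp a b.
Proof.
  split.
  - intros (A & B & C). apply ext. intro n. rewrite fpE. split.
    + intro Hn. destruct (A n Hn) as [(x & Hx & E)|(x & Hx & E)];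
        [apply isSg_iff in E|apply isSg0_iff in E]; eauto.
    + intros [(x & Hx & ->)|(x & Hx & ->)]; [destruct (B x Hx) as (n & Hn & E); apply isSg_iff in E
        |destruct (C x Hx) as (n & Hn & E); apply isSg0_iff in E]; now subst.
  - intros ->. split; [|split].
    + intros n Hn. apply fpE in Hn as [(x & Hx & ->)|(x & Hx & ->)]; [left|right]; exists x;
        rewrite ?isSg_iff, ?isSg0_iff; auto.
    + intros x Hx. exists (sg x). rewrite isSg_iff, fpE. eauto.
    + intros x Hx. exists (sg0 x). rewrite isSg0_iff, fpE. eauto.
Qed.

(** This closure is what Kuratowski pairs, raising the rank by two, fail to have at successor
    levels. *)
Definition fpclosed P : Prop := forall a b, a ∈ P -> b ∈ P -> fp a b ∈ P.

(** Only natural numbers gain rank under the shift. If u is a subset of V_y, then so is [sg u] when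
    y is infinite, and it is a subset of V_{y+1} when y is finite; either index is still below x. *)
Lemma fp_closed_level f a x : Ord a -> VF f a -> x ∈ succ a -> subset omega x -> fpclosed (Pow (app f x)).
Proof.
  intros Oa HV Hx Hw. assert (Ox := Ord_elem (Ord_succ Oa) Hx).
  assert (ina : forall y, y ∈ x -> y ∈ succ a) by (intros y Hy; exact (Ord_trans (Ord_succ Oa) Hx Hy)).
  assert (K : forall u, u ∈ app f x -> exists y, y ∈ x /\ subset (sg u) (app f y) /\ emp ∈ app f y).
  { intros u Hu. apply (VF_E HV) in Hu as (y & Hy & S); [|exact Hx].
    assert (Oy := Ord_elem Ox Hy).
    destruct (Ord_le_or Ord_omega Oy) as [W|W].
    - assert (Y : subset omega (app f y)).
      { intros n Hn. apply (VF_ord Oa HV (ina _ Hy)); [eapply Ord_elem; eauto; apply Ord_omega|auto]. }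
      exists y. split; [exact Hy|]. split; [|apply Y, omega_emp]. intros z Hz.
      apply sgE in Hz as [[Hz _]|(n & _ & Hn & ->)]; [now apply S|apply Y; now apply omega_succ].
    - assert (Hy' : succ y ∈ x) by now apply Hw, omega_succ.
      exists (succ y). split; [exact Hy'|]. split.
      + intros z Hz. apply (VF_succ Oa HV); [now apply ina|].
        apply sgE in Hz as [[Hz _]|(n & Hz & Hn & ->)]; intros w.
        * apply S in Hz. intro Hwz. exact (VF_trans Oa HV (ina _ Hy) Hz Hwz).
        * rewrite succE. apply S in Hz. intros [Q| ->]; [|exact Hz]. exact (VF_trans Oa HV (ina _ Hy) Hz Q).
      + apply (VF_succ Oa HV); [now apply ina|]. intros w Hw'. now apply empE in Hw'. }
  intros p q Hp Hq. rewrite PowE in *. intros z Hz. apply fpE in Hz as [(u & Hu & ->)|(u & Hu & ->)].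
  - destruct (K u (Hp _ Hu)) as (y & Hy & S & _). apply (VF_E HV _ Hx). eauto.
  - destruct (K u (Hq _ Hu)) as (y & Hy & S & E). apply (VF_E HV _ Hx). exists y. split; [exact Hy|].
    intros w Hwz. apply sg0E in Hwz as [Hwz| ->]; auto.
Qed.

(** Tagging with ∅ and {∅} places two disjoint copies of P inside P. *)
Lemma sle_fp_union P S T : fpclosed P -> emp ∈ P -> sing emp ∈ P ->
  sle S P -> sle T P -> sle (cup S T) P.
Proof.
  intros C E1 E2 (g & Fg & Sg) (h & Fh & Sh).
  exists (sep (prod P (cup S T)) (fun p => exists x y, p = opair (fp x emp) y /\ opair x y ∈ g \/
     p = opair (fp x (sing emp)) y /\ opair x y ∈ h)).
  assert (D : forall p, Dfn everything everything (fun env : nat -> M => exists x y, env p = opair (fp x emp) y /\ opair x y ∈ g \/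
     env p = opair (fp x (sing emp)) y /\ opair x y ∈ h)).
  { intro p. repeat first [dfn1 | apply DTm_fp]. }
  assert (N : emp <> sing emp) by (intro Q; apply (@empE _ _ emp); rewrite Q at 2; now apply singE).
  split.
  - intros u y y' A B. rewrite sepE in A, B by exact (D 0).
    destruct A as [_ (x1 & y1 & [[A A']|[A A']])], B as [_ (x2 & y2 & [[B B']|[B B']])];
      apply opair_inj in A as [A ->], B as [B ->]; rewrite A in B; apply fp_inj in B as [-> B];
      try congruence; eauto.
  - intros y Hy. assert (Hy' := Hy). apply cupE in Hy as [Hy|Hy].
    + destruct (Sg y Hy) as (x & Hx & A). exists (fp x emp). split; [auto|].
      rewrite sepE by exact (D 0). split; [apply opair_prod; auto|eauto 6].
    + destruct (Sh y Hy) as (x & Hx & A). exists (fp x (sing emp)). split; [auto|].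
      rewrite sepE by exact (D 0). split; [apply opair_prod; auto|eauto 7].
Qed.

Lemma sle_fp_image P S T (F : M -> M -> M) : fpclosed P ->
  DT everything everything (fun env => F (env 0) (env 1)) -> sle S P -> sle T P ->
  exists W, (forall z, z ∈ W <-> exists x, x ∈ S /\ exists y, y ∈ T /\ z = F x y) /\ sle W P.
Proof.
  intros C DF (g & Fg & Sg) (h & Fh & Sh).
  set (W := Un (repl S (fun x => repl T (fun y => F x y)))).
  assert (DF' : forall s t : (nat -> M) -> M, DT everything everything s -> DT everything everything t ->
    DT everything everything (fun env => F (s env) (t env))) by (intros s t; apply (DT_fun2 (F := F) DF)).
  assert (HW : forall z, z ∈ W <-> exists x, x ∈ S /\ exists y, y ∈ T /\ z = F x y).
  { intro z. unfold W. rewrite UnE. split.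
    - intros (w & Hw & Hz). apply replE in Hw as (x & Hx & ->); [|dfn; apply DF'; dfn].
      apply replE in Hz as (y & Hy & ->); [eauto 6|apply DF'; dfn].
    - intros (x & Hx & y & Hy & ->). exists (repl T (fun y => F x y)). split; apply replE; eauto.
      + dfn. apply DF'; dfn.
      + apply DF'; dfn. }
  exists W. split; [exact HW|].
  assert (D : Dfn everything everything (fun env : nat -> M => exists x y u v, env 0 = opair (fp x y) (F u v) /\
    opair x u ∈ g /\ opair y v ∈ h)).
  { repeat first [dfn1 | apply DTm_fp | apply DF']. }
  exists (sep (prod P W) (fun p => exists x y u v, p = opair (fp x y) (F u v) /\ opair x u ∈ g /\ opair y v ∈ h)).
  split.
  - intros q z z' A B. rewrite sepE in A, B by exact D.
    destruct A as (_ & x & y & u & v & A & A1 & A2), B as (_ & x' & y' & u' & v' & B & B1 & B2).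
    apply opair_inj in A as [-> ->], B as [B ->]. apply fp_inj in B as [-> ->].
    now rewrite (Fg _ _ _ A1 B1), (Fh _ _ _ A2 B2).
  - intros z Hz. assert (Hz' := Hz). apply HW in Hz as (u & Hu & v & Hv & ->).
    destruct (Sg u Hu) as (x & Hx & A), (Sh v Hv) as (y & Hy & B).
    exists (fp x y). split; [auto|]. rewrite sepE by exact D. split; [apply opair_prod; auto|].
    exists x, y, u, v. auto.
Qed.

(** * Elementary maps and their definable fixed points *)

Definition Elem A k : Prop := (forall x, x ∈ A -> app k x ∈ A) /\
  forall p (env : nat -> M), (forall n, env n ∈ A) ->
    dholds (fun x => x ∈ A) env p <-> dholds (fun x => x ∈ A) (fun n => app k (env n)) p.
Definition fixed A k c : Prop := c ∈ A /\ app k c = c.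

Section Elementary.
Context (A k : M) (HE : Elem A k).
Let U : M -> Prop := fun x => x ∈ A.

(** Parameters fixed by k are carried to themselves, so only the free variables move. *)
Lemma elem_transfer Phi (env : nat -> M) : Dfn U (fixed A k) Phi -> (forall n, env n ∈ A) ->
  Phi env <-> Phi (fun n => app k (env n)).
Proof.
  intros (p & par & Hp & H) He. destruct HE as [E1 E2]. unfold U in *.
  rewrite (H env He), (H (fun n => app k (env n))) by (intro; now apply E1).
  rewrite (E2 p (mix env par)).
  - apply dholds_ext. intro n. unfold mix. destruct (Nat.even n); [reflexivity|apply Hp].
  - intro n. unfold mix. destruct (Nat.even n); [apply He|apply Hp].
Qed.

Lemma elem1 (P : M -> Prop) a : Dfn U (fixed A k) (fun env => P (env 0)) ->
  a ∈ A -> P a <-> P (app k a).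
Proof. intros D Ha. exact (elem_transfer (env := fun _ => a) D (fun _ => Ha)). Qed.

Lemma elem2 (P : M -> M -> Prop) a b : Dfn U (fixed A k) (fun env => P (env 0) (env 1)) ->
  a ∈ A -> b ∈ A -> P a b <-> P (app k a) (app k b).
Proof.
  intros D Ha Hb. apply (elem_transfer (env := fun n => match n with 0 => a | _ => b end) D).
  now intros [|n].
Qed.

Lemma elem3 (P : M -> M -> M -> Prop) a b c : Dfn U (fixed A k) (fun env => P (env 0) (env 1) (env 2)) ->
  a ∈ A -> b ∈ A -> c ∈ A -> P a b c <-> P (app k a) (app k b) (app k c).
Proof.
  intros D Ha Hb Hc. apply (elem_transfer (env := fun n => match n with 0 => a | 1 => b | _ => c end) D).
  now intros [|[|n]].
Qed.

Lemma elem4 (P : M -> M -> M -> M -> Prop) a b c d :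
  Dfn U (fixed A k) (fun env => P (env 0) (env 1) (env 2) (env 3)) ->
  a ∈ A -> b ∈ A -> c ∈ A -> d ∈ A -> P a b c d <-> P (app k a) (app k b) (app k c) (app k d).
Proof.
  intros D Ha Hb Hc Hd.
  apply (elem_transfer (env := fun n => match n with 0 => a | 1 => b | 2 => c | _ => d end) D).
  now intros [|[|[|n]]].
Qed.

Lemma elem_mem x y : x ∈ A -> y ∈ A -> x ∈ y <-> app k x ∈ app k y.
Proof.
  intros Hx Hy. destruct HE as [_ E2].
  apply (E2 (dMem 0 1) (fun n => match n with 0 => x | _ => y end)); now intros [|n].
Qed.
End Elementary.

Section ElementaryTransitive.
Context (A k : M) (HE : Elem A k) (Atr : forall x y, x ∈ A -> y ∈ x -> y ∈ A) (Aemp : emp ∈ A).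

Lemma elem_emp : fixed A k emp.
Proof.
  split; [exact Aemp|]. destruct HE as [E1 E2].
  apply ext. intro z. split; intro Hz; [exfalso|now apply empE in Hz].
  apply (proj1 (E2 (dNot (dEx (dMem 0 1))) (fun _ => emp) (fun _ => Aemp))); simpl.
  - intros (a & _ & Ha). now apply empE in Ha.
  - exists z. split; [|exact Hz]. exact (Atr (E1 _ Aemp) Hz).
Qed.

Lemma elem_universe : Universe (fun x => x ∈ A) (fixed A k).
Proof. split; [exact Atr|exists emp; exact elem_emp]. Qed.

(** The image of c satisfies the same definition, so uniqueness makes it c. *)
Lemma fixed_def c (Phi : M -> Prop) : c ∈ A -> Dfn (fun x => x ∈ A) (fixed A k) (fun env => Phi (env 0)) ->
  Phi c -> (forall x, x ∈ A -> Phi x -> x = c) -> fixed A k c.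
Proof.
  intros Hc D Hp Hu. split; [exact Hc|]. apply Hu; [now apply HE|].
  now apply (elem1 HE D Hc).
Qed.

Lemma elem_term F (env : nat -> M) : DT (fun x => x ∈ A) (fixed A k) F -> (forall n, env n ∈ A) ->
  app k (F env) = F (fun n => app k (env n)).
Proof.
  intros [C D] He. refine (proj1 (elem_transfer HE (env := scons (F env) env) D _) _).
  - intros [|n]; simpl; auto.
  - simpl. f_equal.
Qed.

Lemma elem_term1 (F : M -> M) a : DT (fun x => x ∈ A) (fixed A k) (fun env => F (env 0)) -> a ∈ A ->
  app k (F a) = F (app k a).
Proof. intros D Ha. exact (elem_term (env := fun _ => a) D (fun _ => Ha)). Qed.

Lemma elem_term2 (F : M -> M -> M) a b : DT (fun x => x ∈ A) (fixed A k) (fun env => F (env 0) (env 1)) ->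
  a ∈ A -> b ∈ A -> app k (F a b) = F (app k a) (app k b).
Proof.
  intros D Ha Hb. apply (elem_term (env := fun n => match n with 0 => a | _ => b end) D).
  now intros [|n].
Qed.

(** k(x) is a subset of k(Y) = Y, and for z in Y one has z ∈ x iff z = k(z) ∈ k(x). *)
Lemma elem_fix_subset Y x : fixed A k Y -> (forall y, y ∈ Y -> app k y = y) -> x ∈ A -> subset x Y -> app k x = x.
Proof.
  intros [HY EY] F Hx S. assert (HU := elem_universe).
  assert (S' : subset (app k x) Y).
  { rewrite <- EY. refine (proj1 (elem2 HE (P := fun x y => forall z, z ∈ x -> z ∈ y) _ Hx HY) S). dfn. }
  apply ext. intro z. split; intro Hz.
  - assert (Yz := S' z Hz). apply (elem_mem HE (Atr HY Yz) Hx). now rewrite F.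
  - assert (Yz := S z Hz). rewrite <- (F z Yz). now apply (elem_mem HE (Atr HY Yz) Hx).
Qed.
End ElementaryTransitive.
End Flat.

Ltac dfn_hook2 ::= lazymatch goal with
  | |- DT _ _ (fun env => sg (@?a env)) => apply (@DTm_sg _ _ a)
  | |- DT _ _ (fun env => sg0 (@?a env)) => apply (@DTm_sg0 _ _ a)
  | |- DT _ _ (fun env => fp (@?a env) (@?b env)) => apply (@DTm_fp _ _ a b)
  | |- Dfn _ _ (fun env => isSucc _ _) => unfold isSucc
  | |- Dfn _ _ (fun env => isSg _ _ _) => unfold isSg
  | |- Dfn _ _ (fun env => isSg0 _ _ _) => unfold isSg0
  | |- Dfn _ _ (fun env => isFp _ _ _ _) => unfold isFp
  end.

(** * Lifting the embedding to the sets coded by well-founded relations *)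

Create HintDb fx.
Ltac dfn_const ::= cbv beta; first [exact I | assumption | solve [auto with fx]].

Section Lift.
Context {M : SetStructure} {HZF : ZF M}.
Implicit Types x y z a b c u w R t T g : M.
Context (P j : M).
Local Notation N := (Pow P).
Context (HE : Elem N j) (Ptr : forall x y, x ∈ P -> y ∈ x -> y ∈ P) (Pfp : fpclosed P) (Pom : subset omega P).
Local Notation U := (fun x => x ∈ N).
Local Notation Q := (fixed N j).

Lemma inN x : x ∈ N <-> subset x P.
Proof. apply PowE. Qed.
Lemma P_N x : x ∈ P -> x ∈ N.
Proof. intro H. apply inN. intros y Hy. exact (Ptr H Hy). Qed.
Lemma N_trans x y : x ∈ N -> y ∈ x -> y ∈ N.
Proof. rewrite inN. intros H Hy. now apply P_N, H. Qed.

Lemma emp_N : emp ∈ N.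
Proof. apply inN. intros z Hz. now apply empE in Hz. Qed.
#[local] Instance UN : Universe U Q := elem_universe HE N_trans emp_N.
Let fixed_emp := elem_emp HE N_trans emp_N.

Lemma fixed_P : fixed N j P.
Proof.
  assert (HP : P ∈ N) by (apply inN; intros z Hz; exact Hz).
  apply (fixed_def HE (Phi := fun p => forall x, U x -> forall y, y ∈ x -> y ∈ p)); auto.
  - dfn.
  - intros x Hx. now apply inN.
  - intros x Hx H. apply subset_antisym; [now apply inN|]. exact (H P HP).
Qed.

Lemma fixed_omega : fixed N j omega.
Proof.
  assert (HP : omega ∈ N) by now apply inN.
  apply (fixed_def HE (Phi := fun o => forall n, U n -> n ∈ o <-> Ord n /\ forall m, U m ->
     m ∈ n \/ m = n -> (forall w, w ∈ m -> w ∉ m) \/ exists k, k ∈ m /\ isSucc k m)); auto.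
  - dfn.
  - intros n Hn. rewrite omegaE. unfold Nat_. apply and_iff_compat_l. split.
    + intros H m _ Hm. destruct (H m) as [->|(k & ->)]; [now apply succE|left; now apply empty_iff|].
      right. exists k. split; [apply succE; auto|now apply isSucc_iff].
    + intros H m Hm. apply succE in Hm. destruct (H m) as [E|(k & _ & E)]; auto.
      * destruct Hm as [Hm| ->]; [exact (N_trans Hn Hm)|exact Hn].
      * left. now apply empty_iff.
      * right. exists k. now apply isSucc_iff.
  - intros x Hx H. apply ext. intro n. split; intro Hn.
    + assert (Un : U n) by exact (N_trans Hx Hn). apply H in Hn as [On Hn]; [|exact Un].
      apply omegaE. split; [exact On|]. intros m Hm. apply succE in Hm.
      destruct (Hn m) as [E|(k & _ & E)]; auto.
      * destruct Hm as [Hm| ->]; [exact (N_trans Un Hm)|exact Un].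
      * left. now apply empty_iff.
      * right. exists k. now apply isSucc_iff.
    + apply H; [exact (N_trans HP Hn)|]. apply omegaE in Hn as [On Hn]. split; [exact On|].
      intros m _ Hm. destruct (Hn m) as [->|(k & ->)]; [now apply succE|left; now apply empty_iff|].
      right. exists k. split; [apply succE; auto|now apply isSucc_iff].
Qed.

Lemma fixed_U c : fixed N j c -> c ∈ N.
Proof. now intros []. Qed.
#[local] Hint Resolve fixed_P fixed_omega fixed_emp fixed_U : fx.

Lemma jP x : x ∈ P -> app j x ∈ P.
Proof.
  intro H. destruct fixed_P as [A E]. rewrite <- E. now apply (elem_mem HE (P_N H) A).
Qed.

Definition fpin R a b : Prop := exists w, w ∈ R /\ isFp omega a b w.
Lemma fpin_iff R a b : fpin R a b <-> fp a b ∈ R.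
Proof.
  split.
  - intros (w & Hw & E). apply isFp_iff in E. now subst.
  - intro H. exists (fp a b). now rewrite isFp_iff.
Qed.
Lemma D_fpin r s v : DT U Q r -> DT U Q s -> DT U Q v -> Dfn U Q (fun env => fpin (r env) (s env) (v env)).
Proof. apply (Dfn_pred3 (P := fpin)). unfold fpin. dfn. Qed.

Definition fr R : M := sep (prod P P) (fun p => exists b a, p = opair b a /\ fp b a ∈ R).
Lemma frE R b a : opair b a ∈ fr R <-> b ∈ P /\ a ∈ P /\ fp b a ∈ R.
Proof.
  unfold fr. rewrite sepE by dfn. rewrite opair_prod. split.
  - intros [[A B] (b' & a' & E & C)]. apply opair_inj in E as [-> ->]. auto.
  - intros (A & B & C). eauto 6.
Qed.
Lemma prod_DT s v : DTm s -> DTm v -> DTm (fun env => prod (s env) (v env)).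
Proof.
  apply (DT_fun2 (F := prod)). split; [intros; exact I|].
  apply Dfn_ext with (fun env => forall p, p ∈ env 0 <-> exists x, x ∈ env 1 /\ exists y, y ∈ env 2 /\ p = opair x y); [dfn|].
  intros env _. split; [intros ->; intro; apply prodE|]. intro H. apply ext. intro p. now rewrite prodE.
Qed.
Lemma fr_DT s : DTm s -> DTm (fun env => fr (s env)).
Proof. apply (DT_fun1 (F := fr)). unfold fr. repeat first [dfn1 | apply prod_DT]. Qed.

Definition wfc R : Prop := wfr P (fr R).
(** The set coded by the relation R and the point t. Subsets of P, the elements of N, thereby name
    sets of much larger rank. *)
Definition pi R t : M := app (col P (fr R)) t.
Lemma pi_DT s v : DTm s -> DTm v -> DTm (fun env => pi (s env) (v env)).
Proof. apply (DT_fun2 (F := pi)). unfold pi. repeat first [dfn1 | apply fr_DT]. Qed.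
Lemma wfc_D s : DTm s -> Dfm (fun env => wfc (s env)).
Proof. apply (Dfn_pred1 (P := wfc)). unfold wfc. repeat first [dfn1 | apply fr_DT]. Qed.
Ltac dfl := repeat first [dfn1 | apply pi_DT | apply wfc_D | apply fr_DT | apply prod_DT | apply D_fpin].

Lemma piE R t z : wfc R -> t ∈ P -> z ∈ pi R t <-> exists s, s ∈ P /\ fp s t ∈ R /\ z = pi R s.
Proof.
  intros W Ht. unfold pi. destruct (colP W) as [_ C]. rewrite C by exact Ht.
  split; intros (s & Hs & A & ->); exists s; rewrite frE in *; tauto.
Qed.

(** Subsets of P are elements of N, so well-foundedness is first order over N and is preserved by
    j. *)
Lemma wfc_iff R : wfc R <-> forall Z, Z ∈ N -> (exists z, z ∈ Z) ->
  exists z, z ∈ Z /\ forall y, y ∈ Z -> ~ fpin R y z.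
Proof.
  unfold wfc, wfr. split; intros H Z HZ E.
  - apply inN in HZ. destruct (H Z HZ E) as (z & Hz & A). exists z. split; [exact Hz|].
    intros y Hy F. apply (A y Hy). apply fpin_iff in F. apply frE. auto.
  - destruct (H Z (proj2 (inN Z) HZ) E) as (z & Hz & A). exists z. split; [exact Hz|].
    intros y Hy F. apply (A y Hy), fpin_iff. now apply frE in F.
Qed.
Lemma wfc_N r : DT U Q r -> Dfn U Q (fun env => wfc (r env)).
Proof.
  apply (Dfn_pred1 (P := wfc)). eapply Dfn_ext; [|intros env _; apply wfc_iff]. 
  apply (@Dfn_all _ _ _ (fun Z env => (exists z, z ∈ Z) -> exists z, z ∈ Z /\ forall y, y ∈ Z -> ~ fpin (env 0) y z)).
  apply Dfn_imp; [|dfl].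
  apply Dfn_ext with (fun env : nat -> M => exists z, z ∈ env 0 /\ z = z); [dfn|]. intros env _.
  split; intros [z Hz]; exists z; tauto.
Qed.

(** q codes a bisimulation between the two relations. Flat pairs make it a subset of P, so equality
    of the coded sets becomes a statement inside N. *)
Definition eqc R t R' t' : Prop := exists q, q ∈ N /\ (fpin q t t' /\
  forall a, a ∈ P -> forall b, b ∈ P -> fpin q a b ->
    (forall c, c ∈ P -> fpin R c a -> exists d, d ∈ P /\ (fpin R' d b /\ fpin q c d)) /\
    (forall d, d ∈ P -> fpin R' d b -> exists c, c ∈ P /\ (fpin R c a /\ fpin q c d))).

Lemma eqc_iff R t R' t' : wfc R -> wfc R' -> t ∈ P -> t' ∈ P -> eqc R t R' t' <-> pi R t = pi R' t'.
Proof.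
  intros W W' Ht Ht'. split.
  - intros (q & _ & A & B).
    assert (K : forall a b, a ∈ P -> b ∈ P -> fpin q a b -> pi R a = pi R' b).
    { set (Z := sep P (fun a => exists b, b ∈ P /\ (fp a b ∈ q /\ pi R a <> pi R' b))).
      assert (HZ : forall a, a ∈ Z <-> a ∈ P /\ exists b, b ∈ P /\ (fp a b ∈ q /\ pi R a <> pi R' b)).
      { intro. unfold Z. rewrite sepE by dfl. reflexivity. }
      intros a0 b0 Ha0 Hb0 Hq0. apply NNPP. intro NE.
      destruct (W Z) as (a & Ha & Hmin).
      { intros a Ha. now apply HZ in Ha. }
      { exists a0. apply HZ. apply fpin_iff in Hq0. eauto. }
      apply HZ in Ha as (Ha & b & Hb & Hab & NE'). apply NE'.
      apply fpin_iff in Hab. destruct (B a Ha b Hb Hab) as [B1 B2].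
      assert (K : forall c d, c ∈ P -> d ∈ P -> fpin R c a -> fpin q c d -> pi R c = pi R' d).
      { intros c d Hc Hd F G. apply NNPP. intro NE2. apply (Hmin c).
        - apply HZ. split; [exact Hc|]. exists d. apply fpin_iff in G. auto.
        - apply frE. apply fpin_iff in F. auto. }
      apply ext. intro z. rewrite !piE by auto. split.
      - intros (c & Hc & F & ->). apply fpin_iff in F. destruct (B1 c Hc F) as (d & Hd & G & E).
        exists d. split; [exact Hd|]. split; [now apply fpin_iff|auto].
      - intros (d & Hd & F & ->). apply fpin_iff in F. destruct (B2 d Hd F) as (c & Hc & G & E).
        exists c. split; [exact Hc|]. split; [now apply fpin_iff|symmetry; auto]. }
    now apply K.
  - intro E. set (q := sep P (fun w => exists a, a ∈ P /\ exists b, b ∈ P /\ (w = fp a b /\ pi R a = pi R' b))).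
    assert (Hq : forall a b, a ∈ P -> b ∈ P -> fpin q a b <-> pi R a = pi R' b).
    { intros a b Ha Hb. rewrite fpin_iff. unfold q. rewrite sepE by dfl. split.
      - intros (_ & a' & _ & b' & _ & F & G). apply fp_inj in F as [-> ->]. exact G.
      - intro G. split; [now apply Pfp|]. exists a. split; [exact Ha|]. exists b. auto. }
    exists q. split; [apply inN; intros z Hz; unfold q in Hz; now rewrite sepE in Hz by dfl|].
    split; [now apply Hq|]. intros a Ha b Hb F. apply Hq in F; [|auto..].
    assert (K : forall z, z ∈ pi R a <-> z ∈ pi R' b) by (intro; now rewrite F). split.
    + intros c Hc G. apply fpin_iff in G.
      destruct (proj1 (piE (pi R c) W' Hb)) as (d & Hd & G' & E'); [apply K, piE; eauto|].
      exists d. split; [exact Hd|]. rewrite Hq by auto. now rewrite fpin_iff.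
    + intros d Hd G. apply fpin_iff in G.
      destruct (proj1 (piE (pi R' d) W Ha)) as (c & Hc & G' & E'); [apply K, piE; eauto|].
      exists c. split; [exact Hc|]. rewrite Hq by auto. now rewrite fpin_iff.
Qed.

Lemma D_eqc r s v h : DT U Q r -> DT U Q s -> DT U Q v -> DT U Q h ->
  Dfn U Q (fun env => eqc (r env) (s env) (v env) (h env)).
Proof. apply (Dfn_pred4 (P := eqc)). unfold eqc. dfl. Qed.

Definition memc R t R' t' : Prop := exists s, s ∈ P /\ (fpin R' s t' /\ eqc R t R' s).
Lemma memc_iff R t R' t' : wfc R -> wfc R' -> t ∈ P -> t' ∈ P -> memc R t R' t' <-> pi R t ∈ pi R' t'.
Proof.
  intros W W' Ht Ht'. rewrite piE by auto. split; intros (s & Hs & A & B); exists s;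
    rewrite fpin_iff, eqc_iff in *; auto.
Qed.

(* The sets that belong to some transitive T ≤* P. *)
Definition Hull : M := Un (repl (sep N wfc) (fun R => repl P (fun t => pi R t))).
Lemma HullE x : x ∈ Hull <-> exists R t, R ∈ N /\ wfc R /\ t ∈ P /\ x = pi R t.
Proof.
  unfold Hull. rewrite UnE. split.
  - intros (y & Hy & Hx). apply replE in Hy as (R & HR & ->); [|dfl]. rewrite sepE in HR by dfl.
    apply replE in Hx as (t & Ht & ->); [|dfl]. exists R, t. tauto.
  - intros (R & t & HR & W & Ht & ->). exists (repl P (fun t => pi R t)). rewrite !replE by dfl. split.
    + exists R. rewrite sepE by dfl. auto.
    + eauto.
Qed.

(** Position 2n holds the relation, and position 2n + 1 the point, that together code the n-th
    variable. *)
Definition goodc (c : nat -> M) : Prop := forall n, c (2 * n) ∈ N /\ wfc (c (2 * n)) /\ c (S (2 * n)) ∈ P.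
Definition val (c : nat -> M) : nat -> M := fun n => pi (c (2 * n)) (c (S (2 * n))).

(** Truth in the hull is translated into truth in N about codes: a quantifier over the hull becomes
    one over well-founded relations and points. *)
Lemma coded_truth (p : dform) : exists Psi, Dfn U Q Psi /\
  forall c : nat -> M, goodc c -> dholds (fun x => x ∈ Hull) (val c) p <-> Psi c.
Proof.
  induction p as [i k|i k|p IH|p IHp q IHq|p IH].
  - exists (fun c : nat -> M => memc (c (2 * i)) (c (S (2 * i))) (c (2 * k)) (c (S (2 * k)))). split.
    + unfold memc. repeat first [dfn1 | apply D_fpin | apply D_eqc].
    + intros c Hc. destruct (Hc i) as (A1 & A2 & A3), (Hc k) as (B1 & B2 & B3).
      symmetry. now apply memc_iff.
  - exists (fun c : nat -> M => eqc (c (2 * i)) (c (S (2 * i))) (c (2 * k)) (c (S (2 * k)))). split.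
    + repeat first [dfn1 | apply D_fpin | apply D_eqc].
    + intros c Hc. destruct (Hc i) as (A1 & A2 & A3), (Hc k) as (B1 & B2 & B3).
      symmetry. now apply eqc_iff.
  - destruct IH as (Psi & D & H). exists (fun c : nat -> M => ~ Psi c). split; [now apply Dfn_not|].
    intros c Hc. simpl. now rewrite H.
  - destruct IHp as (Psi & D & H), IHq as (Psi' & D' & H'). exists (fun c : nat -> M => Psi c /\ Psi' c).
    split; [now apply Dfn_and|]. intros c Hc. simpl. now rewrite H, H'.
  - destruct IH as (Psi & D & H).
    exists (fun c : nat -> M => exists t, U t /\ (t ∈ P /\ exists R, U R /\ (wfc R /\ Psi (scons R (scons t c))))). split.
    + apply (@Dfn_ex _ _ _ (fun t (c : nat -> M) => t ∈ P /\ exists R, U R /\ (wfc R /\ Psi (scons R (scons t c))))).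
      apply Dfn_and; [dfn|].
      apply (@Dfn_ex _ _ _ (fun R (c : nat -> M) => wfc R /\ Psi (scons R (scons (c 0) (fun n => c (S n)))))).
      apply Dfn_and; [apply wfc_N; dfn|]. eapply Dfn_ext; [exact D|]. intros env _.
      enough (E : scons (env 0) (scons (env 1) (fun n => env (S (S n)))) = env) by now rewrite E.
      apply functional_extensionality. now intros [|[|n]].
    + intros c Hc. cbn [dholds].
      assert (K : forall R t, scons (pi R t) (val c) = val (scons R (scons t c))).
      { intros R t. apply functional_extensionality. intros [|n]; [reflexivity|].
        unfold val. cbn [scons]. replace (2 * S n) with (S (S (2 * n))) by lia. reflexivity. }
      assert (G : forall R t, R ∈ N -> wfc R -> t ∈ P -> goodc (scons R (scons t c))).
      { intros R t HR W Ht [|n]; [auto|]. replace (2 * S n) with (S (S (2 * n))) by lia. apply Hc. }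
      split.
      * intros (a & Ha & A). apply HullE in Ha as (R & t & HR & W & Ht & ->). rewrite K in A.
        apply H in A; [|auto]. exists t. split; [now apply P_N|]. split; [exact Ht|]. exists R. auto.
      * intros (t & _ & Ht & R & HR & W & A). exists (pi R t). split; [apply HullE; eauto 6|].
        rewrite K. apply H; auto.
Qed.

Definition lift : M := lam Hull (fun x => eps (fun y =>
  exists R t, (R ∈ N /\ wfc R /\ t ∈ P) /\ (x = pi R t /\ y = pi (app j R) (app j t)))).

Lemma j_code R t : R ∈ N -> wfc R -> t ∈ P -> app j R ∈ N /\ wfc (app j R) /\ app j t ∈ P.
Proof.
  intros HR W Ht. split; [now apply HE|]. split; [|now apply jP].
  refine (proj1 (elem1 HE (P := wfc) _ HR) W). apply wfc_N. dfn.
Qed.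

(** The embedding carries a bisimulation to a bisimulation, so the lifted value does not depend on
    the code. *)
Lemma j_code_eq R t R' t' : R ∈ N -> wfc R -> t ∈ P -> R' ∈ N -> wfc R' -> t' ∈ P ->
  pi R t = pi R' t' -> pi (app j R) (app j t) = pi (app j R') (app j t').
Proof.
  intros HR W Ht HR' W' Ht' E. apply eqc_iff in E; auto.
  destruct (j_code HR W Ht) as (_ & A & B), (j_code HR' W' Ht') as (_ & A' & B').
  apply eqc_iff; auto. refine (proj1 (elem4 HE (P := eqc) _ _ _ _ _) E); auto using P_N.
  apply D_eqc; dfn.
Qed.

Lemma lift_spec : isfn lift Hull /\ forall R t, R ∈ N -> wfc R -> t ∈ P ->
  app lift (pi R t) = pi (app j R) (app j t).
Proof.
  destruct (@lam_fn _ _ Hull (fun x => eps (fun y =>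
    exists R t, (R ∈ N /\ wfc R /\ t ∈ P) /\ (x = pi R t /\ y = pi (app j R) (app j t))))) as [F V].
  { apply (DTm_eps (P := fun y env => exists R t, (R ∈ N /\ wfc R /\ t ∈ P) /\
      (env 0 = pi R t /\ y = pi (app j R) (app j t)))); [dfl|].
    intros env y y' (R & t & (HR & W & Ht) & E & ->) (R' & t' & (HR' & W' & Ht') & E' & ->).
    apply j_code_eq; auto. now rewrite <- E. }
  fold lift in F, V. split; [exact F|]. intros R t HR W Ht.
  rewrite V by (apply HullE; eauto 6).
  destruct (epsP (P := fun y => exists R' t', (R' ∈ N /\ wfc R' /\ t' ∈ P) /\
    (pi R t = pi R' t' /\ y = pi (app j R') (app j t')))) as (R' & t' & (HR' & W' & Ht') & E & ->);
    [|now apply j_code_eq].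
  exists (pi (app j R) (app j t)), R, t. auto.
Qed.

Lemma lift_elem : Elem Hull lift.
Proof.
  destruct lift_spec as [_ LS]. split.
  - intros x Hx. apply HullE in Hx as (R & t & HR & W & Ht & ->). rewrite LS by auto.
    destruct (j_code HR W Ht) as (A & B & C). apply HullE. eauto 6.
  - intros p env He.
    assert (C : forall n, exists c : M * M, fst c ∈ N /\ wfc (fst c) /\ snd c ∈ P /\ env n = pi (fst c) (snd c)).
    { intro n. destruct (proj1 (HullE (env n)) (He n)) as (R & t & A). now exists (R, t). }
    set (cd := fun n => proj1_sig (constructive_indefinite_description _ (C n))).
    assert (Hcd : forall n, fst (cd n) ∈ N /\ wfc (fst (cd n)) /\ snd (cd n) ∈ P /\ env n = pi (fst (cd n)) (snd (cd n)))
      by (intro n; exact (proj2_sig (constructive_indefinite_description _ (C n)))).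
    set (c := mix (fun n => fst (cd n)) (fun n => snd (cd n))).
    assert (c0 : forall n, c (2 * n) = fst (cd n)) by (intro n; exact (mix_even (fun n => fst (cd n)) _ n)).
    assert (c1 : forall n, c (S (2 * n)) = snd (cd n)) by (intro n; exact (mix_odd _ (fun n => snd (cd n)) n)).
    assert (G : goodc c). { intro n. rewrite c0, c1. destruct (Hcd n) as (A1 & A2 & A3 & _). auto. }
    destruct (coded_truth p) as (Psi & D & H).
    assert (E : env = val c) by (apply functional_extensionality; intro n; unfold val; rewrite c0, c1; destruct (Hcd n) as (_ & _ & _ & A); exact A).
    assert (E' : (fun n => app lift (env n)) = val (fun n => app j (c n))).
    { apply functional_extensionality; intro n. unfold val. rewrite c0, c1.
      destruct (Hcd n) as (A1 & A2 & A3 & A4). rewrite A4. now apply LS. }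
    rewrite E', E, !H; auto.
    + apply (elem_transfer HE D). intro n. destruct (even_or_odd n) as [[k ->]|[k ->]].
      * apply G.
      * apply P_N, G.
    + intro n. destruct (G n) as (A1 & A2 & A3). now apply j_code.
Qed.
End Lift.

(** * Closure properties of the hull *)

Section Closure.
Context {M : SetStructure} {HZF : ZF M}.
Implicit Types x y z a b c u w R t T g : M.
Context (P j : M).
Local Notation N := (Pow P).
Local Notation H := (Hull P).
Context (HE : Elem N j) (Ptr : forall x y, x ∈ P -> y ∈ x -> y ∈ P) (Pfp : fpclosed P) (Pom : subset omega P).
Ltac dfl := repeat first [dfn1 | apply pi_DT | apply wfc_D | apply fr_DT | apply prod_DT].

Definition transitive T : Prop := forall x y, x ∈ T -> y ∈ x -> y ∈ T.

(** Membership on T is pulled back along a partial map of P onto T. Points without an image in T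
    have no predecessors, and by foundation every other point collapses to its image. *)
Lemma Hull_intro T x : transitive T -> sle T P -> x ∈ T -> x ∈ H.
Proof.
  intros Ttr (g & Fg & Sg) Hx.
  set (R := sep P (fun w => exists a b u v, w = fp a b /\ (a ∈ P /\ b ∈ P) /\ (opair a u ∈ g /\ opair b v ∈ g) /\
    (u ∈ T /\ v ∈ T) /\ u ∈ v)).
  assert (HR : forall a b, a ∈ P -> b ∈ P -> fp a b ∈ R <->
    exists u v, (opair a u ∈ g /\ opair b v ∈ g) /\ (u ∈ T /\ v ∈ T) /\ u ∈ v).
  { intros a b Ha Hb. unfold R. rewrite sepE by dfl. split.
    - intros (_ & a' & b' & u & v & E & _ & A). apply fp_inj in E as [-> ->]. eauto.
    - intros (u & v & A). split; [now apply Pfp|]. exists a, b, u, v. auto. }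
  assert (W : wfc P R).
  { intros Z HZ [z0 Hz0]. destruct (classic (exists u z, u ∈ T /\ (opair z u ∈ g /\ z ∈ Z))) as [E|E].
    - set (I := sep T (fun u => exists z, opair z u ∈ g /\ z ∈ Z)).
      assert (HI : forall u, u ∈ I <-> u ∈ T /\ exists z, opair z u ∈ g /\ z ∈ Z)
        by (intro; unfold I; rewrite sepE by dfl; reflexivity).
      destruct (@foundation M HZF I) as (u & Hu & Hmin).
      { destruct E as (u & z & A & B). exists u. apply HI. eauto. }
      apply HI in Hu as (Hu & z & Hzu & Hz). exists z. split; [exact Hz|]. intros y Hy F.
      apply frE in F as (Py & Pz & F). apply HR in F as (u1 & v1 & [A B] & [C D] & K); auto.
      rewrite (Fg _ _ _ B Hzu) in K. apply (Hmin u1); [|exact K]. apply HI. eauto.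
    - exists z0. split; [exact Hz0|]. intros y Hy F. apply frE in F as (Py & Pz & F).
      apply HR in F as (u1 & v1 & [A B] & [C D] & K); auto. apply E. eauto. }
  assert (K : forall u, u ∈ T -> forall a, a ∈ P -> opair a u ∈ g -> pi P R a = u).
  { set (Z := sep T (fun u => exists a, a ∈ P /\ (opair a u ∈ g /\ pi P R a <> u))).
    assert (HZ : forall u, u ∈ Z <-> u ∈ T /\ exists a, a ∈ P /\ (opair a u ∈ g /\ pi P R a <> u))
      by (intro; unfold Z; rewrite sepE by dfl; reflexivity).
    intros u0 Hu0 a0 Ha0 G0. apply NNPP. intro NE.
    destruct (@foundation M HZF Z) as (u & Hu & Hmin); [exists u0; apply HZ; eauto|].
    apply HZ in Hu as (Hu & a & Ha & Ga & NE'). apply NE'.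
    apply ext. intro z. rewrite piE by auto. split.
    - intros (s & Hs & F & ->). apply HR in F as (u1 & v1 & [A B] & [C D] & K); auto.
      rewrite (Fg _ _ _ B Ga) in K.
      enough (E : pi P R s = u1) by now rewrite E. apply NNPP. intro NE2.
      apply (Hmin u1); [apply HZ; eauto|exact K].
    - intro Hz. assert (Tz := Ttr _ _ Hu Hz). destruct (Sg z Tz) as (s & Hs & Gs). exists s.
      split; [exact Hs|]. split; [apply HR; eauto 8|].
      apply NNPP. intro NE2. apply (Hmin z); [apply HZ; eauto|exact Hz]. }
  destruct (Sg x Hx) as (a & Ha & Ga). apply HullE. exists R, a. split; [|split; [exact W|]].
  - apply PowE. intros w Hw. unfold R in Hw. now rewrite sepE in Hw by dfl.
  - split; [exact Ha|]. symmetry. now apply K.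
Qed.

Lemma Hull_elim x : x ∈ H -> exists T, transitive T /\ sle T P /\ x ∈ T.
Proof.
  intro Hx. apply HullE in Hx as (R & t & HR & W & Ht & ->).
  exists (repl P (fun t => pi P R t)). split; [|split].
  - intros x y Hx Hy. rewrite replE in * by dfl. destruct Hx as (s & Hs & ->).
    apply piE in Hy as (r & Hr & _ & ->); eauto.
  - apply sle_repl. dfl.
  - rewrite replE by dfl. eauto.
Qed.

Lemma Hull_trans x y : x ∈ H -> y ∈ x -> y ∈ H.
Proof.
  intros Hx Hy. apply Hull_elim in Hx as (T & A & B & C). eapply Hull_intro; eauto.
Qed.

Lemma emp_P : emp ∈ P.
Proof. apply Pom, omega_emp. Qed.
Lemma one_P : sing emp ∈ P.
Proof.
  replace (sing emp) with (succ emp) by (apply ext; intro z; rewrite succE, singE; split; [intros [K|K]; [now apply empE in K|exact K]|auto]).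
  apply Pom, omega_succ, omega_emp.
Qed.

Lemma sle_cup S T : sle S P -> sle T P -> sle (cup S T) P.
Proof. apply sle_fp_union; auto using emp_P, one_P. Qed.

Lemma sle_sing x a : a ∈ P -> sle (sing x) P.
Proof.
  intro Ha. exists (sing (opair a x)). split.
  - intros u y y' A B. apply singE in A, B. apply opair_inj in A as [_ ->], B as [_ ->]. reflexivity.
  - intros y Hy. apply singE in Hy as ->. exists a. split; [exact Ha|]. now apply singE.
Qed.

(** With x adjoined, T is still transitive and still an image of P. *)
Lemma Hull_subset_level T x : transitive T -> sle T P -> subset x T -> x ∈ H.
Proof.
  intros A B C. apply (@Hull_intro (cup T (sing x))).
  - intros y z Hy Hz. apply cupE. left. apply cupE in Hy as [Hy|Hy]; [eauto|].
    apply singE in Hy as ->. auto.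
  - apply sle_cup; [exact B|]. apply sle_sing with emp. apply emp_P.
  - apply cupE. right. now apply singE.
Qed.

Lemma Hull_P : P ∈ H.
Proof. apply Hull_subset_level with P; [exact Ptr|apply sle_refl|intros z; auto]. Qed.

Lemma Hull_subset x y : x ∈ H -> subset y x -> y ∈ H.
Proof.
  intros Hx S. apply Hull_elim in Hx as (T & A & B & C). apply Hull_subset_level with T; auto.
  intros z Hz. eauto.
Qed.

Lemma transitive_cup S T : transitive S -> transitive T -> transitive (cup S T).
Proof. intros A B x y Hx Hy. rewrite cupE in *. destruct Hx; eauto. Qed.

Lemma Hull_upair x y : x ∈ H -> y ∈ H -> upair x y ∈ H.
Proof.
  intros Hx Hy. apply Hull_elim in Hx as (T & A & B & C), Hy as (T' & A' & B' & C').
  apply Hull_subset_level with (cup T T'); [now apply transitive_cup|now apply sle_cup|].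
  intros z Hz. apply upairE in Hz as [->| ->]; apply cupE; auto.
Qed.

Lemma Hull_Un x : x ∈ H -> Un x ∈ H.
Proof.
  intro Hx. apply Hull_elim in Hx as (T & A & B & C). apply Hull_subset_level with T; auto.
  intros z Hz. apply UnE in Hz as (y & Hy & Hz). eauto.
Qed.

(** A transitive set around the product has three layers, the elements, the unordered pairs and the
    ordered pairs, and flat pairs make each an image of P. *)
Lemma Hull_prod x y : x ∈ H -> y ∈ H -> prod x y ∈ H.
Proof.
  intros Hx Hy. apply Hull_elim in Hx as (T & A & B & C), Hy as (T' & A' & B' & C').
  set (S := cup T T'). assert (TS : transitive S) by now apply transitive_cup.
  assert (sS : sle S P) by now apply sle_cup.
  destruct (@sle_fp_image M HZF P S S (@upair M HZF)) as (W1 & HW1 & S1); auto; [dfn|].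
  destruct (@sle_fp_image M HZF P S S (@opair M HZF)) as (W2 & HW2 & S2); auto; [dfn|].
  apply Hull_subset_level with (cup (cup S W1) W2).
  - intros u v Hu Hv. rewrite !cupE in *. destruct Hu as [[Hu|Hu]|Hu].
    + left; left. exact (TS _ _ Hu Hv).
    + apply HW1 in Hu as (a & Ha & b & Hb & ->). apply upairE in Hv as [->| ->]; auto.
    + apply HW2 in Hu as (a & Ha & b & Hb & ->). left; right. apply HW1.
      apply upairE in Hv as [->| ->]; [exists a; split; [auto|]; exists a|exists a; split; [auto|]; exists b]; auto.
  - now repeat apply sle_cup.
  - intros p Hp. apply prodE in Hp as (a & Ha & b & Hb & ->). apply cupE. right. apply HW2.
    exists a. split; [apply cupE; eauto|]. exists b. split; [apply cupE; eauto|reflexivity].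
Qed.

Lemma emp_Hull : emp ∈ H.
Proof. apply (Hull_subset Hull_P). intros z Hz. now apply empE in Hz. Qed.

(** In the membership relation of P each point codes itself. This relation is definable in N, hence
    fixed by j. *)
Lemma lift_P x : x ∈ P -> app (lift P j) x = app j x.
Proof.
  intro Hx. assert (HU := elem_universe HE (N_trans Ptr) (emp_N P)).
  assert (fxP := fixed_P HE Ptr). assert (fxO := fixed_omega HE Ptr Pom).
  assert (UP := fixed_U fxP). assert (UO := fixed_U fxO).
  set (R := sep P (fun w => exists a, a ∈ P /\ exists b, b ∈ P /\ (w = fp a b /\ a ∈ b))).
  assert (HR : forall a b, a ∈ P -> b ∈ P -> fp a b ∈ R <-> a ∈ b).
  { intros a b Ha Hb. unfold R. rewrite sepE by dfl. split.
    - intros (_ & a' & _ & b' & _ & E & K). apply fp_inj in E as [-> ->]. exact K.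
    - intro K. split; [now apply Pfp|]. exists a. split; [exact Ha|]. exists b. auto. }
  assert (R_N : R ∈ N) by (apply PowE; intros w Hw; unfold R in Hw; now rewrite sepE in Hw by dfl).
  assert (W : wfc P R).
  { intros Z HZ E. destruct (foundation E) as (z & Hz & Hmin). exists z. split; [exact Hz|].
    intros y Hy F. apply frE in F as (Py & Pz & F). exact (Hmin y Hy (proj1 (HR _ _ Py Pz) F)). }
  assert (K : forall a, a ∈ P -> pi P R a = a).
  { intros a0 Ha0. apply NNPP. intro NE0.
    set (Z := sep P (fun a => pi P R a <> a)).
    assert (HZ : forall a, a ∈ Z <-> a ∈ P /\ pi P R a <> a) by (intro; unfold Z; rewrite sepE by dfl; reflexivity).
    destruct (@foundation M HZF Z) as (a & Ha & Hmin); [exists a0; now apply HZ|].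
    apply HZ in Ha as [Ha NE]. apply NE. apply ext. intro z. rewrite piE by auto. split.
    - intros (s & Hs & F & ->). apply (HR _ _ Hs Ha) in F. replace (pi P R s) with s; [exact F|].
      symmetry. apply NNPP. intro NE2. apply (Hmin s); [now apply HZ|exact F].
    - intro Hz. assert (Pz := Ptr Ha Hz). exists z. split; [exact Pz|]. split; [now apply HR|].
      symmetry. apply NNPP. intro NE2. apply (Hmin z); [now apply HZ|exact Hz]. }
  assert (FR : fixed N j R).
  { apply (fixed_def HE (Phi := fun r => (forall w, w ∈ r -> exists a, a ∈ P /\ exists b, b ∈ P /\ (isFp omega a b w /\ a ∈ b)) /\
      forall a, a ∈ P -> forall b, b ∈ P -> a ∈ b -> exists w, w ∈ r /\ isFp omega a b w)); auto.
    - dfl.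
    - split.
      + intros w Hw. unfold R in Hw. rewrite sepE in Hw by dfl. destruct Hw as (_ & a & Ha & b & Hb & -> & K').
        exists a. split; [exact Ha|]. exists b. split; [exact Hb|]. split; [now apply isFp_iff|exact K'].
      + intros a Ha b Hb K'. exists (fp a b). split; [now apply HR|now apply isFp_iff].
    - intros r Hr [A B]. apply ext. intro w. split; intro Hw.
      + destruct (A w Hw) as (a & Ha & b & Hb & E & K'). apply isFp_iff in E as ->. now apply HR.
      + unfold R in Hw. rewrite sepE in Hw by dfl. destruct Hw as (_ & a & Ha & b & Hb & -> & K').
        destruct (B a Ha b Hb K') as (w & Hw & E). apply isFp_iff in E as ->. exact Hw. }
  rewrite <- (K x Hx) at 1.
  rewrite (proj2 (lift_spec HE Ptr Pfp Pom) R x R_N W Hx), (proj2 FR).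
  apply K. now apply jP.
Qed.
End Closure.

(** * Elementary maps of sufficiently closed transitive sets *)

Lemma fixed_mem {M : SetStructure} {HZF : ZF M} (A k c : M) : fixed A k c -> c ∈ A.
Proof. now intros []. Qed.
Ltac dfn_const ::= cbv beta; first [exact I | assumption | eapply fixed_mem; eassumption | solve [eauto with fx]].

(** The closure properties through which the combinatorial arguments use the hull and the lifted
    map. *)
Record Model {M : SetStructure} {HZF : ZF M} (H J : M) : Prop := {
  mdl_elem : Elem H J;
  mdl_trans : forall x y, x ∈ H -> y ∈ x -> y ∈ H;
  mdl_sub : forall x y, x ∈ H -> subset y x -> y ∈ H;
  mdl_upair : forall x y, x ∈ H -> y ∈ H -> upair x y ∈ H;
  mdl_Un : forall x, x ∈ H -> Un x ∈ H;
  mdl_prod : forall x y, x ∈ H -> y ∈ H -> prod x y ∈ H;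
  mdl_emp : emp ∈ H
}.
Existing Class Model.

Section Models.
Context {M : SetStructure} {HZF : ZF M} (H J : M) {MD : Model H J}.
Implicit Types x y z a b c u w R T g : M.
Local Notation U := (fun x => x ∈ H).
Local Notation Q := (fixed H J).

#[export] Instance model_universe : Universe U Q.
Proof. exact (elem_universe (mdl_elem MD) (mdl_trans MD) (mdl_emp MD)). Qed.
#[export] Instance model_rich : Rich U Q.
Proof.
  repeat split; [apply (mdl_upair MD)|apply (mdl_Un MD)|apply (mdl_sub MD)|dfn].
Qed.

Lemma J_H x : x ∈ H -> app J x ∈ H.
Proof. apply (mdl_elem MD). Qed.
Lemma J_mem x y : x ∈ H -> y ∈ H -> x ∈ y <-> app J x ∈ app J y.
Proof. apply (elem_mem (mdl_elem MD)). Qed.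

Lemma opair_H x y : x ∈ H -> y ∈ H -> opair x y ∈ H.
Proof. intros. repeat apply (mdl_upair MD); auto. Qed.
Lemma succ_H x : x ∈ H -> succ x ∈ H.
Proof. intros. apply (mdl_Un MD), (mdl_upair MD); auto. now apply (mdl_upair MD). Qed.

Lemma J_opair x y : x ∈ H -> y ∈ H -> app J (opair x y) = opair (app J x) (app J y).
Proof. apply (elem_term2 (mdl_elem MD)); dfn. Qed.
Lemma J_succ x : x ∈ H -> app J (succ x) = succ (app J x).
Proof. apply (elem_term1 (mdl_elem MD)); dfn. Qed.
Lemma J_app g x : g ∈ H -> x ∈ H -> app J (app g x) = app (app J g) (app J x).
Proof. apply (elem_term2 (mdl_elem MD)); dfn. Qed.
Lemma J_Ord a : a ∈ H -> Ord a -> Ord (app J a).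
Proof. intro Ha. apply (elem1 (mdl_elem MD) (P := fun a => Ord a) ltac:(dfn) Ha). Qed.

Lemma J_sub x y : x ∈ H -> y ∈ H -> subset x y -> subset (app J x) (app J y).
Proof.
  intros Hx Hy S. exact (proj1 (elem2 (mdl_elem MD) (P := fun x y => forall z, z ∈ x -> z ∈ y) ltac:(dfn) Hx Hy) S).
Qed.

Lemma J_fixed_mem Y y : fixed H J Y -> y ∈ Y -> app J y ∈ Y.
Proof.
  intros [A B] Hy. assert (K := proj1 (J_mem (mdl_trans MD A Hy) A) Hy). now rewrite B in K.
Qed.

Lemma J_fixed_sub Y a : fixed H J Y -> a ∈ H -> subset a Y -> subset (app J a) Y.
Proof. intros [A B] Ha S. rewrite <- B. now apply J_sub. Qed.

Lemma J_ge a : a ∈ H -> Ord a -> subset a (app J a).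
Proof.
  intros Ha Oa. revert Ha. revert a Oa. apply (ord_ind (P := fun a => a ∈ H -> subset a (app J a))); [unfold subset; dfn|].
  intros a Oa IH Ha z Hz. assert (Uz := mdl_trans MD Ha Hz). assert (Oz := Ord_elem Oa Hz).
  assert (K := proj1 (J_mem Uz Ha) Hz).
  eapply Ord_sub_mem; [exact Oz| |exact (J_Ord Ha Oa)|exact (IH z Hz Uz)|exact K].
  exact (J_Ord Uz Oz).
Qed.

Lemma fixed_prod a b : fixed H J a -> fixed H J b -> fixed H J (prod a b).
Proof.
  intros [Ha Ea] [Hb Eb].
  apply (fixed_def (mdl_elem MD) (Phi := fun p => (forall q, q ∈ p -> exists x, x ∈ a /\ exists y, y ∈ b /\ q = opair x y) /\
    forall x, x ∈ a -> forall y, y ∈ b -> opair x y ∈ p)).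
  - now apply (mdl_prod MD).
  - assert (fixed H J a) by (split; auto). assert (fixed H J b) by (split; auto). dfn.
  - split; [intros q; apply prodE|]. intros x Hx y Hy. now apply opair_prod.
  - intros p Hp [A B]. apply ext. intro q. rewrite prodE. split; [apply A|].
    intros (x & Hx & y & Hy & ->). auto.
Qed.

Lemma fixed_sep a (P : M -> Prop) : fixed H J a -> Dfn U Q (fun env => P (env 0)) -> fixed H J (sep a P).
Proof.
  intros Fa D.
  assert (T : DT U Q (fun _ => sep a P)).
  { apply (@DT_sep _ _ U Q _ _ (fun _ => a) (fun x _ => P x)); [dfn|]. exact (Dfn_rename (fun _ => 0) D). }
  assert (E : sep a P ∈ H) by exact (proj1 T (fun _ => emp) (fun _ => mdl_emp MD)).
  split; [exact E|]. exact (elem_term (mdl_elem MD) (env := fun _ => emp) T (fun _ => mdl_emp MD)).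
Qed.

(** Turns a definable operation on Y into a set fixed by J, the form that a decoding must have. *)
Lemma fixed_lam2 Y (F : M -> M -> M) : fixed H J Y -> DT U Q (fun env => F (env 0) (env 1)) ->
  (forall c a, c ∈ Y -> a ∈ Y -> F c a ∈ Y) ->
  exists D, fixed H J D /\ forall c a, c ∈ Y -> a ∈ Y -> app D (opair c a) = F c a.
Proof.
  intros FY DF HF. set (D := sep (prod (prod Y Y) Y) (fun p => exists c, c ∈ Y /\ exists a, a ∈ Y /\ p = opair (opair c a) (F c a))).
  assert (DP : Dfn U Q (fun env => exists c, c ∈ Y /\ exists a, a ∈ Y /\ env 0 = opair (opair c a) (F c a))).
  { apply (Dbex (t := fun _ => Y) (R := fun c env => exists a, a ∈ Y /\ env 0 = opair (opair c a) (F c a))); [dfn|].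
    apply (Dbex (t := fun _ => Y) (R := fun a env => env 1 = opair (opair (env 0) a) (F (env 0) a))); [dfn|].
    apply Deq; [typeclasses eauto|dfn|].
    apply DT_opair; [typeclasses eauto..|dfn|]. apply (DT_fun2 DF); dfn. }
  assert (FD : fixed H J D) by (apply fixed_sep; [now repeat apply fixed_prod|exact DP]).
  exists D. split; [exact FD|].
  assert (DH : forall p, p ∈ D <-> p ∈ prod (prod Y Y) Y /\ exists c, c ∈ Y /\ exists a, a ∈ Y /\ p = opair (opair c a) (F c a)).
  { intro p. assert (FP := fixed_prod (fixed_prod FY FY) FY).
    assert (T : DT U Q (fun _ => prod (prod Y Y) Y)) by (apply DT_cst; [exact FP|apply FP]).
    apply (sep_richE (U := U) (Q := Q) (s := fun _ => prod (prod Y Y) Y) (P := fun p _ => exists c, c ∈ Y /\ exists a, a ∈ Y /\ p = opair (opair c a) (F c a)) T DP (env := fun _ => emp)).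
    intros _. apply (mdl_emp MD). }
  intros c a Hc Ha. apply app_val.
  - apply DH. split; [|eauto 6]. rewrite !opair_prod. auto.
  - intros y Hy. apply DH in Hy as [_ (c' & _ & a' & _ & E)].
    apply opair_inj in E as [E ->]. apply opair_inj in E as [-> ->]. reflexivity.
Qed.

Lemma Dfn_isfn (s v : (nat -> M) -> M) : DT U Q s -> DT U Q v -> Dfn U Q (fun env => isfn (s env) (v env)).
Proof.
  apply (Dfn_pred2 (P := @isfn M HZF)).
  apply Dfn_ext with (fun env => (forall p, p ∈ env 0 -> exists x, x ∈ env 1 /\ p = opair x (app (env 0) x)) /\
    forall x, x ∈ env 1 -> opair x (app (env 0) x) ∈ env 0); [dfn|].
  intros env _. unfold isfn. split.
  - intro A. split; [intros p; apply A|]. intros x Hx. apply A. eauto.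
  - intros [A B] p. split; [apply A|]. intros (x & Hx & ->). auto.
Qed.

Lemma app_H g x : g ∈ H -> x ∈ H -> app g x ∈ H.
Proof.
  intros Hg Hx.
  assert (D : DT U Q (fun env => app (env 0) (env 1))) by dfn.
  refine (proj1 D (fun n => match n with 0 => g | _ => x end) _). now intros [|n].
Qed.

Lemma isfn_H f a b : isfn f a -> a ∈ H -> b ∈ H -> (forall x, x ∈ a -> app f x ∈ b) -> f ∈ H.
Proof.
  intros F Ha Hb V. apply (mdl_sub MD (mdl_prod MD Ha Hb)). intros p Hp. apply F in Hp as (x & Hx & ->).
  apply opair_prod. auto.
Qed.

Lemma fixed_emp : fixed H J emp.
Proof. exact (elem_emp (mdl_elem MD) (mdl_trans MD) (mdl_emp MD)). Qed.

Lemma fixed_succ a : fixed H J a -> fixed H J (succ a).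
Proof. intros [A B]. split; [now apply succ_H|]. rewrite J_succ by auto. now rewrite B. Qed.

Lemma fixed_pred a : fixed H J (succ a) -> fixed H J a.
Proof.
  intros [A B]. assert (Ua : a ∈ H) by (apply (mdl_trans MD A), succE; auto). split; [exact Ua|].
  rewrite J_succ in B by auto. now apply succ_inj in B.
Qed.

Section Omega.
Context (Hom : omega ∈ H).

Lemma fixed_om : fixed H J omega.
Proof.
  apply (fixed_def (mdl_elem MD) (Phi := fun w => Ord w /\ (exists z, z ∈ w /\ forall u, u ∈ z -> u ∉ z) /\
    (forall n, n ∈ w -> succ n ∈ w) /\
    forall n, n ∈ w -> (forall u, u ∈ n -> u ∉ n) \/ exists k, k ∈ n /\ n = succ k)); [exact Hom|dfn|..].
  - split; [apply Ord_omega|]. split; [exists emp; split; [apply omega_emp|now apply empty_iff]|].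
    split; [apply omega_succ|]. intros n Hn. destruct (nat_cases Hn) as [->|(k & Hk & ->)]; [left; now apply empty_iff|].
    right. exists k. split; [apply succE; auto|reflexivity].
  - intros w _ (Ow & (z & Hz & Ez) & S & C). apply empty_iff in Ez as ->.
    assert (L : Lim w) by (split; auto). destruct (Ord_trich Ow Ord_omega) as [K|[K|K]]; [|exact K|].
    + apply (Lim_omega L) in K. now apply mem_irrefl in K.
    + destruct (C _ K) as [E|(k & Hk & E)].
      * apply empty_iff in E. exfalso. apply (@empE _ _ emp). rewrite <- E at 2. apply omega_emp.
      * exfalso. assert (Hs := omega_succ Hk). rewrite <- E in Hs. now apply mem_irrefl in Hs.
Qed.

Lemma fixed_nat n : n ∈ omega -> fixed H J n.
Proof.
  revert n. apply nat_ind_; [unfold fixed; dfn|exact fixed_emp|].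
  intros n Hn IH. now apply fixed_succ.
Qed.
End Omega.
End Models.

Ltac dfn_hook3 ::= lazymatch goal with
  | |- Dfn _ _ (fun env => isfn (@?a env) (@?b env)) => apply (@Dfn_isfn _ _ _ _ _ a b)
  end.

(** Being fixed passes from a successor to its predecessor, hence downward. The naturals of [M] may
    be nonstandard, so the induction takes place inside [M]. *)
Lemma nat_down {M : SetStructure} {HZF : ZF M} (P : M -> Prop) (m : M) :
  Dfn everything everything (fun env => P (env 0)) -> m ∈ omega -> P m ->
  (forall k, k ∈ m -> P (succ k) -> P k) -> forall k, k ∈ succ m -> P k.
Proof.
  intros D Hm Pm St k Hk. apply NNPP. intro NP.
  assert (Om := Ord_elem Ord_omega Hm). assert (Ok := Ord_elem (Ord_succ Om) Hk).
  assert (K : forall n, n ∈ omega -> subset k n -> subset n m -> ~ P n).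
  { apply (nat_ind_ (P := fun n => subset k n -> subset n m -> ~ P n)).
    - unfold subset. repeat first [dfn1 | exact D].
    - intros S _. replace emp with k; [exact NP|]. apply ext. intro z. split; [apply S|]. intro Hz. now apply empE in Hz.
    - intros n Hn IH S T HP. assert (On := Ord_elem Ord_omega Hn).
      assert (nm : n ∈ m) by (apply T, succE; auto).
      destruct (Ord_le_or Ok On) as [A|A].
      + apply IH; auto. now apply Ord_sub.
      + apply NP. replace k with (succ n); [exact HP|]. apply subset_antisym; [|exact S]. now apply succ_sub. }
  apply (K m); auto; [|intros z; auto]. apply succE in Hk as [Hk| ->]; [now apply Ord_sub|intros z; auto].
Qed.

(** * Coding the embedding below an even level *)

(** By induction on the level: an element of V_y is a subset of some fixed V_u with u < y, all of
    whose elements are fixed already. *)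
Lemma fixed_levels_pointwise {M : SetStructure} {HZF : ZF M} (A k : M) :
  Elem A k -> (forall x y, x ∈ A -> y ∈ x -> y ∈ A) -> emp ∈ A ->
  forall a hV, Ord a -> VF hV a -> (forall u, u ∈ a -> fixed A k (app hV u)) ->
  forall x, x ∈ app hV a -> x ∈ A -> app k x = x.
Proof.
  intros HE Atr Aemp a hV Oa HV FV.
  enough (K : forall y, Ord y -> y ∈ succ a -> forall x, x ∈ app hV y -> x ∈ A -> app k x = x).
  { intros x. apply K; [exact Oa|apply succE; auto]. }
  apply (ord_ind (P := fun y => y ∈ succ a -> forall x, x ∈ app hV y -> x ∈ A -> app k x = x)); [dfn|].
  intros y Oy IH Hy x Hx Ax. apply (VF_E HV) in Hx as (u & Hu & S); [|exact Hy].
  assert (Hu' := Ord_trans (Ord_succ Oa) Hy Hu).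
  assert (ua : u ∈ a).
  { apply succE in Hy as [Hy| ->]; [exact (Ord_trans Oa Hy Hu)|exact Hu]. }
  apply (elem_fix_subset HE Atr Aemp (FV u ua)); [|exact Ax|exact S].
  intros z Hz. apply (IH u Hu Hu' z Hz). exact (Atr _ _ (proj1 (FV u ua)) Hz).
Qed.

Section Levels.
Context {M : SetStructure} {HZF : ZF M} (H J : M) {MD : Model H J}.
Implicit Types x y z a b c u w R T g k m n : M.
Local Notation U := (fun x => x ∈ H).
Local Notation Q := (fixed H J).
Context (hV e : M) (Oe : Ord e) (HV : VF hV (succ (succ e))).
Local Notation V x := (app hV x).
Context (HP : V (succ (succ e)) ∈ H) (FX : fixed H J (V (succ e))) (Hom : omega ∈ H).

Let O1 := Ord_succ Oe.
Let O2 := Ord_succ O1.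
Let FO := fixed_om Hom.

(** e + 1 is the set of ordinals in the fixed set V_{e+1}. *)
Lemma fixed_e : fixed H J e.
Proof.
  assert (A : fixed H J (succ e)).
  { replace (succ e) with (sep (V (succ e)) (fun x => Ord x)).
    - apply (fixed_sep (MD := MD) FX); dfn.
    - apply ext. intro x. rewrite sepE by dfn.
      assert (I : succ e ∈ succ (succ (succ e))) by (apply succE; left; apply succE; auto). split.
      + intros [B C]. now apply (VF_ord O2 HV I C) in B.
      + intro B. assert (C := Ord_elem O1 B). split; [now apply (VF_ord O2 HV I C)|exact C]. }
  exact (fixed_pred A).
Qed.

(** The hierarchy up to V_{e+1} only, whose members are elements of V_{e+2}; this keeps the function
    inside H. *)
Definition levels : M := lam (succ (succ e)) (fun y => V y).
Lemma levels_fn : isfn levels (succ (succ e)) /\ forall y, y ∈ succ (succ e) -> app levels y = V y.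
Proof. apply lam_fn. dfn. Qed.

Let up2 y : y ∈ succ (succ e) -> y ∈ succ (succ (succ e)).
Proof. intro Hy. apply succE. auto. Qed.

Lemma levels_VF : VF levels (succ e).
Proof.
  destruct levels_fn as [F E]. split; [exact F|]. intros x Hx z. rewrite E by exact Hx.
  rewrite (VF_E HV z (up2 Hx)). split; intros (u & Hu & S); exists u; (split; [exact Hu|]).
  - now rewrite E by exact (Ord_trans O2 Hx Hu).
  - now rewrite E in S by exact (Ord_trans O2 Hx Hu).
Qed.

Lemma fixed_levels : fixed H J levels.
Proof.
  destruct levels_fn as [F E].
  assert (Fe := fixed_e). assert (F2 : fixed H J (succ (succ e))) by exact (fixed_succ (fixed_succ Fe)).
  assert (L : levels ∈ H).
  { apply (isfn_H F (proj1 F2) HP). intros x Hx. rewrite E by exact Hx.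
    apply (VF_level_mem HV); [apply succE; auto|exact Hx]. }
  apply (fixed_def (mdl_elem MD) (Phi := fun f => isfn f (succ (succ e)) /\ forall x, x ∈ succ (succ e) ->
    forall z, z ∈ H -> z ∈ app f x <-> exists u, u ∈ x /\ forall w, w ∈ z -> w ∈ app f u)); [exact L|dfn|..].
  - split; [exact F|]. intros x Hx z _. now apply levels_VF.
  - intros f Hf [Ff C]. assert (VF f (succ e)).
    { split; [exact Ff|]. intros x Hx z.
      assert (Ux : forall x, x ∈ succ (succ e) -> x ∈ H) by (intros; eapply (mdl_trans MD); [apply F2|eauto]).
      split.
      - intro Hz. apply C; auto. exact (mdl_trans MD (app_H Hf (Ux _ Hx)) Hz).
      - intros (u & Hu & S). apply C; [exact Hx| |eauto].
        apply (mdl_sub MD (app_H Hf (Ux u (Ord_trans O2 Hx Hu))) S). }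
    apply (isfn_ext Ff F). intros x Hx.
    apply (VF_unique O1 O1 H0 levels_VF); auto. exact (Ord_elem O2 Hx).
Qed.

Lemma fixed_V y : fixed H J y -> y ∈ succ (succ e) -> fixed H J (V y).
Proof.
  intros [Uy Ey] Hy. destruct levels_fn as [F E]. rewrite <- E by exact Hy.
  destruct fixed_levels as [L FL]. split; [now apply (app_H (MD := MD))|].
  rewrite (J_app (MD := MD)) by auto. now rewrite FL, Ey.
Qed.

Lemma levels_pointwise_fixed : (forall y, y ∈ succ (succ e) -> app J y = y) ->
  forall x, x ∈ V (succ (succ e)) -> app J x = x.
Proof.
  intros FA x Hx.
  apply (fixed_levels_pointwise (mdl_elem MD) (mdl_trans MD) (mdl_emp MD) O2 HV); [|exact Hx|exact (mdl_trans MD HP Hx)].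
  intros y Hy. apply fixed_V; [|exact Hy]. split; [|auto].
  exact (mdl_trans MD (proj1 (fixed_succ (fixed_succ fixed_e))) Hy).
Qed.

(* c codes the restriction of J to the level x + 1, as decoded by D. *)
Definition coded x : Prop := exists D, (D ∈ H /\ app J D = D) /\ exists c, c ∈ V (succ x) /\
  forall a, a ∈ V (succ x) -> app D (opair c a) = app J a.

(** For z in V_x with x < g, z ∈ J(a) iff z ∈ J(a) ∩ V_{J(x)} = J(a ∩ V_x), because x ≤ J(x). So the
    values of J on V_g determine those on its subsets, and the graph on V_g is itself a subset of
    V_g, limit levels being closed under pairs. *)
Lemma coded_limit g : Lim g -> g ∈ succ e -> fixed H J g -> coded g.
Proof.
  intros Lg Hg Fg. assert (Og := proj1 Lg).
  assert (Hg1 : g ∈ succ (succ e)) by (apply succE; auto).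
  assert (Hg2 : succ g ∈ succ (succ e)) by (apply succ_mono; auto).
  assert (Hg3 : g ∈ succ (succ (succ e))) by (apply succE; auto).
  assert (Hg4 : succ g ∈ succ (succ (succ e))) by (apply succE; auto).
  assert (FV := fixed_V Fg Hg1). assert (FL := fixed_levels).
  assert (FY := fixed_V (fixed_succ Fg) Hg2).
  assert (YE : forall z, z ∈ V (succ g) <-> subset z (V g)) by (intro; apply (VF_succ O2 HV); exact Hg4).
  destruct levels_fn as [FLn EL].
  set (Vg := V g) in *.
  set (cut := fun a x => sep a (fun u => u ∈ app levels x)).
  assert (Dcut : DT U Q (fun env => cut (env 0) (env 1))) by (unfold cut; dfn).
  assert (cutE : forall a x z, z ∈ cut a x <-> z ∈ a /\ z ∈ app levels x) by (intros; unfold cut; rewrite sepE by dfn; reflexivity).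
  set (F := fun c a => sep Vg (fun z => exists x, x ∈ g /\ exists w, w ∈ Vg /\ (opair (cut a x) w ∈ c /\ z ∈ w))).
  assert (FE : forall c a z, z ∈ F c a <-> z ∈ Vg /\ exists x, x ∈ g /\ exists w, w ∈ Vg /\ (opair (cut a x) w ∈ c /\ z ∈ w))
    by (intros; unfold F, cut; rewrite sepE by dfn; reflexivity).
  destruct (fixed_lam2 (F := F) FY) as (D & FD & HD).
  { unfold F, cut. dfn. }
  { intros c a _ _. apply YE. intros z Hz. now apply FE in Hz. }
  exists D. split; [exact FD|].
  assert (JV : forall y, y ∈ Vg -> app J y ∈ Vg).
  { intros y Hy. exact (J_fixed_mem FV Hy). }
  set (c := repl Vg (fun y => opair y (app J y))).
  assert (Hc : forall p, p ∈ c <-> exists y, y ∈ Vg /\ p = opair y (app J y)) by (intro; unfold c; rewrite replE by dfn; reflexivity).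
  assert (cY : c ∈ V (succ g)).
  { apply YE. intros p Hp. apply Hc in Hp as (y & Hy & ->). apply (VF_opair O2 HV); auto. }
  exists c. split; [exact cY|]. intros a Ha. rewrite HD by auto.
  assert (Ua := mdl_trans MD (proj1 FY) Ha). apply YE in Ha.
  assert (levx : forall x, x ∈ g -> app levels x = V x).
  { intros x Hx. apply EL. exact (Ord_trans O2 Hg1 Hx). }
  assert (cutV : forall x, x ∈ g -> cut a x ∈ Vg).
  { intros x Hx. apply (VF_E HV _ Hg3). exists x. split; [exact Hx|]. intros z Hz. apply cutE in Hz as [_ Hz].
    now rewrite levx in Hz. }
  assert (Ug := proj1 Fg).
  assert (Jcut : forall x, x ∈ g -> app J (cut a x) = cut (app J a) (app J x)).
  { intros x Hx. apply (elem_term2 (mdl_elem MD) Dcut); [exact Ua|exact (mdl_trans MD Ug Hx)]. }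
  apply ext. intro z. rewrite FE. split.
  - intros (_ & x & Hx & w & Hw & K & Hz). apply Hc in K as (y & Hy & E). apply opair_inj in E as [<- ->].
    rewrite Jcut in Hz by exact Hx. now apply cutE in Hz.
  - intro Hz.
    assert (Hz' : z ∈ Vg) by exact (J_fixed_sub FV Ua Ha Hz).
    split; [exact Hz'|]. apply (VF_lim O2 HV _ Hg3 Lg) in Hz' as (x & Hx & Hzx). exists x. split; [exact Hx|].
    exists (app J (cut a x)). split; [now apply JV, cutV|]. split; [apply Hc; eauto|].
    rewrite Jcut by exact Hx. apply cutE. split; [exact Hz|].
    assert (Ux := mdl_trans MD Ug Hx). assert (Ox := Ord_elem Og Hx).
    assert (HJ : app J x ∈ g) by exact (J_fixed_mem Fg Hx).
    rewrite levx by exact HJ. revert Hzx. apply (VF_mono HV).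
    + exact (Ord_trans (Ord_succ O2) Hg3 Hx).
    + exact (Ord_trans (Ord_succ O2) Hg3 HJ).
    + now apply (J_ge (MD := MD)).
Qed.

(** The sets [bb y a] to which J has to be applied lie one level below a, so it suffices to store
    the graph of J on W. With flat pairs this graph is a subset of W, which puts it exactly two
    levels above the given code. *)
Lemma coded_step x : Ord x -> fixed H J x -> subset omega x -> succ (succ x) ∈ succ e -> coded x -> coded (succ (succ x)).
Proof.
  intros Ox Fx Wx Hx (D & FD & c0 & Hc0 & HD). fold (fixed H J D) in FD.
  assert (I2 : succ (succ x) ∈ succ (succ e)) by (apply succE; auto).
  assert (I3 : succ (succ (succ x)) ∈ succ (succ e)) by (apply succ_mono; auto; now repeat apply Ord_succ).
  assert (I1 : succ x ∈ succ (succ e)) by (apply (Ord_trans O2 I2); apply succE; auto).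
  assert (F1 := fixed_succ Fx).
  assert (F2 := fixed_succ F1).
  assert (F3 := fixed_succ F2).
  assert (FY1 := fixed_V F1 I1). assert (FW := fixed_V F2 I2). assert (FY := fixed_V F3 I3).
  assert (WE : forall z, z ∈ V (succ (succ x)) <-> subset z (V (succ x))) by (intro; apply (VF_succ O2 HV); now apply up2).
  assert (YE : forall z, z ∈ V (succ (succ (succ x))) <-> subset z (V (succ (succ x)))) by (intro; apply (VF_succ O2 HV); now apply up2).
  assert (WP : V (succ (succ x)) = Pow (V (succ x))) by (apply ext; intro; now rewrite WE, PowE).
  assert (Wfp : fpclosed (V (succ (succ x)))).
  { rewrite WP. apply (fp_closed_level (a := succ (succ e)) O2 HV); [now apply up2|]. intros n Hn. apply succE. auto. }
  assert (Y1W : subset (V (succ x)) (V (succ (succ x)))).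
  { apply (VF_mono HV); [now apply up2..|]. intros z Hz. apply succE; auto. }
  set (Y1 := V (succ x)) in *. set (W := V (succ (succ x))) in *. set (Y := V (succ (succ (succ x)))) in *.
  set (bb := fun y a => sep Y1 (fun s => sep Y1 (fun u => app D (opair s u) ∈ y) ∈ a)).
  assert (Dbb : DT U Q (fun env => bb (env 0) (env 1))) by (unfold bb; dfn).
  assert (bbE : forall y a s, s ∈ bb y a <-> s ∈ Y1 /\ sep Y1 (fun u => app D (opair s u) ∈ y) ∈ a)
    by (intros; unfold bb; rewrite sepE by dfn; reflexivity).
  assert (bbW : forall y a, bb y a ∈ W) by (intros y a; apply WE; intros z Hz; now apply bbE in Hz).
  set (F := fun c' a => sep W (fun y => exists c, c ∈ Y1 /\ exists z, z ∈ W /\ exists b, b ∈ W /\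
    ((b = bb y a /\ c ∈ z) /\ exists w, w ∈ c' /\ exists q, q ∈ W /\ (isFp omega z c q /\ isFp omega b q w)))).
  assert (FE : forall c' a y, y ∈ F c' a <-> y ∈ W /\ exists c, c ∈ Y1 /\ exists z, z ∈ W /\ exists b, b ∈ W /\
    ((b = bb y a /\ c ∈ z) /\ exists w, w ∈ c' /\ exists q, q ∈ W /\ (isFp omega z c q /\ isFp omega b q w)))
    by (intros; unfold F, bb; rewrite sepE by dfn; reflexivity).
  destruct (fixed_lam2 (F := F) FY) as (D' & FD' & HD').
  { unfold F, bb. dfn. }
  { intros c a _ _. apply YE. intros z Hz. now apply FE in Hz. }
  exists D'. split; [exact FD'|].
  assert (JW : forall y, y ∈ W -> app J y ∈ W).
  { intros y Hy. exact (J_fixed_mem FW Hy). }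
  (* The old code c0 is repeated in every triple, so that one set yields both the graph and c0. *)
  set (c' := repl W (fun y => fp y (fp (app J y) c0))).
  assert (Hc' : forall w, w ∈ c' <-> exists y, y ∈ W /\ w = fp y (fp (app J y) c0)) by (intro; unfold c'; rewrite replE by dfn; reflexivity).
  assert (c'Y : c' ∈ Y).
  { apply YE. intros w Hw. apply Hc' in Hw as (y & Hy & ->). auto. }
  exists c'. split; [exact c'Y|]. intros a Ha. rewrite HD' by auto.
  assert (Ua := mdl_trans MD (proj1 FY) Ha). apply YE in Ha.
  assert (K : forall y, y ∈ W -> c0 ∈ app J (bb y a) <-> y ∈ app J a).
  { intros y Hy. assert (Uy := mdl_trans MD (proj1 FW) Hy).
    rewrite (elem_term2 (mdl_elem MD) Dbb Uy Ua). rewrite bbE.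
    replace (sep Y1 (fun u => app D (opair c0 u) ∈ app J y)) with y; [tauto|].
    apply ext. intro u. rewrite sepE by dfn. assert (S := proj1 (WE y) Hy). split.
    - intro Hu. assert (Yu := S u Hu). split; [exact Yu|]. rewrite HD by exact Yu.
      exact (proj1 (J_mem (mdl_trans MD Uy Hu) Uy) Hu).
    - intros [Yu L]. rewrite HD in L by exact Yu.
      exact (proj2 (J_mem (mdl_trans MD (proj1 FY1) Yu) Uy) L). }
  apply ext. intro y. rewrite FE. split.
  - intros (Hy & c & Hc & z & Hz & b & Hb & [-> Hcz] & w & Hw & q & Hq & E1 & E2).
    apply isFp_iff in E1 as ->, E2 as ->. apply Hc' in Hw as (y' & _ & E). apply fp_inj in E as [<- E].
    apply fp_inj in E as [-> ->]. now apply K.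
  - intro Hy. assert (Wy : y ∈ W) by exact (J_fixed_sub FW Ua Ha Hy).
    split; [exact Wy|]. exists c0. split; [exact Hc0|]. exists (app J (bb y a)). split; [apply JW, bbW|].
    exists (bb y a). split; [apply bbW|]. split; [split; [reflexivity|now apply K]|].
    exists (fp (bb y a) (fp (app J (bb y a)) c0)). split; [apply Hc'; eauto|].
    exists (fp (app J (bb y a)) c0). rewrite !isFp_iff. split; [|auto]. apply Wfp; [apply JW, bbW|auto].
Qed.

Theorem coded_even g m h : Lim g -> m ∈ omega -> Even m -> app h emp = g ->
  (forall k, k ∈ m -> app h (succ k) = succ (app h k)) -> app h m = e -> coded e.
Proof.
  intros Lg Hm Em H0 HS He. assert (Om := Ord_elem Ord_omega Hm).
  (* From the fixed point e down: each predecessor is fixed, and at 0 the limit g turns out to be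
     fixed. *)
  assert (A : forall k, k ∈ succ m -> (app h k ∈ succ e) /\ fixed H J (app h k)).
  { apply nat_down; [unfold fixed; dfn|exact Hm|rewrite He; split; [apply succE; auto|apply fixed_e]|].
    intros k Hk [B C]. rewrite HS in B, C by exact Hk. split.
    - apply (Ord_trans O1 B). apply succE; auto.
    - exact (fixed_pred C). }
  assert (B : forall k, k ∈ omega -> k ∈ succ m -> subset g (app h k)).
  { apply (nat_ind_ (P := fun k => k ∈ succ m -> subset g (app h k))); [unfold subset; dfn|rewrite H0; intros _ z; auto|].
    intros k Hk IH Sk. assert (km : k ∈ m).
    { apply succE in Sk as [Sk|Sk]; [apply (Ord_trans Om Sk), succE; auto|rewrite <- Sk; apply succE; auto]. }
    rewrite HS by exact km. intros z Hz. apply succE. left. apply IH; [apply succE; auto|exact Hz]. }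
  (* Coding advances by two, so k and its successor are carried through the induction together. *)
  assert (C : forall k, k ∈ omega -> (k ∈ succ m -> Even k -> coded (app h k)) /\
    (succ k ∈ succ m -> Even (succ k) -> coded (app h (succ k)))).
  { apply nat_ind_.
    - unfold coded, Even. dfn.
    - split.
      + intros _ _. rewrite H0. destruct (A emp) as [A1 A2].
        { destruct (Ord_trich Ord_emp (Ord_succ Om)) as [K|[K|K]]; [exact K|symmetry in K; now apply succ_not_emp in K|now apply empE in K]. }
        rewrite H0 in *. now apply coded_limit.
      + intros _ K. apply Even_succ in K; [|apply omega_emp]. destruct K. apply Even_emp.
    - intros k Hk [IH1 IH2]. split; [exact IH2|]. intros Sk Ek.
      assert (k1 : succ k ∈ m).
      { apply succE in Sk as [Sk|Sk]; [apply (Ord_trans Om Sk), succE; auto|rewrite <- Sk; apply succE; auto]. }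
      assert (k0 : k ∈ m) by (apply (Ord_trans Om k1), succE; auto).
      assert (Ev : Even k).
      { apply Even_succ in Ek; [|now apply omega_succ]. apply NNPP. intro N. apply Ek. now apply Even_succ. }
      assert (ks : k ∈ succ m) by (apply succE; auto). destruct (A k ks) as [A1 A2].
      rewrite HS, HS by auto. apply coded_step; auto.
      + exact (Ord_elem O1 A1).
      + apply (subset_trans (Lim_omega Lg)). now apply B.
      + rewrite <- !HS by auto. now apply A. }
  rewrite <- He. refine (proj1 (C m Hm) _ Em). apply succE; auto.
Qed.
End Levels.

(** * Increasing ω-continuous maps *)

(* [th] is ℵ*(X), [k] is the critical point of J, and an element of X codes J on X. *)
Record Core {M : SetStructure} {HZF : ZF M} (H J X th D k : M) : Prop := {
  c_mod : Model H J;
  c_om : omega ∈ H;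
  c_X : fixed H J X;
  c_th : fixed H J th;
  c_D : fixed H J D;
  c_O : Ord th;
  c_thE : forall a, a ∈ th <-> Ord a /\ sle a X;
  c_fp : fpclosed X;
  c_Xom : subset omega X;
  c_code : exists c, c ∈ X /\ forall a, a ∈ X -> app D (opair c a) = app J a;
  c_k : k ∈ th;
  c_moved : app J k <> k;
  c_least : forall a, a ∈ k -> app J a = a
}.

Section Increasing.
Context {M : SetStructure} {HZF : ZF M} (H J X th D k : M) (C : Core H J X th D k).
Implicit Types x y z a b c u w R T g m n i h : M.
Local Notation U := (fun x => x ∈ H).
Local Notation Q := (fixed H J).
#[local] Instance MD : Model H J := c_mod C.
Let FX := c_X C.
Let Fth := c_th C.
Let FD := c_D C.
Let FO := fixed_om (MD := c_mod C) (c_om C).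
Let Oth := c_O C.

Lemma thO a : a ∈ th -> Ord a.
Proof. intro Ha. exact (Ord_elem (c_O C) Ha). Qed.
Lemma thH a : a ∈ th -> a ∈ H.
Proof. intro Ha. exact (mdl_trans MD (proj1 (c_th C)) Ha). Qed.
Lemma thT a b : a ∈ th -> b ∈ a -> b ∈ th.
Proof. intros Ha Hb. exact (Ord_trans (c_O C) Ha Hb). Qed.
Lemma th_sub a b : b ∈ th -> Ord a -> subset a b -> a ∈ th.
Proof. intros Hb Oa S. exact (Ord_sub_mem Oa (thO Hb) (c_O C) S Hb). Qed.
Lemma J_th a : a ∈ th -> app J a ∈ th.
Proof. exact (J_fixed_mem (MD := MD) (c_th C)). Qed.
Lemma X_emp : emp ∈ X.
Proof. apply (c_Xom C), omega_emp. Qed.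
Lemma X_one : sing emp ∈ X.
Proof. exact (one_P (c_Xom C)). Qed.
Lemma th_sle_lim a : a ∈ th -> succ a ∈ th.
Proof.
  intro Ha. apply (c_thE C) in Ha as [Oa S]. apply (c_thE C). split; [now apply Ord_succ|].
  apply (sle_cup (c_fp C) (c_Xom C)); [exact S|]. exact (sle_sing _ X_emp).
Qed.
Lemma th_omega : omega ∈ th.
Proof.
  apply (c_thE C). split; [apply Ord_omega|]. apply (sle_sub_r (a := omega)); [apply (c_Xom C)|apply sle_refl].
Qed.
Lemma th_emp : emp ∈ th.
Proof. exact (thT th_omega omega_emp). Qed.
Lemma th_Lim : Lim th.
Proof. split; [exact Oth|]. split; [exact th_emp|exact th_sle_lim]. Qed.
Lemma X_H x : x ∈ X -> x ∈ H.
Proof. exact (mdl_trans MD (proj1 (c_X C))). Qed.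

Lemma cup_max a b : Ord a -> Ord b -> Ord (cup a b) /\ (cup a b = a \/ cup a b = b).
Proof.
  intros Oa Ob. assert (E : cup a b = a \/ cup a b = b).
  { destruct (Ord_le_or Oa Ob) as [S|S]; [right|left]; apply ext; intro z; rewrite cupE; split; auto.
    - intros [K|K]; auto.
    - intros [K|K]; auto. exact (Ord_trans Oa S K). }
  split; [|exact E]. now destruct E as [-> | ->].
Qed.

(** The last clause is continuity at suprema of ω-sequences that belong to H. *)
Definition incr i : Prop := isfn i th /\ (forall a, a ∈ th -> app i a ∈ th) /\
  (forall a, a ∈ th -> forall b, b ∈ a -> app i b ∈ app i a) /\
  forall h, h ∈ H -> forall a, a ∈ th -> (forall n, n ∈ omega -> app h n ∈ a) ->
    (forall x, x ∈ a -> exists n, n ∈ omega /\ x ∈ app h n) ->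
    forall x, x ∈ app i a -> exists n, n ∈ omega /\ x ∈ app i (app h n).

Lemma incr_U (s : (nat -> M) -> M) : DT U Q s -> Dfn U Q (fun env => incr (s env)).
Proof. apply (Dfn_pred1 (P := incr)). unfold incr. dfn. Qed.
Lemma incr_D (s : (nat -> M) -> M) : DTm s -> Dfm (fun env => incr (s env)).
Proof. apply (Dfn_pred1 (P := incr)). unfold incr. dfn. Qed.

Lemma incr_ge i a : incr i -> a ∈ th -> subset a (app i a).
Proof.
  intros (F & V & I & _) Ha. assert (Oa := thO Ha). revert Ha. revert a Oa.
  apply (ord_ind (P := fun a => a ∈ th -> subset a (app i a))); [unfold subset; dfn|].
  intros a Oa IH Ha z Hz. assert (Tz := thT Ha Hz).
  exact (Ord_sub_mem (thO Tz) (thO (V z Tz)) (thO (V a Ha)) (IH z Hz Tz) (I a Ha z Hz)).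
Qed.

Lemma incr_le i a b : incr i -> a ∈ th -> b ∈ th -> subset a b -> subset (app i a) (app i b).
Proof.
  intros (F & V & I & _) Ha Hb S. apply Ord_subset in S as [S| ->]; [|intros z; auto|now apply thO|now apply thO].
  apply Ord_sub; [now apply thO, V|auto].
Qed.

Definition Jt : M := lam th (fun a => app J a).
Lemma Jt_fn : isfn Jt th /\ forall a, a ∈ th -> app Jt a = app J a.
Proof. apply lam_fn. dfn. Qed.
Lemma Jt_H : Jt ∈ H.
Proof.
  destruct Jt_fn as [F E]. apply (isfn_H F (proj1 Fth) (proj1 Fth)). intros a Ha. rewrite E by exact Ha.
  now apply J_th.
Qed.

(** If h is a cofinal ω-sequence in a, then J(h) is cofinal in J(a), and J(h)(n) = J(h(n)) since J
    fixes n. *)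
Lemma incr_J : incr Jt.
Proof.
  destruct Jt_fn as [F E]. split; [exact F|]. split; [intros a Ha; rewrite E by exact Ha; now apply J_th|]. split.
  - intros a Ha b Hb. assert (Tb := thT Ha Hb). rewrite !E by auto. exact (proj1 (J_mem (MD := MD) (thH Tb) (thH Ha)) Hb).
  - intros h Hh a Ha B1 B2 x Hx. rewrite E in Hx by exact Ha.
    assert (K := proj1 (elem2 (mdl_elem MD) (P := fun h a => forall x, x ∈ a -> exists n, n ∈ omega /\ x ∈ app h n)
      ltac:(dfn) Hh (thH Ha)) B2 x Hx).
    destruct K as (n & Hn & K). exists n. split; [exact Hn|]. rewrite E by exact (thT Ha (B1 n Hn)).
    assert (Fn := fixed_nat (MD := MD) Hn).
    rewrite (J_app (MD := MD) Hh (proj1 Fn)), (proj2 Fn). exact K.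
Qed.

Section Iteration.
Context (v : M -> M) (Dv : DTm (fun env => v (env 0))).
Let Dv' (s : (nat -> M) -> M) : DTm s -> DTm (fun env => v (s env)).
Proof. exact (DT_fun1 Dv (s := s)). Qed.

(** The maximum with the current value and the added 1 make the sequence strictly increasing,
    however small v is. *)
Definition is_iter a h : Prop := isfn h omega /\ app h emp = a /\
  forall n, n ∈ omega -> app h (succ n) = succ (cup (app h n) (v (app h n))).

Lemma iter_ex a : exists h, is_iter a h.
Proof. apply (@omega_rec M HZF a (fun x => succ (cup x (v x)))). repeat first [dfn1|apply Dv']. Qed.

Lemma iter_unique a h h' : is_iter a h -> is_iter a h' -> h = h'.
Proof.
  intros (F & E0 & E1) (F' & E0' & E1'). apply (isfn_ext F F').
  apply nat_ind_; [dfn|congruence|]. intros n Hn IH. rewrite E1, E1', IH by exact Hn. reflexivity.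
Qed.

(** The ordinal c is the supremum of the sequence. A map bounded by v sends each term below the next
    one, so continuity gives i(c) = c. *)
Lemma iterate_closed b a h : Lim b -> subset b th -> (forall c, c ∈ b -> v c ∈ b) -> a ∈ b -> is_iter a h ->
  (forall n, n ∈ omega -> app h n ∈ b) /\ h ∈ H /\
  ((forall x, x ∈ b -> exists n, n ∈ omega /\ x ∈ app h n) \/
   exists c, c ∈ b /\ a ∈ c /\ forall i, incr i -> (forall x, x ∈ b -> subset (app i x) (v x)) -> app i c = c).
Proof.
  intros Lb Sb Cv Ha (F & E0 & E1). assert (Ob := proj1 Lb).
  assert (K : forall n, n ∈ omega -> app h n ∈ b).
  { apply nat_ind_; [dfn|now rewrite E0|]. intros n Hn IH. rewrite E1 by exact Hn. apply Lb.
    destruct (cup_max (Ord_elem Ob IH) (Ord_elem Ob (Cv _ IH))) as [_ [-> | ->]]; auto. }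
  split; [exact K|]. assert (Hh : h ∈ H).
  { apply (isfn_H F (c_om C) (proj1 Fth)). intros n Hn. now apply Sb, K. }
  split; [exact Hh|].
  set (c := sep b (fun x => exists n, n ∈ omega /\ x ∈ app h n)).
  assert (cE : forall x, x ∈ c <-> x ∈ b /\ exists n, n ∈ omega /\ x ∈ app h n) by (intro; unfold c; rewrite sepE by dfn; reflexivity).
  assert (St : forall n, n ∈ omega -> app h n ∈ c).
  { intros n Hn. apply cE. split; [now apply K|]. exists (succ n). split; [now apply omega_succ|].
    rewrite E1 by exact Hn. assert (On := Ord_elem Ob (K n Hn)). assert (Ov := Ord_elem Ob (Cv _ (K n Hn))).
    destruct (cup_max On Ov) as [Oc _]. apply (succ_sub (a := app h n) (b := succ (cup (app h n) (v (app h n))))); [exact On|now apply Ord_succ|].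
    intros z Hz. apply succE in Hz as [Hz| ->]; apply succE.
    - left. apply cupE. auto.
    - apply Ord_subset; [exact On|exact Oc|]. intros w Hw. apply cupE. auto. }
  assert (Oc : Ord c).
  { split.
    - intros x Hx y Hy. apply cE in Hx as (Hx & n & Hn & Hx'). apply cE. split; [exact (Ord_trans Ob Hx Hy)|].
      exists n. split; [exact Hn|]. exact (Ord_trans (Ord_elem Ob (K n Hn)) Hx' Hy).
    - intros x Hx. apply cE in Hx as (Hx & _). exact (proj2 Ob x Hx). }
  assert (S : subset c b) by (intros x Hx; now apply cE in Hx).
  apply Ord_subset in S as [S|S]; [right|left|exact Oc|exact Ob].
  - exists c. split; [exact S|]. split; [rewrite <- E0; apply St, omega_emp|].
    intros i Hi B. assert (Tc := Sb _ S). apply subset_antisym; [|now apply incr_ge].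
    intros x Hx. destruct Hi as (_ & _ & _ & Ct). destruct (Ct h Hh c Tc St) with (x := x) as (n & Hn & L); [|exact Hx|].
    + intros y Hy. now apply cE in Hy.
    + apply (B _ (K n Hn)) in L. assert (N := St (succ n) (omega_succ Hn)). apply (Ord_trans Oc N).
      rewrite E1 by exact Hn. apply succE. left. apply cupE. auto.
  - intros x Hx. rewrite <- S in Hx. now apply cE in Hx.
Qed.
End Iteration.

(** * Common fixed points of the maps that share the properties of J *)

Section FixedPoints.
Context (P : M -> M -> M -> M -> Prop) (DP : Dfn U Q (fun env => P (env 0) (env 1) (env 2) (env 3)))
  (DP' : Dfm (fun env => P (env 0) (env 1) (env 2) (env 3))).
Definition common a b c : M := sep th (fun x => forall i, i ∈ H -> P i a b c -> app i x = x).

Lemma common_D (s r q : (nat -> M) -> M) : DTm s -> DTm r -> DTm q -> DTm (fun env => common (s env) (r env) (q env)).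
Proof.
  apply (DT_fun3 (F := common)). unfold common.
  apply (@DT_sep _ _ _ _ _ _ (fun _ => th) (fun x env => forall i, i ∈ H -> P i (env 0) (env 1) (env 2) -> app i x = x)); [dfn|].
  apply (@Dball _ _ _ _ _ (fun i env => P i (env 1) (env 2) (env 3) -> app i (env 0) = env 0)); [dfn|].
  apply Dfn_imp; [|dfn]. exact (Dfn_rename (fun l : nat => match l with 0 => 0 | S l => S (S l) end) DP').
Qed.

Lemma commonE a b c x : x ∈ common a b c <-> x ∈ th /\ forall i, i ∈ H -> P i a b c -> app i x = x.
Proof.
  unfold common. rewrite sepE; [reflexivity|].
  apply (@Dball _ _ _ _ (fun _ => H) (fun i env => P i a b c -> app i (env 0) = env 0)); [dfn|].
  apply Dfn_imp; [|dfn].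
  exact (Dfm_inst (fun l : nat => match l with 0 => Some 0 | _ => None end) (fun l : nat => match l with 1 => a | 2 => b | _ => c end) DP').
Qed.

(** The rank of x in Y, phrased with a witness in H so that J preserves the statement. *)
Definition isrank Y x r : Prop := exists F, F ∈ H /\ (isfn F Y /\ app F x = r /\
  forall x, x ∈ Y -> (forall z, z ∈ app F x -> exists y, y ∈ Y /\ (y ∈ x /\ z = app F y)) /\
    forall y, y ∈ Y -> y ∈ x -> app F y ∈ app F x).
Lemma isrank_iff Y x r : subset Y th -> x ∈ Y -> isrank Y x r <-> r = app (rk Y) x.
Proof.
  intros SY Hx. assert (OY : forall y, y ∈ Y -> Ord y) by (intros y Hy; apply thO, SY, Hy). split.
  - intros (F & HF & Fn & <- & A). replace F with (rk Y); [reflexivity|].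
    apply (iscol_unique (memrel_wf (Y:=Y))); [exact (colP (memrel_wf (Y:=Y)))|]. split; [exact Fn|].
    intros y Hy z. destruct (A y Hy) as [A1 A2]. split.
    + intro Hz. destruct (A1 z Hz) as (u & Hu & uy & ->). exists u. rewrite memrelE. auto.
    + intros (u & Hu & R & ->). apply memrelE in R as (_ & _ & R). auto.
  - intros ->. exists (rk Y). split.
    + apply (isfn_H (MD := MD) (b := th) (rk_fn Y)); [apply (mdl_sub MD (proj1 Fth) SY)|apply Fth|].
      intros y Hy. apply (th_sub (SY y Hy)); [now apply (rk_Ord OY)|now apply (rk_sub OY)].
    + split; [apply rk_fn|]. split; [reflexivity|]. intros y Hy. split.
      * intros z Hz. now apply rkE in Hz.
      * intros u Hu. now apply rk_mono.
Qed.

(** J restricted to θ belongs to the family for a, b, c and to the family for their images, so J is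
    the identity on K and on J(K), whence J(K) = K. By elementarity an element of rank κ in K would
    also have rank J(κ). *)
Lemma common_small a b c : a ∈ H -> b ∈ H -> c ∈ H -> P Jt a b c -> P Jt (app J a) (app J b) (app J c) ->
  forall x, x ∈ common a b c -> app (rk (common a b c)) x ∈ k.
Proof.
  intros Ha Hb Hc P0 P1. set (K := common a b c).
  assert (SK : subset K th) by (intros x Hx; now apply commonE in Hx).
  assert (DK : DT U Q (fun env => common (env 0) (env 1) (env 2))).
  { apply (@DT_sep _ _ U Q _ _ (fun _ => th) (fun x env => forall i, i ∈ H -> P i (env 0) (env 1) (env 2) -> app i x = x)); [dfn|].
    apply (@Dfn_all _ _ _ (fun i env => P i (env 1) (env 2) (env 3) -> app i (env 0) = env 0)).
    apply Dfn_imp; [|dfn]. exact (Dfn_rename (fun l : nat => match l with 0 => 0 | S l => S (S l) end) DP). }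
  assert (HK : K ∈ H) by exact (mdl_sub MD (proj1 Fth) SK).
  assert (JK : app J K = common (app J a) (app J b) (app J c)).
  { apply (elem_term (mdl_elem MD) (env := fun l : nat => match l with 0 => a | 1 => b | _ => c end) DK). now intros [|[|l]]. }
  destruct Jt_fn as [_ EJ].
  assert (Fx : forall x, x ∈ K -> app J x = x).
  { intros x Hx. apply commonE in Hx as [Tx A]. rewrite <- (EJ x Tx). apply A; [apply Jt_H|exact P0]. }
  assert (JKK : app J K = K).
  { apply ext. intro x. split; intro Hx.
    - assert (Hx' := Hx). rewrite JK in Hx. apply commonE in Hx as [Tx A].
      assert (E : app J x = x) by (rewrite <- (EJ x Tx); apply A; [apply Jt_H|exact P1]).
      rewrite <- E in Hx'. exact (proj2 (J_mem (MD := MD) (thH Tx) HK) Hx').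
    - rewrite <- (Fx x Hx). exact (proj1 (J_mem (MD := MD) (thH (SK x Hx)) HK) Hx). }
  assert (OK : forall y, y ∈ K -> Ord y) by (intros y Hy; apply thO, SK, Hy).
  assert (N : forall x, x ∈ K -> app (rk K) x <> k).
  { intros x Hx E. apply (c_moved C). symmetry in E. apply (isrank_iff _ SK Hx) in E.
    assert (L := proj1 (elem3 (mdl_elem MD) (P := isrank) ltac:(unfold isrank; dfn) HK (thH (SK x Hx)) (thH (c_k C))) E).
    rewrite JKK, (Fx x Hx) in L. apply (isrank_iff _ SK Hx) in L, E. congruence. }
  intros x Hx. destruct (Ord_trich (rk_Ord OK Hx) (thO (c_k C))) as [A|[A|A]]; [exact A|now apply N in A|].
  destruct (rk_initial Hx A) as (y & Hy & _ & E). now apply N in E.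
Qed.
End FixedPoints.
End Increasing.

(** * No uniform surjections *)

Section Uniform.
Context {M : SetStructure} {HZF : ZF M} (H J X th D k : M) (C : Core H J X th D k).
Implicit Types x y z a b c u w R T g m n i h t s : M.
Local Notation U := (fun x => x ∈ H).
Local Notation Q := (fixed H J).
#[local] Instance model_uniform : Model H J := c_mod C.
Let FX := c_X C.
Let Fth := c_th C.
Let FD := c_D C.
Let FO := fixed_om (MD := c_mod C) (c_om C).
Let Oth := c_O C.
Local Notation Jt := (Jt J th).

Definition uniform t : Prop :=
  (forall p, p ∈ t -> exists a, a ∈ th /\ exists x, x ∈ X /\ exists b, b ∈ th /\ p = opair a (opair x b)) /\
  (forall a, a ∈ th -> forall x, x ∈ X -> forall b, b ∈ th -> forall b', b' ∈ th ->
    opair a (opair x b) ∈ t -> opair a (opair x b') ∈ t -> b = b') /\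
  forall a, a ∈ th -> forall b, b ∈ a -> exists x, x ∈ X /\ opair a (opair x b) ∈ t.

Section Given.
Context (t : M) (Ht : uniform t).

Lemma uniform_mem a x b : opair a (opair x b) ∈ t -> a ∈ th /\ x ∈ X /\ b ∈ th.
Proof.
  intro K. destruct (proj1 Ht _ K) as (a' & Ha & x' & Hx & b' & Hb & E).
  apply opair_inj in E as [-> E]. apply opair_inj in E as [-> ->]. auto.
Qed.

(** Otherwise (x, y) ↦ t_{g(x)}(y), read on flat pairs, would map X onto θ. *)
Lemma X_regular g : functional g -> (forall b, b ∈ th -> exists x, x ∈ X /\ exists a, a ∈ th /\ opair x a ∈ g /\ b ∈ a) -> False.
Proof.
  intros Fg Cg. apply (@mem_irrefl M HZF th). apply (c_thE C). split; [exact Oth|].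
  set (q := sep (prod X th) (fun p => exists x y a b, p = opair (fp x y) b /\ ((x ∈ X /\ y ∈ X) /\ (opair x a ∈ g /\ opair a (opair y b) ∈ t)))).
  assert (qE : forall p, p ∈ q <-> p ∈ prod X th /\ exists x y a b, p = opair (fp x y) b /\ ((x ∈ X /\ y ∈ X) /\ (opair x a ∈ g /\ opair a (opair y b) ∈ t)))
    by (intro; unfold q; rewrite sepE by dfn; reflexivity).
  exists q. split.
  - intros z b b' A B. apply qE in A as (_ & x & y & a & b1 & E & _ & A1 & A2), B as (_ & x' & y' & a' & b1' & E' & _ & B1 & B2).
    apply opair_inj in E as [-> ->], E' as [E' ->]. apply fp_inj in E' as [<- <-].
    rewrite (Fg _ _ _ B1 A1) in B2. destruct (uniform_mem A2) as (T1 & T2 & T3), (uniform_mem B2) as (_ & _ & T4).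
    exact (proj1 (proj2 Ht) _ T1 _ T2 _ T3 _ T4 A2 B2).
  - intros b Hb. destruct (Cg b Hb) as (x & Hx & a & Ha & K & L).
    destruct (proj2 (proj2 Ht) a Ha b L) as (y & Hy & N). exists (fp x y). assert (Hf := c_fp C Hx Hy). split; [exact Hf|].
    apply qE. split; [now apply opair_prod|]. exists x, y, a, b. auto.
Qed.

Lemma uniform_H : t ∈ H.
Proof.
  apply (mdl_sub model_uniform (x := prod th (prod X th))).
  - apply (mdl_prod model_uniform); [apply Fth|]. apply (mdl_prod model_uniform); [apply FX|apply Fth].
  - intros p Hp. destruct (proj1 Ht p Hp) as (a & Ha & x & Hx & b & Hb & ->). rewrite !opair_prod. auto.
Qed.

Lemma uniform_J : uniform (app J t).
Proof.
  exact (proj1 (elem1 (mdl_elem model_uniform) (P := uniform) ltac:(unfold uniform; dfn) uniform_H) Ht).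
Qed.

(** i acts on the ordinals in t and the decoded s acts on X; through t the action on X will
    determine i. *)
Definition carries i s t t' : Prop := forall a, a ∈ th -> forall x, x ∈ X -> forall b, b ∈ th ->
  opair a (opair x b) ∈ t -> opair (app i a) (opair (app D (opair s x)) (app i b)) ∈ t'.
Definition lifts i t t' (_ : M) : Prop := incr H th i /\ exists s, s ∈ X /\ carries i s t t'.

Lemma lifts_U : Dfn U Q (fun env => lifts (env 0) (env 1) (env 2) (env 3)).
Proof. unfold lifts, carries. apply Dfn_and; [apply (incr_U C)|]; dfn. Qed.
Lemma lifts_D (r q v : (nat -> M) -> M) : DTm r -> DTm q -> DTm v -> Dfm (fun env => lifts (r env) (q env) (v env) (v env)).
Proof.
  intros A B E. assert (DL : Dfm (fun env => lifts (env 0) (env 1) (env 2) (env 3))).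
  { unfold lifts, carries. apply Dfn_and; [apply incr_D|]; dfn. }
  exact (Dfn_pred4 DL A B E E).
Qed.

Let J_code : forall a x b t, t ∈ H -> a ∈ th -> x ∈ X -> b ∈ th -> opair a (opair x b) ∈ t ->
  opair (app Jt a) (opair (app J x) (app Jt b)) ∈ app J t.
Proof.
  clear t Ht. intros a x b t Ht Ha Hx Hb K. destruct (Jt_fn J th) as [_ E]. rewrite !E by auto.
  assert (Ua := thH C Ha). assert (Ub := thH C Hb). assert (Ux := X_H C Hx).
  assert (Up := opair_H (MD := model_uniform) Ux Ub).
  rewrite <- (J_opair (MD := model_uniform) Ux Ub), <- (J_opair (MD := model_uniform) Ua Up).
  exact (proj1 (J_mem (MD := model_uniform) (opair_H (MD := model_uniform) Ua Up) Ht) K).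
Qed.

(** The element of X that codes J serves as s; this is where coding J below an even level pays
    off. *)
Lemma lifts_J t0 : t0 ∈ H -> lifts Jt t0 (app J t0) emp.
Proof.
  intro U0. split; [exact (incr_J C)|]. destruct (c_code C) as (c & Hc & E). exists c. split; [exact Hc|].
  intros a Ha x Hx b Hb K. rewrite E by exact Hx. now apply J_code.
Qed.

(** ω is a subset of X, so such a sequence is a cofinal partial map from X. *)
Lemma no_cofinal_sequence h : isfn h omega -> (forall n, n ∈ omega -> app h n ∈ th) ->
  ~ forall x, x ∈ th -> exists n, n ∈ omega /\ x ∈ app h n.
Proof.
  intros F V Cf. apply (@X_regular h).
  - intros x y y' A B. apply (isfn_pair _ _ F) in A as [_ ->], B as [_ ->]. reflexivity.
  - intros b Hb. destruct (Cf b Hb) as (n & Hn & K). exists n. split; [now apply (c_Xom C)|].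
    exists (app h n). split; [now apply V|]. split; [now apply (isfn_pair _ _ F)|exact K].
Qed.

(* Two maps with the same code agree on arbitrarily large ordinals, where the
   values are read off from t and its image. *)
Lemma carries_unique i i' s : incr H th i -> incr H th i' -> carries i s t (app J t) -> carries i' s t (app J t) ->
  forall a, a ∈ th -> app i a = app i' a.
Proof.
  intros I I' K K' a Ha.
  (* Iterating the larger of the two values leads to an ordinal above a fixed by both maps; it stays
     below θ because no ω-sequence is cofinal in θ. *)
  set (v := fun x => cup (app i x) (app i' x)). assert (Dv : DTm (fun env => v (env 0))) by (unfold v; dfn).
  destruct (iter_ex Dv (succ a)) as (h & Hh).
  assert (vT : forall x, x ∈ th -> v x ∈ th).
  { intros x Hx. destruct I as (_ & I1 & _), I' as (_ & I1' & _). unfold v.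
    destruct (cup_max (thO C (I1 x Hx)) (thO C (I1' x Hx))) as [_ [-> | ->]]; auto. }
  destruct (iterate_closed C (th_Lim C) (fun z A => A) vT (th_sle_lim C Ha) Hh)
    as (V & _ & [Cf|(c & Tc & ac & Fc)]).
  - exfalso. exact (no_cofinal_sequence (proj1 Hh) V Cf).
  - assert (E : app i c = c) by (apply Fc; [exact I|intros x _ z Hz; apply cupE; auto]).
    assert (E' : app i' c = c) by (apply Fc; [exact I'|intros x _ z Hz; apply cupE; auto]).
    assert (ac' : a ∈ c) by (apply (Ord_trans (thO C Tc) ac), succE; auto).
    destruct (proj2 (proj2 Ht) c Tc a ac') as (x & Hx & A).
    assert (B := K c Tc x Hx a Ha A). assert (B' := K' c Tc x Hx a Ha A). rewrite E in B. rewrite E' in B'.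
    destruct uniform_J as (M1 & M2 & _).
    assert (Y : app D (opair s x) ∈ X).
    { destruct (M1 _ B) as (a1 & _ & x1 & Hx1 & b1 & _ & E1). apply opair_inj in E1 as [_ E1].
      now apply opair_inj in E1 as [-> _]. }
    exact (M2 c Tc _ Y _ (proj1 (proj2 I) a Ha) _ (proj1 (proj2 I') a Ha) B B').
Qed.

(** The code s determines i(a), so these values are the range of a partial map from X to θ, and such
    a map is not cofinal. *)
Lemma lifts_bounded a : a ∈ th -> exists b, b ∈ th /\ forall i, i ∈ H -> lifts i t (app J t) (app J t) -> subset (app i a) b.
Proof.
  intro Ha. apply NNPP. intro N.
  set (g := sep (prod X th) (fun p => exists s, s ∈ X /\ exists i, i ∈ H /\ ((incr H th i /\ carries i s t (app J t)) /\ p = opair s (app i a)))).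
  assert (gE : forall p, p ∈ g <-> p ∈ prod X th /\ exists s, s ∈ X /\ exists i, i ∈ H /\ ((incr H th i /\ carries i s t (app J t)) /\ p = opair s (app i a))).
  { intro p. unfold g. rewrite sepE; [reflexivity|]. unfold carries. repeat first [dfn1|apply incr_D]. }
  apply (@X_regular g).
  - intros x y y' A B. apply gE in A as (_ & s & _ & i & _ & [I A] & E), B as (_ & s' & _ & i' & _ & [I' B] & E').
    apply opair_inj in E as [-> ->], E' as [<- ->]. now apply carries_unique with s.
  - intros b Hb. apply NNPP. intro N'. apply N. exists b. split; [exact Hb|]. intros i Hi (I & s & Hs & A).
    assert (Ti := proj1 (proj2 I) a Ha). destruct (Ord_le_or (thO C Ti) (thO C Hb)) as [L|L]; [exact L|].
    exfalso. apply N'. exists s. split; [exact Hs|]. exists (app i a). split; [exact Ti|]. split; [|exact L].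
    apply gE. split; [now apply opair_prod|]. exists s. split; [exact Hs|]. exists i. auto.
Qed.

Theorem no_uniform : False.
Proof.
  set (v := fun a => mu th (fun b => forall i, i ∈ H -> lifts i t (app J t) (app J t) -> subset (app i a) b)).
  assert (Dv : DTm (fun env => v (env 0))).
  { unfold v, mu, subset. repeat first [dfn1|apply lifts_D]. }
  assert (vP : forall a, a ∈ th -> v a ∈ th /\ forall i, i ∈ H -> lifts i t (app J t) (app J t) -> subset (app i a) (v a)).
  { intros a Ha. destruct (@muP M HZF th (fun b => forall i, i ∈ H -> lifts i t (app J t) (app J t) -> subset (app i a) b)) as (A & B & _);
      [unfold subset; repeat first [dfn1|apply lifts_D]|exact Oth|now apply lifts_bounded|]. split; [exact A|exact B]. }
  assert (DP : Dfm (fun env => lifts (env 0) (env 1) (env 2) (env 3))).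
  { unfold lifts, carries. apply Dfn_and; [apply incr_D|]; dfn. }
  set (K := common H th lifts t (app J t) (app J t)).
  assert (KE : forall x, x ∈ K <-> x ∈ th /\ forall i, i ∈ H -> lifts i t (app J t) (app J t) -> app i x = x)
    by (intro; apply (commonE _ _ DP)).
  assert (Kb : forall a, a ∈ th -> exists c, c ∈ K /\ a ∈ c).
  { intros a Ha. destruct (iter_ex Dv a) as (h & Hh).
    destruct (iterate_closed C (th_Lim C) (fun z A => A) (fun x Hx => proj1 (vP x Hx)) Ha Hh)
      as (V & _ & [Cf|(c & Tc & ac & Fc)]).
    - exfalso. exact (no_cofinal_sequence (proj1 Hh) V Cf).
    - exists c. split; [|exact ac]. apply KE. split; [exact Tc|]. intros i Hi L. apply Fc; [apply L|].
      intros x Hx. now apply vP. }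
  assert (small : forall x, x ∈ K -> app (rk K) x ∈ k).
  { assert (Ut := uniform_H). assert (Uj := J_H (MD := model_uniform) Ut).
    apply (common_small C lifts_U DP Ut Uj Uj); [exact (lifts_J Ut)|exact (lifts_J Uj)]. }
  assert (OK : forall x, x ∈ K -> Ord x) by (intros x Hx; apply KE in Hx as [Hx _]; now apply (thO C)).
  (* κ is an image of X; composing with the enumeration of K gives a cofinal partial map from X to
     θ. *)
  destruct (proj1 (c_thE C k) (c_k C)) as [_ (E & FE & SE)].
  set (g := sep (prod X th) (fun p => exists x, x ∈ X /\ exists a, a ∈ K /\ (p = opair x a /\ opair x (app (rk K) a) ∈ E))).
  assert (gE : forall p, p ∈ g <-> p ∈ prod X th /\ exists x, x ∈ X /\ exists a, a ∈ K /\ (p = opair x a /\ opair x (app (rk K) a) ∈ E))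
    by (intro; unfold g; rewrite sepE by dfn; reflexivity).
  apply (@X_regular g).
  - intros x y y' A B. apply gE in A as (_ & x1 & _ & a & Ha & A & A'), B as (_ & x2 & _ & a' & Ha' & B & B').
    apply opair_inj in A as [-> ->], B as [<- ->]. apply (rk_inj OK Ha Ha'). exact (FE _ _ _ A' B').
  - intros b Hb. destruct (Kb b Hb) as (c & Hc & bc). destruct (SE _ (small c Hc)) as (x & Hx & L).
    exists x. split; [exact Hx|]. exists c. assert (Tc : c ∈ th) by (now apply KE in Hc). split; [exact Tc|].
    split; [|exact bc]. apply gE. split; [now apply opair_prod|]. exists x. split; [exact Hx|]. exists c. auto.
Qed.
End Given.
End Uniform.

(** * Constructing uniform surjections from an injection *)

Section FromInjection.
Context {M : SetStructure} {HZF : ZF M} (H J X th D k : M) (C : Core H J X th D k).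
Implicit Types x y z a b c u w R g m n i h t : M.
Local Notation U := (fun x => x ∈ H).
Local Notation Q := (fixed H J).
#[local] Instance model_injection : Model H J := c_mod C.
Let FX := c_X C.
Let Fth := c_th C.
Let FD := c_D C.
Let FO := fixed_om (MD := c_mod C) (c_om C).
Let Oth := c_O C.
Let Fpr : fixed H J (prod th th) := fixed_prod (MD := c_mod C) (c_th C) (c_th C).
Local Notation Jt := (Jt J th).
Context (f : M) (Hf : f ∈ H)
  (f_inj : forall a b, a ∈ th -> b ∈ th -> (forall u, u ∈ X -> u ∈ app f a <-> u ∈ app f b) -> a = b).

(* If s codes J on X, this says that b is the preimage under J of the value of g' at a. *)
Definition pulls g g' a b s : Prop := forall u, u ∈ X -> u ∈ app g b <-> app D (opair s u) ∈ app g' a.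
Definition Pull g g' : M := sep (prod th th) (fun p => exists a, a ∈ th /\ exists b, b ∈ th /\
  (p = opair a b /\ exists s, s ∈ X /\ pulls g g' a b s)).
Lemma PullE g g' a b : opair a b ∈ Pull g g' <-> a ∈ th /\ b ∈ th /\ exists s, s ∈ X /\ pulls g g' a b s.
Proof.
  unfold Pull, pulls. rewrite sepE by dfn. rewrite opair_prod. split.
  - intros [_ (a' & Ha & b' & Hb & E & A)]. apply opair_inj in E as [-> ->]. auto.
  - intros (Ha & Hb & A). split; [auto|]. exists a. split; [exact Ha|]. exists b. auto.
Qed.

(** Keeps of J the ability to locate, from a alone, a point of (c', c]; stated for arbitrary i so
    that H can quantify over such maps. *)
Definition interpolates i T : Prop := forall c, c ∈ th -> forall c', c' ∈ c -> forall a, a ∈ th ->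
  app i c' ∈ a -> a ∈ succ (app i c) -> exists b, b ∈ th /\ (opair a b ∈ T /\ (c' ∈ b /\ b ∈ succ c)).

(* The image under J of the conclusion is witnessed by a itself and the code of J. *)
Lemma J_interpolates g : g ∈ H -> interpolates Jt (Pull g (app J g)).
Proof.
  intros Hg c Hc c' Hc' a Ha A1 A2. destruct (Jt_fn J th) as [_ EJ].
  assert (Tc' := thT C Hc Hc'). rewrite EJ in A1, A2 by auto.
  destruct (c_code C) as (s & Hs & Es).
  set (S := fun env : nat -> M => exists b, b ∈ th /\ ((env 0 ∈ b /\ b ∈ succ (env 1)) /\
    exists s, s ∈ X /\ pulls (env 2) (env 3) (env 4) b s)).
  assert (DS : Dfn U Q S) by (unfold S, pulls; dfn).
  set (env := fun l : nat => match l with 0 => c' | 1 => c | 2 => g | 3 => app J g | _ => a end).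
  assert (Henv : forall l, env l ∈ H).
  { assert (Ug := J_H (MD := model_injection) Hg). assert (Uc := thH C Hc). assert (Uc' := thH C Tc'). assert (Ua := thH C Ha).
    intros [|[|[|[|l]]]]; assumption. }
  assert (K : S env).
  { apply (elem_transfer (mdl_elem model_injection) DS Henv). unfold S, env. exists a. split; [exact Ha|]. split; [auto|].
    exists s. split; [exact Hs|]. intros u Hu. rewrite Es by exact Hu.
    assert (Ug := J_H (MD := model_injection) Hg). rewrite <- (J_app (MD := model_injection) Ug (thH C Ha)).
    exact (J_mem (MD := model_injection) (X_H C Hu) (app_H (MD := model_injection) Ug (thH C Ha))). }
  destruct K as (b & Hb & K1 & K2). exists b. split; [exact Hb|]. split; [|exact K1]. apply PullE. auto.
Qed.

Definition B : M := Pull f (app J f).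

(** J(B) arises from J(f) as B arises from f, so interpolation also holds for J(B), as the second
    hypothesis of [common_small] demands. *)
Lemma JB : app J B = Pull (app J f) (app J (app J f)).
Proof.
  apply (elem_term2 (mdl_elem model_injection) (F := Pull)); [unfold Pull, pulls; dfn|exact Hf|exact (J_H (MD := model_injection) Hf)].
Qed.

Lemma B_H : B ∈ H.
Proof.
  apply (mdl_sub model_injection (proj1 Fpr)). intros p Hp. unfold B, Pull, pulls in Hp. now rewrite sepE in Hp by dfn.
Qed.

(* Properties of J expressible in H; they hold of J for the parameters B and J B. *)
Definition Emb i T a b : Prop := incr H th i /\ interpolates i T /\ app i a = b.
Lemma Emb_U : Dfn U Q (fun env => Emb (env 0) (env 1) (env 2) (env 3)).
Proof. unfold Emb, interpolates. apply Dfn_and; [apply (incr_U C)|]; dfn. Qed.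
Lemma Emb_D0 : Dfm (fun env => Emb (env 0) (env 1) (env 2) (env 3)).
Proof. unfold Emb, interpolates. apply Dfn_and; [apply incr_D|]; dfn. Qed.
Lemma Emb_D (s r q v : (nat -> M) -> M) : DTm s -> DTm r -> DTm q -> DTm v ->
  Dfm (fun env => Emb (s env) (r env) (q env) (v env)).
Proof. apply Dfn_pred4. exact Emb_D0. Qed.

Definition near a : M := sep th (fun b => opair a b ∈ B).
Lemma near_D (s : (nat -> M) -> M) : DTm s -> DTm (fun env => near (s env)).
Proof. apply (DT_fun1 (F := near)). unfold near. dfn. Qed.
Lemma nearE a b : b ∈ near a <-> b ∈ th /\ opair a b ∈ B.
Proof. unfold near. rewrite sepE by dfn. reflexivity. Qed.
Lemma near_Ord a b : b ∈ near a -> Ord b.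
Proof. intro Hb. apply nearE in Hb as [Hb _]. exact (thO C Hb). Qed.
Ltac dfe := repeat first [dfn1 | apply Emb_D | apply near_D].

(** By injectivity of f, an x in X pulls back the value at a to f(b) for at most one b; sending x to
    the rank of b maps X onto the order type of the section. For c the first section of order type
    at least c is used. *)
Lemma uniform_unbounded :
  (forall c, c ∈ th -> exists a, a ∈ th /\ forall y, y ∈ c -> exists b, b ∈ near a /\ app (rk (near a)) b = y) ->
  exists t, uniform X th t.
Proof.
  intro A. set (S := fun c a => forall y, y ∈ c -> exists b, b ∈ near a /\ app (rk (near a)) b = y).
  set (q := fun c => mu th (fun a => S c a)).
  assert (qP : forall c, c ∈ th -> q c ∈ th /\ S c (q c)).
  { intros c Hc. destruct (@muP M HZF th (fun a => S c a)) as (A1 & A2 & _); [unfold S; dfe|exact Oth|now apply A|]. auto. }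
  assert (qD : forall s, DTm s -> DTm (fun env => q (s env))).
  { intros s. apply (DT_fun1 (F := q)). unfold q, mu, S. dfe. }
  set (T := fun c x y => y ∈ c /\ exists b, b ∈ near (q c) /\ (pulls f (app J f) (q c) b x /\ app (rk (near (q c))) b = y)).
  set (t := sep (prod th (prod X th)) (fun p => exists c, c ∈ th /\ exists x, x ∈ X /\ exists y, y ∈ th /\ (p = opair c (opair x y) /\ T c x y))).
  assert (tE : forall p, p ∈ t <-> p ∈ prod th (prod X th) /\ exists c, c ∈ th /\ exists x, x ∈ X /\ exists y, y ∈ th /\ (p = opair c (opair x y) /\ T c x y)).
  { intro p. unfold t, T, pulls. rewrite sepE; [reflexivity|]. repeat first [dfn1 | apply qD | apply near_D]. }
  exists t. split; [|split].
  - intros p Hp. apply tE in Hp as (_ & c & Hc & x & Hx & y & Hy & -> & _). exists c. split; [exact Hc|]. exists x. split; [exact Hx|]. eauto.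
  - intros a Ha x Hx b Hb b' Hb' K K'. apply tE in K as (_ & c & _ & x1 & _ & y & _ & E & K), K' as (_ & c' & _ & x1' & _ & y' & _ & E' & K').
    apply opair_inj in E as [<- E], E' as [<- E']. apply opair_inj in E as [<- <-], E' as [<- <-].
    destruct K as (_ & d & Hd & P & <-), K' as (_ & d' & Hd' & P' & <-). f_equal. apply nearE in Hd as [Hd _], Hd' as [Hd' _].
    apply f_inj; auto. intros u Hu. rewrite (P u Hu). symmetry. exact (P' u Hu).
  - intros a Ha b Hb. destruct (qP a Ha) as [Tq Sq]. destruct (Sq b Hb) as (d & Hd & E).
    assert (Hd' := Hd). apply nearE in Hd' as [Td Bd]. apply PullE in Bd as (_ & _ & x & Hx & P).
    assert (Tb := thT C Ha Hb). exists x. split; [exact Hx|]. apply tE. rewrite !opair_prod. split; [auto|].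
    exists a. split; [exact Ha|]. exists x. split; [exact Hx|]. exists b. split; [exact Tb|]. split; [reflexivity|].
    split; [exact Hb|]. exists d. auto.
Qed.

(** * Definable cofinal maps when the sections of B have bounded order type *)

Section Bounded.
Context (l0 L E : M) (Hl0 : forall a, a ∈ th -> forall b, b ∈ near a -> app (rk (near a)) b ∈ l0)
  (HL : L ∈ th) (L0 : succ l0 ∈ L) (Lk : k ∈ L) (Lom : omega ∈ L)
  (FE : functional E) (SE : forall y, y ∈ L -> exists x, x ∈ X /\ opair x y ∈ E).
Let OL := thO C HL.

Definition bounds a c y : Prop := forall i, i ∈ H -> Emb i B a (app J a) -> app i c ∈ y.
Definition least_bound b a c : M := mu b (fun y => bounds a c y).
Definition orbit b a c : M := eps (fun h => is_iter (least_bound b a) c h).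
Definition stable a : M := common H th Emb B a (app J a).
(** A nonzero g is then an element or a limit point of each section of B with index from a on below
    b. *)
Definition fills b g a : Prop := forall a', a' ∈ b -> subset a a' -> forall c', c' ∈ g ->
  exists y, y ∈ th /\ (opair a' y ∈ B /\ (c' ∈ y /\ y ∈ succ g)).
Definition filled b : M := sep b (fun g => exists a, a ∈ b /\ fills b g a).
Definition fill_start b g : M := mu b (fun a => fills b g a).

Lemma bounds_D (s r q : (nat -> M) -> M) : DTm s -> DTm r -> DTm q -> Dfm (fun env => bounds (s env) (r env) (q env)).
Proof. apply (Dfn_pred3 (P := bounds)). unfold bounds. dfe. Qed.
Lemma least_bound_D (s r q : (nat -> M) -> M) : DTm s -> DTm r -> DTm q -> DTm (fun env => least_bound (s env) (r env) (q env)).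
Proof. apply (DT_fun3 (F := least_bound)). unfold least_bound, mu. repeat first [dfn1 | apply bounds_D]. Qed.
Lemma orbit_D (s r q : (nat -> M) -> M) : DTm s -> DTm r -> DTm q -> DTm (fun env => orbit (s env) (r env) (q env)).
Proof.
  apply (DT_fun3 (F := orbit)). unfold orbit.
  apply (DTm_eps (P := fun h env => is_iter (least_bound (env 0) (env 1)) (env 2) h)).
  - unfold is_iter. repeat first [dfn1 | apply least_bound_D].
  - intros env h h'. apply iter_unique.
Qed.
Lemma stable_D (s : (nat -> M) -> M) : DTm s -> DTm (fun env => stable (s env)).
Proof. intro A. apply common_D; [exact Emb_D0|dfn|exact A|]. exact (DT_app (DT_cst (I : everything J) (I : everything J)) A). Qed.
Lemma fills_D (s r q : (nat -> M) -> M) : DTm s -> DTm r -> DTm q -> Dfm (fun env => fills (s env) (r env) (q env)).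
Proof. apply (Dfn_pred3 (P := fills)). unfold fills. dfe. Qed.
Lemma filled_D (s : (nat -> M) -> M) : DTm s -> DTm (fun env => filled (s env)).
Proof. apply (DT_fun1 (F := filled)). unfold filled. repeat first [dfn1 | apply fills_D]. Qed.
Lemma fill_start_D (s r : (nat -> M) -> M) : DTm s -> DTm r -> DTm (fun env => fill_start (s env) (r env)).
Proof. apply (DT_fun2 (F := fill_start)). unfold fill_start, mu. repeat first [dfn1 | apply fills_D]. Qed.
Ltac dfb := repeat first [dfn1 | apply Emb_D | apply near_D | apply bounds_D | apply least_bound_D | apply orbit_D
  | apply stable_D | apply fills_D | apply filled_D | apply fill_start_D].

(* Without choice, the cofinal map into b must be definable from b: it is the first
   good one among these, ordered by the parameters n, a, c. *)
Definition candidate b n a c : M := sep (prod b b) (fun p =>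
  n = num 0 /\ p ∈ orbit b a c \/
  n = num 1 /\ (exists x, x ∈ stable a /\ p = opair (app (rk (stable a)) x) x) \/
  n = num 2 /\ (exists x, x ∈ c /\ p = opair x (least_bound b a x)) \/
  n = num 3 /\ (exists g, g ∈ filled b /\ (p = opair (app (rk (filled b)) g) g /\ app (rk (filled b)) g ∈ L)) \/
  n = num 4 /\ (exists g, g ∈ filled b /\ (p = opair (app (rk (filled b)) g) (fill_start b g) /\ app (rk (filled b)) g ∈ L)) \/
  n = num 5 /\ p = opair emp c).
Definition cofinal b h z : Prop := (forall x y, opair x y ∈ h -> x ∈ z) /\ functional h /\
  forall x, x ∈ b -> exists u y, opair u y ∈ h /\ subset x y.

Lemma candidate_D (s r q v : (nat -> M) -> M) : DTm s -> DTm r -> DTm q -> DTm v ->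
  DTm (fun env => candidate (s env) (r env) (q env) (v env)).
Proof.
  assert (A : DTm (fun env => candidate (env 0) (env 1) (env 2) (env 3))).
  { unfold candidate. repeat first [dfn1 | apply Emb_D | apply near_D | apply bounds_D | apply least_bound_D | apply orbit_D
  | apply stable_D | apply fills_D | apply filled_D | apply fill_start_D | apply prod_DT]. }
  intros A1 A2 A3 A4. destruct A as [_ A]. split; [intros; exact I|].
  apply (Dfn_pred5 (P := fun z s r q v => z = candidate s r q v) A); [dfn|..].
  - exact (DT_rename S A1).
  - exact (DT_rename S A2).
  - exact (DT_rename S A3).
  - exact (DT_rename S A4).
Qed.
Lemma cofinal_D (s r q : (nat -> M) -> M) : DTm s -> DTm r -> DTm q -> Dfm (fun env => cofinal (s env) (r env) (q env)).
Proof. apply (Dfn_pred3 (P := cofinal)). unfold cofinal, functional. dfn. Qed.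

Lemma candidateE b n a c p : p ∈ candidate b n a c <-> p ∈ prod b b /\
  (n = num 0 /\ p ∈ orbit b a c \/
  n = num 1 /\ (exists x, x ∈ stable a /\ p = opair (app (rk (stable a)) x) x) \/
  n = num 2 /\ (exists x, x ∈ c /\ p = opair x (least_bound b a x)) \/
  n = num 3 /\ (exists g, g ∈ filled b /\ (p = opair (app (rk (filled b)) g) g /\ app (rk (filled b)) g ∈ L)) \/
  n = num 4 /\ (exists g, g ∈ filled b /\ (p = opair (app (rk (filled b)) g) (fill_start b g) /\ app (rk (filled b)) g ∈ L)) \/
  n = num 5 /\ p = opair emp c).
Proof. unfold candidate. rewrite sepE; [reflexivity|dfb]. Qed.

Ltac select K := let E' := fresh "E" in
  destruct K as [_ K]; repeat (destruct K as [[E' K]|K]; [first [apply num_inj in E'; discriminate | clear E']|]);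
  try (let E' := fresh "E" in destruct K as [E' K]; first [apply num_inj in E'; discriminate | clear E']).

Definition reaches b : Prop := exists n, n ∈ omega /\ exists a, a ∈ th /\ exists c, c ∈ th /\ exists z, z ∈ b /\
  cofinal b (candidate b n a c) z.

Section AtLimit.
Context (b : M) (Tb : b ∈ th) (Lb : Lim b) (bL : L ∈ b) (bJ : forall c, c ∈ b -> app J c ∈ b).
Let Ob := thO C Tb.
Let inb x : x ∈ b -> x ∈ th := thT C Tb (b := x).

Lemma least_boundP a c : (exists y, y ∈ b /\ bounds a c y) -> least_bound b a c ∈ b /\ bounds a c (least_bound b a c).
Proof.
  intro Ex. destruct (@muP M HZF b (fun y => bounds a c y)) as (A1 & A2 & _); [dfb|exact Ob|exact Ex|]. auto.
Qed.

(** If some orbit of the least bounds is unbounded in b, it is a cofinal ω-sequence. Otherwise the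
    suprema of orbits are common fixed points; they are unbounded in b, and the common fixed points
    have order type at most κ, which is below b. *)
Lemma reaches_by_iteration a : a ∈ th -> (forall c, c ∈ b -> exists y, y ∈ b /\ bounds a c y) -> reaches b.
Proof.
  intros Ha A. assert (vT : forall x, x ∈ b -> least_bound b a x ∈ b) by (intros x Hx; now apply least_boundP, A).
  assert (Dv : DTm (fun env => least_bound b a (env 0))) by dfb.
  assert (Orb : forall c, is_iter (least_bound b a) c (orbit b a c)) by (intro c; exact (epsP (iter_ex Dv c))).
  destruct (classic (exists c, c ∈ b /\ forall x, x ∈ b -> exists n, n ∈ omega /\ x ∈ app (orbit b a c) n)) as [(c & Hc & Cf)|N].
  - exists (num 0). split; [apply num_omega|]. exists a. split; [exact Ha|]. exists c. split; [now apply inb|].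
    exists omega. split; [exact (Ord_trans Ob bL Lom)|].
    destruct (iterate_closed C Lb inb vT Hc (Orb c)) as (V & _ & _).
    assert (F := proj1 (Orb c)).
    split; [|split].
    + intros x y K. apply candidateE in K. select K. now apply (isfn_pair _ _ F) in K as [K _].
    + intros x y y' K K'. apply candidateE in K, K'. select K. select K'.
      apply (isfn_pair _ _ F) in K as [_ ->], K' as [_ ->]. reflexivity.
    + intros x Hx. destruct (Cf x Hx) as (n & Hn & L'). exists n, (app (orbit b a c) n). split.
      * apply candidateE. split; [|left; split; [reflexivity|now apply (isfn_pair _ _ F)]].
        apply opair_prod. split; [exact (Ord_trans Ob (Ord_trans Ob bL Lom) Hn)|now apply V].
      * apply Ord_sub; [exact (Ord_elem Ob (V n Hn))|exact L'].
  - exists (num 1). split; [apply num_omega|]. exists a. split; [exact Ha|]. exists emp. split; [exact (th_emp C)|].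
    exists k. split; [exact (Ord_trans Ob bL Lk)|].
    assert (KE : forall x, x ∈ stable a <-> x ∈ th /\ forall i, i ∈ H -> Emb i B a (app J a) -> app i x = x)
      by (intro; apply (commonE _ _ Emb_D0)).
    assert (Ua := thH C Ha). assert (UJ := J_H (MD := model_injection) Ua).
    assert (Sm : forall x, x ∈ stable a -> app (rk (stable a)) x ∈ k).
    { destruct (Jt_fn J th) as [_ EJ]. apply (common_small C Emb_U Emb_D0 B_H Ua UJ).
      - split; [exact (incr_J C)|]. split; [now apply J_interpolates|now apply EJ].
      - split; [exact (incr_J C)|]. split; [rewrite JB; apply J_interpolates; now apply (J_H (MD := model_injection))|].
        apply EJ. now apply (J_th C). }
    assert (OK : forall x, x ∈ stable a -> Ord x) by (intros x Hx; apply KE in Hx as [Hx _]; exact (thO C Hx)).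
    split; [|split].
    + intros x y K. apply candidateE in K. select K. destruct K as (u & Hu & K). apply opair_inj in K as [-> ->]. auto.
    + intros x y y' K K'. apply candidateE in K, K'. select K. select K'.
      destruct K as (u & Hu & K), K' as (u' & Hu' & K'). apply opair_inj in K as [-> ->], K' as [K' ->].
      exact (rk_inj OK Hu Hu' K').
    + intros x Hx. destruct (iterate_closed C Lb inb vT Hx (Orb x)) as (V & _ & [Cf|(c & Hc & xc & Fc)]).
      { destruct N. eauto. }
      assert (Kc : c ∈ stable a).
      { apply KE. split; [now apply inb|]. intros i Hi Em. apply Fc; [apply Em|]. intros y Hy.
        destruct (least_boundP (A y Hy)) as [V1 V2]. apply Ord_sub; [exact (Ord_elem Ob V1)|]. now apply V2. }
      exists (app (rk (stable a)) c), c. split.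
      * apply candidateE. split; [apply opair_prod; split; [|exact Hc]|right; left; split; [reflexivity|eauto]].
        exact (Ord_trans Ob (Ord_trans Ob bL Lk) (Sm c Kc)).
      * apply Ord_sub; [exact (OK c Kc)|exact xc].
Qed.

Lemma filledE g : g ∈ filled b <-> g ∈ b /\ exists a, a ∈ b /\ fills b g a.
Proof. unfold filled. rewrite sepE; [reflexivity|dfb]. Qed.

(** The values at c are unbounded in b, those at each x < c are bounded. Either the least bounds for
    x < c are already cofinal, or from their supremum on each a' lies in (i(x), i(c)] for one i and
    all x < c, and interpolation makes c filled. *)
Lemma reaches_by_bounds a c : a ∈ b -> c ∈ b -> (forall y, y ∈ b -> ~ bounds a c y) ->
  (forall x, x ∈ c -> exists y, y ∈ b /\ bounds a x y) -> reaches b \/ (c ∈ filled b /\ a ∈ c).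
Proof.
  intros Ha Hc N A.
  assert (V : forall x, x ∈ c -> least_bound b a x ∈ b /\ bounds a x (least_bound b a x)) by (intros; now apply least_boundP, A).
  destruct (classic (forall x, x ∈ b -> exists u, u ∈ c /\ subset x (least_bound b a u))) as [Cf|Nc]; [left|right].
  - exists (num 2). split; [apply num_omega|]. exists a. split; [now apply inb|]. exists c. split; [now apply inb|].
    exists c. split; [exact Hc|]. split; [|split].
    + intros x y K. apply candidateE in K. select K. destruct K as (u & Hu & K). apply opair_inj in K as [-> ->]. auto.
    + intros x y y' K K'. apply candidateE in K, K'. select K. select K'.
      destruct K as (u & Hu & K), K' as (u' & Hu' & K'). apply opair_inj in K as [-> ->], K' as [-> ->]. reflexivity.
    + intros x Hx. destruct (Cf x Hx) as (u & Hu & S). exists u, (least_bound b a u). split; [|exact S].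
      apply candidateE. split; [|right; right; left; split; [reflexivity|eauto]].
      apply opair_prod. split; [exact (Ord_trans Ob Hc Hu)|now apply V].
  - assert (Nc' : exists y, y ∈ b /\ forall x, x ∈ c -> least_bound b a x ∈ y).
    { apply NNPP. intro N'. apply Nc. intros x Hx. apply NNPP. intro N2. apply N'. exists x. split; [exact Hx|].
      intros u Hu. apply NNPP. intro N3. apply N2. exists u. split; [exact Hu|].
      destruct (Ord_le_or (Ord_elem Ob Hx) (Ord_elem Ob (proj1 (V u Hu)))) as [S|S]; [exact S|contradiction]. }
    destruct Nc' as (y0 & Hy0 & Ny). split.
    + apply filledE. split; [exact Hc|]. exists y0. split; [exact Hy0|]. intros a' Ha' S x Hx.
      (* a' + 1 is not a bound at c, so some i satisfies i(c) > a'. *)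
      assert (N1 := N (succ a') (proj2 (proj2 Lb) a' Ha')). apply not_all_ex_not in N1 as [i N1].
      apply imply_to_and in N1 as [Hi N1]. apply imply_to_and in N1 as [Em N1].
      assert (Ti := proj1 (proj2 (proj1 Em)) c (inb Hc)).
      apply (proj1 (proj2 Em)); [now apply inb|exact Hx|now apply inb| |].
      * apply S. apply (Ord_trans (Ord_elem Ob Hy0) (Ny x Hx)). now apply (proj2 (V x Hx)).
      * apply succE. destruct (Ord_trich (Ord_elem Ob Ha') (thO C Ti)) as [K|[K|K]]; [auto|auto|].
        destruct N1. apply succE. auto.
    (* If c ≤ a, then i(c) ≤ i(a) = J(a) < b for all these maps, which would bound the values at
       c. *)
    + destruct (Ord_le_or (Ord_elem Ob Hc) (Ord_elem Ob Ha)) as [S|S]; [exfalso|exact S].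
      assert (HJ := bJ Ha). apply (N (succ (app J a))); [now apply Lb|]. intros i Hi Em.
      assert (Sub := incr_le C (proj1 Em) (inb Hc) (inb Ha) S). rewrite (proj2 (proj2 Em)) in Sub.
      apply succE. apply Ord_subset; [|exact (Ord_elem Ob HJ)|exact Sub].
      exact (thO C (proj1 (proj2 (proj1 Em)) c (inb Hc))).
Qed.

(* If the first L stages were all filled from a common point on, the elements
   near a late point would have order type above l0. *)
Lemma reaches_by_filling : (forall x, x ∈ b -> exists g, g ∈ filled b /\ x ∈ g) -> reaches b.
Proof.
  intro A. set (W := filled b). assert (WE : forall g, g ∈ W <-> g ∈ b /\ exists a, a ∈ b /\ fills b g a) by (intro; apply filledE).
  assert (OW : forall g, g ∈ W -> Ord g) by (intros g Hg; apply WE in Hg as [Hg _]; exact (Ord_elem Ob Hg)).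
  assert (mP : forall g, g ∈ W -> fill_start b g ∈ b /\ fills b g (fill_start b g)).
  { intros g Hg. apply WE in Hg as [_ Ex]. destruct (@muP M HZF b (fun a => fills b g a)) as (A1 & A2 & _); [dfb|exact Ob|exact Ex|]. auto. }
  destruct (classic (forall x, x ∈ b -> exists g, g ∈ W /\ (app (rk W) g ∈ L /\ subset x g))) as [Cf|Nc].
  - exists (num 3). split; [apply num_omega|]. exists emp. split; [exact (th_emp C)|]. exists emp. split; [exact (th_emp C)|].
    exists L. split; [exact bL|]. split; [|split].
    + intros x y K. apply candidateE in K. select K. destruct K as (u & Hu & K & K2). apply opair_inj in K as [-> ->]. auto.
    + intros x y y' K K'. apply candidateE in K, K'. select K. select K'.
      destruct K as (u & Hu & K & _), K' as (u' & Hu' & K' & _). apply opair_inj in K as [-> ->], K' as [K' ->].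
      exact (rk_inj OW Hu Hu' K').
    + intros x Hx. destruct (Cf x Hx) as (g & Hg & K & S). exists (app (rk W) g), g. split; [|exact S].
      apply candidateE. split; [|right; right; right; left; split; [reflexivity|eauto]].
      apply opair_prod. split; [exact (Ord_trans Ob bL K)|now apply WE].
  - assert (Full : forall r, r ∈ L -> exists g, g ∈ W /\ app (rk W) g = r).
    { intros r Hr. apply not_all_ex_not in Nc as [x Nc]. apply imply_to_and in Nc as [Hx Nc].
      destruct (A x Hx) as (g & Hg & xg).
      assert (N1 : app (rk W) g ∉ L).
      { intro K. apply Nc. exists g. split; [exact Hg|]. split; [exact K|]. apply Ord_sub; [now apply OW|exact xg]. }
      assert (S : r ∈ app (rk W) g).
      { destruct (Ord_le_or OL (rk_Ord OW Hg)) as [S|S]; [now apply S|contradiction]. }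
      destruct (rk_initial Hg S) as (g' & Hg' & _ & Eg). eauto. }
    exists (num 4). split; [apply num_omega|]. exists emp. split; [exact (th_emp C)|]. exists emp. split; [exact (th_emp C)|].
    exists L. split; [exact bL|]. split; [|split].
    + intros x y K. apply candidateE in K. select K. destruct K as (u & Hu & K & K2). apply opair_inj in K as [-> ->]. auto.
    + intros x y y' K K'. apply candidateE in K, K'. select K. select K'.
      destruct K as (u & Hu & K & _), K' as (u' & Hu' & K' & _). apply opair_inj in K as [-> ->], K' as [K' ->].
      f_equal. exact (rk_inj OW Hu Hu' K').
    + intros x Hx. apply NNPP. intro N.
      assert (mx : forall g, g ∈ W -> app (rk W) g ∈ L -> fill_start b g ∈ x).
      { intros g Hg Lg. destruct (Ord_le_or (Ord_elem Ob Hx) (Ord_elem Ob (proj1 (mP g Hg)))) as [S|S]; [|exact S].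
        destruct N. exists (app (rk W) g), (fill_start b g). split; [|exact S].
        apply candidateE. split; [|do 4 right; left; split; [reflexivity|eauto]].
        apply opair_prod. split; [exact (Ord_trans Ob bL Lg)|now apply mP]. }
      assert (fx : forall g c', g ∈ W -> app (rk W) g ∈ L -> c' ∈ g -> exists y, y ∈ near x /\ (c' ∈ y /\ y ∈ succ g)).
      { intros g c' Hg Lg Hc'. destruct (proj2 (mP g Hg) x Hx) with (c' := c') as (y & Ty & By & K); [|exact Hc'|].
        - apply Ord_sub; [exact (Ord_elem Ob Hx)|now apply mx].
        - exists y. split; [now apply nearE|exact K]. }
      (* For filled g' < g among the first L, the section at x has an element in (g', g]. By
         induction, any y > g in the section has there at least the rank that g has in W. *)
      assert (cl : forall g, Ord g -> g ∈ W -> app (rk W) g ∈ L -> forall y, y ∈ near x -> g ∈ y ->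
        subset (app (rk W) g) (app (rk (near x)) y)).
      { apply (ord_ind (P := fun g => g ∈ W -> app (rk W) g ∈ L -> forall y, y ∈ near x -> g ∈ y ->
          subset (app (rk W) g) (app (rk (near x)) y))); [unfold subset, W; dfb|].
        intros g Og IH Hg Lg y Hy gy z Hz. destruct (rk_initial Hg Hz) as (g' & Hg' & g'g & <-).
        destruct (fx g g' Hg Lg g'g) as (y' & Hy' & g'y' & y'g).
        assert (Lg' := Ord_trans OL Lg Hz).
        assert (Oy := near_Ord Hy).
        assert (yy : y' ∈ y) by (apply succE in y'g as [y'g| ->]; [exact (Ord_trans Oy gy y'g)|exact gy]).
        assert (ON : forall u, u ∈ near x -> Ord u) by (intros u; apply near_Ord).
        apply (Ord_sub_mem (rk_Ord OW Hg') (rk_Ord ON Hy') (rk_Ord ON Hy)); [|now apply rk_mono].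
        apply IH; auto. }
      (* Between the filled points of ranks l0 and l0 + 1 lies an element of the section whose rank
         is at least l0; this is why L exceeds l0 + 1. *)
      destruct (Full l0) as (g1 & Hg1 & E1); [apply (Ord_trans OL L0), succE; auto|].
      destruct (Full (succ l0) L0) as (g2 & Hg2 & E2).
      assert (Ol0 : Ord (succ l0)) by exact (Ord_elem OL L0).
      assert (g12 : g1 ∈ g2).
      { assert (K : l0 ∈ app (rk W) g2) by (rewrite E2; apply succE; auto).
        destruct (rk_initial Hg2 K) as (g & Hg & gg2 & Eg). rewrite <- E1 in Eg. now apply (rk_inj OW Hg Hg1) in Eg as <-. }
      destruct (fx g2 g1 Hg2) as (y & Hy & g1y & _); [now rewrite E2|exact g12|].
      assert (K := cl g1 (OW g1 Hg1) Hg1). rewrite E1 in K.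
      assert (Ll0 : l0 ∈ L) by (apply (Ord_trans OL L0), succE; auto).
      apply (@mem_irrefl M HZF (app (rk (near x)) y)). apply (K Ll0 y Hy g1y). apply Hl0; [now apply inb|exact Hy].
Qed.

(** Each a < b yields a cofinal map at once or a filled point above a; if only the latter happens,
    the filled points are unbounded in b. *)
Lemma reaches_limit : reaches b.
Proof.
  apply NNPP. intro N. apply N. apply reaches_by_filling. intros a Ha.
  destruct (classic (forall c, c ∈ b -> exists y, y ∈ b /\ bounds a c y)) as [T|T].
  - destruct N. exact (reaches_by_iteration (inb Ha) T).
  - destruct (@Ord_min M HZF (fun c => c ∈ b /\ forall y, y ∈ b -> ~ bounds a c y)) as (c & Oc & [Hc Nb] & Min).
    + dfb.
    + apply not_all_ex_not in T as [c T]. apply imply_to_and in T as [Hc T]. exists c. split; [exact (Ord_elem Ob Hc)|].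
      split; [exact Hc|]. intros y Hy K. apply T. eauto.
    + destruct (reaches_by_bounds Ha Hc Nb) as [R|[R1 R2]]; [|contradiction|eauto].
      intros x Hx. apply NNPP. intro K. apply (Min x Hx). split; [exact (Ord_trans Ob Hc Hx)|]. intros y Hy L'. apply K. eauto.
Qed.
End AtLimit.

Definition first_index b : M := mu omega (fun n => exists a, a ∈ th /\ exists c, c ∈ th /\ exists z, z ∈ b /\ cofinal b (candidate b n a c) z).
Definition second_index b : M := mu th (fun a => exists c, c ∈ th /\ exists z, z ∈ b /\ cofinal b (candidate b (first_index b) a c) z).
Definition third_index b : M := mu th (fun c => exists z, z ∈ b /\ cofinal b (candidate b (first_index b) (second_index b) c) z).
Definition chosen b : M := candidate b (first_index b) (second_index b) (third_index b).
Definition domain b : M := mu b (fun z => cofinal b (chosen b) z).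

Lemma first_D (s : (nat -> M) -> M) : DTm s -> DTm (fun env => first_index (s env)).
Proof. apply (DT_fun1 (F := first_index)). unfold first_index, mu. repeat first [dfn1 | apply candidate_D | apply cofinal_D]. Qed.
Lemma second_D (s : (nat -> M) -> M) : DTm s -> DTm (fun env => second_index (s env)).
Proof. apply (DT_fun1 (F := second_index)). unfold second_index, mu. repeat first [dfn1 | apply candidate_D | apply cofinal_D | apply first_D]. Qed.
Lemma third_D (s : (nat -> M) -> M) : DTm s -> DTm (fun env => third_index (s env)).
Proof. apply (DT_fun1 (F := third_index)). unfold third_index, mu. repeat first [dfn1 | apply candidate_D | apply cofinal_D | apply first_D | apply second_D]. Qed.
Lemma chosen_D (s : (nat -> M) -> M) : DTm s -> DTm (fun env => chosen (s env)).
Proof. intro A. unfold chosen. apply candidate_D; [exact A|now apply first_D|now apply second_D|now apply third_D]. Qed.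
Lemma domain_D (s : (nat -> M) -> M) : DTm s -> DTm (fun env => domain (s env)).
Proof. apply (DT_fun1 (F := domain)). unfold domain, mu. repeat first [dfn1 | apply cofinal_D | apply chosen_D]. Qed.
Ltac dfc := repeat first [dfn1 | lazymatch goal with
  | |- DT _ _ (fun env => prod (@?a env) (@?b env)) => apply prod_DT
  | |- DT _ _ (fun env => candidate (@?a env) (@?b env) (@?c env) (@?d env)) => apply candidate_D
  | |- Dfn _ _ (fun env => cofinal (@?a env) (@?b env) (@?c env)) => apply cofinal_D
  | |- DT _ _ (fun env => first_index (@?a env)) => apply first_D
  | |- DT _ _ (fun env => second_index (@?a env)) => apply second_D
  | |- DT _ _ (fun env => chosen (@?a env)) => apply chosen_D
  | |- DT _ _ (fun env => domain (@?a env)) => apply domain_D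
  end].

Lemma chosenP b : Ord b -> reaches b -> domain b ∈ b /\ cofinal b (chosen b) (domain b).
Proof.
  intros Ob R.
  destruct (@muP M HZF omega (fun n => exists a, a ∈ th /\ exists c, c ∈ th /\ exists z, z ∈ b /\ cofinal b (candidate b n a c) z))
    as (_ & R1 & _); [dfc|exact Ord_omega|exact R|]. fold (first_index b) in R1.
  destruct (@muP M HZF th (fun a => exists c, c ∈ th /\ exists z, z ∈ b /\ cofinal b (candidate b (first_index b) a c) z))
    as (_ & R2 & _); [dfc|exact Oth|exact R1|]. fold (second_index b) in R2.
  destruct (@muP M HZF th (fun c => exists z, z ∈ b /\ cofinal b (candidate b (first_index b) (second_index b) c) z))
    as (_ & R3 & _); [dfc|exact Oth|exact R2|]. fold (third_index b) in R3.
  destruct (@muP M HZF b (fun z => cofinal b (chosen b) z)) as (A1 & A2 & _); [dfc|exact Ob|exact R3|]. auto.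
Qed.

(** * The recursion that builds the uniform sequence *)

Definition flat r u : M := sep (prod th (prod X th)) (fun q => exists z, z ∈ u /\ exists p, q = opair z p /\ p ∈ app r z).
(** The least c < b with J(c) ≥ b: the image under J of the sections up to c has a section at b. *)
Definition overtake b : M := mu th (fun c => c ∈ b /\ app J c ∉ b).
(* plus s a maps part of X onto a + 1 if s does so onto a *)
Definition plus (s a x c : M) : Prop := (exists y, x = fp y emp /\ opair y c ∈ s) \/ (x = fp emp (sing emp) /\ c = a).
Definition Jclosed b : Prop := forall c, c ∈ b -> app J c ∈ b.
(** Up to L the fixed map [E] serves. If J leads from below b to b or beyond, the section comes from
    the image of earlier stages. Otherwise a flat pair is decoded: x finds an index u of the chosen
    cofinal map, and y an ordinal at most its value a. *)
Definition stage b r : M := sep (prod X th) (fun p =>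
  subset b L /\ (exists x y, p = opair x y /\ (y ∈ b /\ p ∈ E)) \/
  ~ subset b L /\ ((~ Jclosed b /\ opair b p ∈ app J (flat r (succ (overtake b)))) \/
    (Jclosed b /\ exists x y u a c, p = opair (fp x y) c /\ (opair x u ∈ app r (domain b) /\ (opair u a ∈ chosen b /\ plus (app r a) a y c))))).

Lemma flat_D (s r : (nat -> M) -> M) : DTm s -> DTm r -> DTm (fun env => flat (s env) (r env)).
Proof. apply (DT_fun2 (F := flat)). unfold flat. dfc. Qed.
Lemma overtake_D (s : (nat -> M) -> M) : DTm s -> DTm (fun env => overtake (s env)).
Proof. apply (DT_fun1 (F := overtake)). unfold overtake, mu. dfc. Qed.
Ltac dfs := repeat first [progress dfc | lazymatch goal with
  | |- DT _ _ (fun env => flat (@?a env) (@?b env)) => apply flat_D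
  | |- DT _ _ (fun env => overtake (@?a env)) => apply overtake_D
  end].
Lemma stage_D : DTm (fun env => stage (env 0) (env 1)).
Proof. unfold stage, plus, Jclosed. dfs. Qed.
Lemma stageE b r p : p ∈ stage b r <-> p ∈ prod X th /\ (
  subset b L /\ (exists x y, p = opair x y /\ (y ∈ b /\ p ∈ E)) \/
  ~ subset b L /\ ((~ Jclosed b /\ opair b p ∈ app J (flat r (succ (overtake b)))) \/
    (Jclosed b /\ exists x y u a c, p = opair (fp x y) c /\ (opair x u ∈ app r (domain b) /\ (opair u a ∈ chosen b /\ plus (app r a) a y c))))).
Proof.
  unfold stage, plus, Jclosed. rewrite sepE; [reflexivity|dfs].
Qed.
Lemma flatE r u z p : opair z p ∈ flat r u <-> (z ∈ th /\ p ∈ prod X th) /\ z ∈ u /\ p ∈ app r z.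
Proof.
  unfold flat. rewrite sepE by dfn. rewrite opair_prod. split; intros [A B0]; (split; [exact A|]).
  - destruct B0 as (z' & Hz & p' & E' & Hp). apply opair_inj in E' as [-> ->]. auto.
  - exists z. split; [apply B0|]. exists p. split; [reflexivity|apply B0].
Qed.

Definition covers (s b : M) : Prop := (forall x c c', opair x c ∈ s -> opair x c' ∈ s -> c = c') /\
  forall c, c ∈ b -> exists x, x ∈ X /\ opair x c ∈ s.

(* The restriction of covers to the relation t, expressible in H. *)
Definition covers_upto c t : Prop := forall z, z ∈ succ c ->
  (forall x, x ∈ X -> forall b, b ∈ th -> forall b', b' ∈ th -> opair z (opair x b) ∈ t -> opair z (opair x b') ∈ t -> b = b') /\
  forall b, b ∈ z -> exists x, x ∈ X /\ opair z (opair x b) ∈ t.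

(** In the composed case each c < b is at most some value a of the cofinal map, so [plus] at a meets
    it. In the case of the image under J, covering up to [c1] transfers to covering up to J([c1]),
    which is at least b. *)
Lemma covers_stage b r : b ∈ th -> (forall z, z ∈ b -> subset (app r z) (prod X th)) ->
  (forall z, z ∈ b -> covers (app r z) z) -> covers (stage b r) b.
Proof.
  intros Tb Sr IH. assert (Ob := thO C Tb).
  destruct (classic (subset b L)) as [S|NS]; [|destruct (classic (Jclosed b)) as [Jc|NJ]].
  - split.
    + intros x c c' K K'. apply stageE in K as [_ [(_ & x1 & y1 & E1 & _ & K)|[K _]]]; [|contradiction].
      apply stageE in K' as [_ [(_ & x2 & y2 & E2 & _ & K')|[K' _]]]; [|contradiction]. exact (FE K K').
    + intros c Hc. destruct (SE (S c Hc)) as (x & Hx & K). exists x. split; [exact Hx|]. apply stageE.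
      split; [apply opair_prod; split; [exact Hx|exact (thT C Tb Hc)]|]. left. split; [exact S|]. exists x, c. auto.
  - assert (bL : L ∈ b) by (destruct (Ord_le_or Ob OL); tauto).
    assert (R : reaches b).
    { destruct (Ord_cases Ob) as [->|[(c & Oc & ->)|Lb]].
      - now apply empE in bL.
      - assert (Hc : c ∈ succ c) by (apply succE; auto).
        (* For b = c + 1 the one-point map with value c is cofinal. *)
        exists (num 5). split; [apply num_omega|]. exists emp. split; [exact (th_emp C)|]. exists c. split; [exact (thT C Tb Hc)|].
        assert (S1 : succ emp ∈ succ c).
        { apply (Ord_trans Ob bL), (Ord_trans OL Lom), omega_succ, omega_emp. }
        exists (succ emp). split; [exact S1|]. split; [|split].
        + intros x y K. apply candidateE in K. select K. apply opair_inj in K as [-> ->]. apply succE. auto.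
        + intros x y y' K K'. apply candidateE in K, K'. select K. select K'.
          apply opair_inj in K as [-> ->], K' as [_ ->]. reflexivity.
        + intros x Hx. exists emp, c. split.
          * apply candidateE. split; [|do 5 right; auto]. apply opair_prod. split; [|exact Hc].
            apply (Ord_trans Ob S1), succE; auto.
          * apply succE in Hx as [Hx| ->]; [exact (Ord_sub Oc Hx)|intros z; auto].
      - now apply reaches_limit. }
    destruct (chosenP Ob R) as (Hd & G1 & G2 & G3).
    assert (inb : forall u a, opair u a ∈ chosen b -> a ∈ b).
    { intros u a K. unfold chosen in K. rewrite candidateE in K. destruct K as [K _]. now apply opair_prod in K. }
    destruct (IH _ Hd) as [D1 D2]. split.
    + intros x c c' K K'. apply stageE in K as [_ [[K _]|[_ [[K _]|[_ K]]]]]; [contradiction..|].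
      apply stageE in K' as [_ [[K' _]|[_ [[K' _]|[_ K']]]]]; [contradiction..|].
      destruct K as (x1 & y1 & u1 & a1 & c1 & E1 & A1 & A2 & A3), K' as (x2 & y2 & u2 & a2 & c2 & E2 & B1 & B2 & B3).
      apply opair_inj in E1 as [-> ->], E2 as [E2 ->]. apply fp_inj in E2 as [<- <-].
      rewrite (D1 _ _ _ B1 A1) in B2. rewrite (G2 _ _ _ B2 A2) in B3.
      assert (N : emp <> sing emp) by (intro Q'; apply (@empE _ _ emp); rewrite Q' at 2; now apply singE).
      destruct A3 as [(y & Ey & A3)|[Ey ->]], B3 as [(y' & Ey' & B3)|[Ey' ->]].
      * rewrite Ey in Ey'. apply fp_inj in Ey' as [<- _]. exact (proj1 (IH a1 (inb _ _ A2)) _ _ _ A3 B3).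
      * rewrite Ey in Ey'. apply fp_inj in Ey' as [_ Ey']. contradiction.
      * rewrite Ey in Ey'. apply fp_inj in Ey' as [_ Ey']. now symmetry in Ey'.
      * reflexivity.
    + intros c Hc. destruct (G3 c Hc) as (u & a & A2 & S). destruct (D2 u (G1 _ _ A2)) as (x & Hx & A1).
      assert (ab := inb _ _ A2).
      assert (P : exists y, y ∈ X /\ plus (app r a) a y c).
      { apply Ord_subset in S as [S| ->]; [|..|exact (Ord_elem Ob Hc)|exact (Ord_elem Ob ab)].
        - destruct (proj2 (IH a ab) c S) as (y & Hy & K). exists (fp y emp).
          split; [exact (c_fp C Hy (X_emp C))|left; eauto].
        - exists (fp emp (sing emp)). split; [exact (c_fp C (X_emp C) (X_one C))|right; auto]. }
      destruct P as (y & Hy & P). exists (fp x y). assert (Hxy := c_fp C Hx Hy). split; [exact Hxy|].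
      apply stageE. split; [apply opair_prod; split; [exact Hxy|exact (thT C Tb Hc)]|]. right. split; [exact NS|]. right.
      split; [exact Jc|]. exists x, y, u, a, c. auto.
  - set (c1 := overtake b).
    destruct (@muP M HZF th (fun c => c ∈ b /\ app J c ∉ b)) as (_ & [A1 A2] & _); [dfn|exact Oth| |].
    { apply not_all_ex_not in NJ as [c NJ]. apply imply_to_and in NJ as [Hc NJ]. exists c. split; [exact (thT C Tb Hc)|auto]. }
    fold (overtake b) in A1, A2. fold c1 in A1, A2.
    assert (T1 := thT C Tb A1).
    set (rr := flat r (succ c1)).
    assert (in_b : forall z, z ∈ succ c1 -> z ∈ b).
    { intros z Hz. apply succE in Hz as [Hz| ->]; [exact (Ord_trans Ob A1 Hz)|exact A1]. }
    assert (Hrr : rr ∈ H).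
    { apply (mdl_sub model_injection (x := prod th (prod X th))).
      - apply (mdl_prod model_injection); [apply Fth|]. apply (mdl_prod model_injection); [apply FX|apply Fth].
      - intros p Hp. unfold rr, flat in Hp. now rewrite sepE in Hp by dfn. }
    assert (K0 : covers_upto c1 rr).
    { intros z Hz. destruct (IH z (in_b z Hz)) as [I1 I2]. split.
      - intros x Hx c Hc c' Hc' K K'. apply flatE in K as (_ & _ & K), K' as (_ & _ & K'). exact (I1 _ _ _ K K').
      - intros c Hc. destruct (I2 c Hc) as (x & Hx & K). exists x. split; [exact Hx|]. apply flatE.
        split; [|auto]. split; [exact (thT C Tb (in_b z Hz))|exact (Sr z (in_b z Hz) _ K)]. }
    assert (K1 : covers_upto (app J c1) (app J rr)).
    { exact (proj1 (elem2 (mdl_elem model_injection) (P := covers_upto) ltac:(unfold covers_upto; dfn) (thH C T1) Hrr) K0). }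
    assert (bJ : b ∈ succ (app J c1)).
    { apply succE. apply Ord_subset; [exact Ob|exact (thO C (J_th C T1))|].
      destruct (Ord_le_or Ob (thO C (J_th C T1))); [assumption|contradiction]. }
    destruct (K1 b bJ) as [K2 K3].
    assert (St : forall p, p ∈ stage b r <-> p ∈ prod X th /\ opair b p ∈ app J rr).
    { intro p. rewrite stageE. split.
      - intros [Hp [[K _]|[_ [[_ K]|[K _]]]]]; [contradiction|auto|contradiction].
      - intros [Hp K]. auto 6. }
    split.
    + intros x c c' K K'. apply St in K as [P K], K' as [P' K']. apply opair_prod in P as [Hx Hc], P' as [_ Hc'].
      exact (K2 x Hx c Hc c' Hc' K K').
    + intros c Hc. destruct (K3 c Hc) as (x & Hx & K). exists x. split; [exact Hx|]. apply St. split; [|exact K].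
      apply opair_prod. split; [exact Hx|exact (thT C Tb Hc)].
Qed.

Lemma uniform_bounded : exists t, uniform X th t.
Proof.
  destruct (@wf_recursion M HZF th (fun y x => y ∈ x) stage) as (F & Fn & HF); [dfn|exact stage_D|intros Z HZ E'; exact (wf_mem HZ E')|].
  set (rs := res (fun y x : M => y ∈ x) F) in *.
  assert (rsE : forall b z, b ∈ th -> z ∈ b -> app (rs b) z = app F z).
  { intros b z Hb Hz. assert (Tz := thT C Hb Hz). apply app_val.
    - apply resE; [dfn|]. split; [now apply (isfn_pair _ _ Fn)|eauto].
    - intros y K. apply resE in K as [K _]; [|dfn]. now apply (isfn_pair _ _ Fn) in K as [_ ->]. }
  assert (Sub : forall z, z ∈ th -> subset (app F z) (prod X th)).
  { intros z Hz p Hp. rewrite HF in Hp by exact Hz. now apply stageE in Hp. }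
  assert (K : forall b, Ord b -> b ∈ th -> covers (app F b) b).
  { apply (ord_ind (P := fun b => b ∈ th -> covers (app F b) b)); [unfold covers; dfn|].
    intros b Ob IH Hb. rewrite HF by exact Hb. apply covers_stage; [exact Hb|..].
    - intros z Hz. rewrite rsE by auto. apply Sub. exact (thT C Hb Hz).
    - intros z Hz. rewrite rsE by auto. apply IH; [exact Hz|exact (thT C Hb Hz)]. }
  exists (flat F th). split; [|split].
  - intros p Hp. assert (P : p ∈ prod th (prod X th)) by (unfold flat in Hp; now rewrite sepE in Hp by dfn).
    apply prodE in P as (a & Ha & q & Hq & ->). apply prodE in Hq as (x & Hx & c & Hc & ->). eauto 8.
  - intros a Ha x Hx b Hb b' Hb' K1 K2. apply flatE in K1 as (_ & _ & K1), K2 as (_ & _ & K2).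
    exact (proj1 (K a (thO C Ha) Ha) _ _ _ K1 K2).
  - intros a Ha b Hb. destruct (proj2 (K a (thO C Ha) Ha) b Hb) as (x & Hx & K1). exists x. split; [exact Hx|].
    apply flatE. split; [|auto]. split; [exact Ha|exact (Sub a Ha _ K1)].
Qed.
End Bounded.

Theorem no_injection : False.
Proof.
  enough (exists t, uniform X th t) as [t Ht] by exact (no_uniform C Ht).
  destruct (classic (forall c, c ∈ th -> exists a, a ∈ th /\ forall y, y ∈ c -> exists b, b ∈ near a /\ app (rk (near a)) b = y)) as [A|A];
    [now apply uniform_unbounded|].
  apply not_all_ex_not in A as [l0 A]. apply imply_to_and in A as [Hl A].
  assert (Hl0 : forall a, a ∈ th -> forall b, b ∈ near a -> app (rk (near a)) b ∈ l0).
  { intros a Ha b Hb. assert (OB : forall u, u ∈ near a -> Ord u) by (intros u; apply near_Ord).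
    destruct (Ord_le_or (thO C Hl) (rk_Ord OB Hb)) as [S|S]; [|exact S].
    destruct A. exists a. split; [exact Ha|]. intros y Hy. destruct (rk_initial Hb (S y Hy)) as (u & Hu & _ & Eu). eauto. }
  (* The successor of the maximum of l0 + 1, κ and ω exceeds all three and serves as L. *)
  set (m1 := cup (succ l0) (cup k omega)).
  assert (O0 := Ord_succ (thO C Hl)). assert (Ok := thO C (c_k C)).
  destruct (cup_max Ok Ord_omega) as [O1 E1]. destruct (cup_max O0 O1) as [O2 E2]. fold m1 in O2, E2.
  assert (Tm : m1 ∈ th).
  { destruct E2 as [-> | ->]; [exact (th_sle_lim C Hl)|]. destruct E1 as [-> | ->]; [exact (c_k C)|exact (th_omega C)]. }
  assert (HL := th_sle_lim C Tm).
  assert (In : forall x, Ord x -> subset x m1 -> x ∈ succ m1).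
  { intros x Ox S. apply succE, Ord_subset; auto. }
  destruct (proj1 (c_thE C _) HL) as [_ (E & FE & SE)].
  apply (@uniform_bounded l0 (succ m1) E); auto.
  - apply In; [exact O0|]. intros z Hz. apply cupE. auto.
  - apply In; [exact Ok|]. intros z Hz. apply cupE. right. apply cupE. auto.
  - apply In; [exact Ord_omega|]. intros z Hz. apply cupE. right. apply cupE. auto.
Qed.
End FromInjection.

(** * Passing to the lifted embedding *)

Section Assembly.
Context {M : SetStructure} {HZF : ZF M}.
Implicit Types x y z a b c u w R g m n i h t : M.
Context (hV e j : M) (Oe : Ord e) (HV : VF hV (succ (succ e))).
Local Notation V x := (app hV x).
Local Notation X := (V (succ e)).
Local Notation P := (V (succ (succ e))).
Local Notation N := (Pow P).
Context (HE : Elem N j).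
Let O1 := Ord_succ Oe.
Let O2 := Ord_succ O1.

Lemma lev0 x : x ∈ succ (succ e) -> x ∈ succ (succ (succ e)).
Proof. intro Hx. apply succE. auto. Qed.
Let I1 : succ e ∈ succ (succ (succ e)).
Proof. apply lev0, succE. auto. Qed.
Let I2 : succ (succ e) ∈ succ (succ (succ e)).
Proof. apply succE. auto. Qed.

Lemma P_Pow x : x ∈ P <-> subset x X.
Proof. now apply (VF_succ O2 HV). Qed.
Lemma X_Pow x : x ∈ X <-> subset x (V e).
Proof. now apply (VF_succ O2 HV). Qed.
Lemma P_trans x y : x ∈ P -> y ∈ x -> y ∈ P.
Proof. now apply (VF_trans O2 HV). Qed.
Lemma X_P x : x ∈ X -> x ∈ P.
Proof. intro Hx. apply (P_trans (x := X)); [|exact Hx]. apply P_Pow. intros z; auto. Qed.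

(** V_{e+1} is the largest element of P under inclusion. *)
Lemma fixed_X : fixed N j X.
Proof.
  assert (HX : X ∈ P) by (apply P_Pow; intros z; auto).
  assert (HU := elem_universe HE (N_trans P_trans) (emp_N P)). assert (FP := fixed_P HE P_trans).
  apply (fixed_def HE (Phi := fun x => x ∈ P /\ forall y, y ∈ P -> forall z, z ∈ y -> z ∈ x)).
  - exact (P_N P_trans HX).
  - dfn.
  - split; [exact HX|]. intros y Hy. now apply P_Pow.
  - intros x _ [A B]. apply subset_antisym; [now apply P_Pow|exact (B _ HX)].
Qed.

(** Each level is the union of the next, so being fixed descends one level at a time from V_{e+1};
    for finite e it reaches all levels, and fixing the levels forces the identity. *)
Lemma finite_trivial : e ∈ omega -> forall x, x ∈ N -> app j x = x.
Proof.
  intros He. assert (HU := elem_universe HE (N_trans P_trans) (emp_N P)).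
  assert (F : forall u, u ∈ succ (succ e) -> fixed N j (V u)).
  { apply nat_down; [unfold fixed; dfn|now apply omega_succ|exact fixed_X|].
    intros u Hu Fu. assert (Ou := Ord_elem O1 Hu).
    assert (Su : succ u ∈ succ (succ e)) by (apply succ_mono; auto).
    assert (Su' := lev0 Su).
    assert (Pu : V u ∈ P) by (apply (VF_level_mem HV); [exact I2|apply succE; auto]).
    apply (fixed_def HE (Phi := fun y => (forall z, z ∈ V (succ u) -> forall w, w ∈ z -> w ∈ y) /\
      forall w, w ∈ y -> exists z, z ∈ V (succ u) /\ w ∈ z)).
    - exact (P_N P_trans Pu).
    - dfn.
    - split.
      + intros z Hz. now apply (VF_succ O2 HV) in Hz.
      + intros w Hw. exists (V u). split; [|exact Hw]. apply (VF_succ O2 HV); [exact Su'|]. intros z; auto.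
    - intros y _ [A B]. apply ext. intro w. split.
      + intro Hw. destruct (B w Hw) as (z & Hz & K). apply (VF_succ O2 HV) in Hz; [now apply Hz|exact Su'].
      + intro Hw. apply (A (V u)); [|exact Hw]. apply (VF_succ O2 HV); [exact Su'|]. intros z; auto. }
  assert (K : forall x, x ∈ P -> app j x = x).
  { intros x Hx. exact (fixed_levels_pointwise HE (N_trans P_trans) (emp_N P) O2 HV F Hx (P_N P_trans Hx)). }
  intros x Hx. apply (elem_fix_subset HE (N_trans P_trans) (emp_N P) (fixed_P HE P_trans) K Hx).
  now apply PowE.
Qed.

Section Infinite.
Context (We : subset omega e).
Local Notation H := (Hull P).
Local Notation J := (lift P j).

Lemma Xfp : fpclosed X.
Proof.
  assert (E : X = Pow (V e)) by (apply ext; intro; now rewrite X_Pow, PowE).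
  rewrite E. apply (fp_closed_level O2 HV); [|exact We]. apply lev0, succE. left. apply succE. auto.
Qed.
Lemma Pfp : fpclosed P.
Proof.
  assert (E : P = Pow X) by (apply ext; intro; now rewrite P_Pow, PowE).
  rewrite E. apply (fp_closed_level O2 HV); [exact I1|]. intros n Hn. apply succE. auto.
Qed.
Lemma Xom : subset omega X.
Proof.
  intros n Hn. apply (VF_ord O2 HV I1); [exact (Ord_elem Ord_omega Hn)|]. apply succE. auto.
Qed.
Lemma Pom : subset omega P.
Proof. intros n Hn. now apply X_P, Xom. Qed.

Lemma hull_model : Model H J.
Proof.
  assert (A := Pfp). assert (A' := Pom). assert (T := P_trans). split.
  - exact (lift_elem HE T A A').
  - exact (Hull_trans A).
  - exact (Hull_subset A A').
  - exact (Hull_upair A A').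
  - exact (Hull_Un A A').
  - exact (Hull_prod A A').
  - exact (emp_Hull T A A').
Qed.

Lemma hull_omega : omega ∈ H.
Proof. exact (Hull_subset_level Pfp Pom P_trans (sle_refl P) Pom). Qed.

Lemma hull_X : fixed H J X.
Proof.
  assert (HX : X ∈ P) by (apply P_Pow; intros z; auto). split.
  - exact (Hull_trans Pfp (Hull_P P_trans Pfp Pom) HX).
  - rewrite (lift_P HE P_trans Pfp Pom HX). apply fixed_X.
Qed.

(* ℵ*(X) *)
Definition theta : M := sep H (fun a => Ord a /\ sle a X).
Lemma thetaE a : a ∈ theta <-> Ord a /\ sle a X.
Proof.
  unfold theta. rewrite sepE by (unfold sle, functional; dfn). split; [tauto|]. intros [Oa S]. split; [|auto].
  apply (Hull_subset_level Pfp Pom (T := a)); [exact (fun x y => Ord_trans Oa)|exact (sle_sub_r X_P S)|intros z; auto].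
Qed.
Lemma Ord_theta : Ord theta.
Proof.
  split.
  - intros a Ha b Hb. apply thetaE in Ha as [Oa S]. apply thetaE. split; [exact (Ord_elem Oa Hb)|].
    exact (sle_sub (Ord_sub Oa Hb) S).
  - intros a Ha. apply thetaE in Ha as [Oa _]. exact (proj1 Oa).
Qed.

(** The inverse of the injection makes θ an image of P, so θ belongs to the hull, where it is
    definable from X and hence fixed by the lifted map. *)
Lemma theta_core f : isfn f theta -> (forall a, a ∈ theta -> app f a ∈ P) ->
  (forall a b, a ∈ theta -> b ∈ theta -> app f a = app f b -> a = b) ->
  (exists x, x ∈ P /\ app j x <> x) -> coded H J hV e -> False.
Proof.
  intros Ff Vf If Mv (D & FD & Co).
  assert (MD := hull_model). assert (FX := hull_X). assert (Hom := hull_omega).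
  assert (HP := Hull_P P_trans Pfp Pom).
  assert (Tth : sle theta P).
  { set (g := sep (prod P theta) (fun p => exists a, a ∈ theta /\ p = opair (app f a) a)).
    assert (gE : forall p, p ∈ g <-> p ∈ prod P theta /\ exists a, a ∈ theta /\ p = opair (app f a) a)
      by (intro; unfold g; rewrite sepE by dfn; reflexivity).
    exists g. split.
    - intros x y y' A B. apply gE in A as (_ & a & Ha & A), B as (_ & b & Hb & B).
      apply opair_inj in A as [-> ->], B as [B ->]. now apply If.
    - intros a Ha. exists (app f a). split; [now apply Vf|]. apply gE. split; [apply opair_prod; auto|eauto]. }
  assert (Hth : theta ∈ H).
  { apply (Hull_subset_level Pfp Pom (T := theta)); [exact (fun x y => Ord_trans Ord_theta)|exact Tth|intros z; auto]. }
  assert (HU := model_universe (MD := MD)). assert (HR := model_rich (MD := MD)).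
  (* A surjection can be cut down to a subset of X × a, which lies in H, so being an image of X
     means the same in H. *)
  assert (SH : forall a, a ∈ H -> sle a X <-> exists g, g ∈ H /\
    ((forall x, x ∈ X -> forall y, y ∈ a -> forall y', y' ∈ a -> opair x y ∈ g -> opair x y' ∈ g -> y = y') /\
     forall y, y ∈ a -> exists x, x ∈ X /\ opair x y ∈ g)).
  { intros a Ha. split.
    - intros (g & Fg & Sg). exists (sep (prod X a) (fun p => p ∈ g)). split.
      + apply (mdl_sub MD (mdl_prod MD (proj1 FX) Ha)). intros p Hp. now rewrite sepE in Hp by dfn.
      + split.
        * intros x _ y _ y' _ A B. rewrite sepE in A, B by dfn. exact (Fg _ _ _ (proj2 A) (proj2 B)).
        * intros y Hy. destruct (Sg y Hy) as (x & Hx & K). exists x. split; [exact Hx|].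
          rewrite sepE by dfn. rewrite opair_prod. auto.
    - intros (g & _ & Fg & Sg). exists (sep (prod X a) (fun p => p ∈ g)). split.
      + intros x y y' A B. rewrite sepE in A, B by dfn. rewrite opair_prod in A, B.
        apply (Fg x) with (y := y) (y' := y'); tauto.
      + intros y Hy. destruct (Sg y Hy) as (x & Hx & K). exists x. split; [exact Hx|].
        rewrite sepE by dfn. rewrite opair_prod. auto. }
  assert (Fth : fixed H J theta).
  { apply (fixed_def (mdl_elem MD) (Phi := fun t => forall a, a ∈ H -> a ∈ t <-> Ord a /\ exists g, g ∈ H /\
      ((forall x, x ∈ X -> forall y, y ∈ a -> forall y', y' ∈ a -> opair x y ∈ g -> opair x y' ∈ g -> y = y') /\
       forall y, y ∈ a -> exists x, x ∈ X /\ opair x y ∈ g))); [exact Hth|dfn|..].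
    - intros a Ha. rewrite thetaE. now rewrite (SH a Ha).
    - intros t Ht A. apply ext. intro a. split; intro Ha.
      + assert (Ua := mdl_trans MD Ht Ha). apply thetaE. rewrite (SH a Ua). now apply A.
      + assert (Ua := mdl_trans MD Hth Ha). apply A; [exact Ua|]. rewrite <- (SH a Ua). now apply thetaE. }
  assert (Low : forall y, y ∈ succ (succ e) -> y ∈ theta).
  { intros y Hy. apply thetaE. split; [exact (Ord_elem O2 Hy)|]. apply (sle_sub (T' := X)); [|apply sle_refl].
    intros z Hz. assert (z1 : z ∈ succ e).
    { apply succE in Hy as [Hy| ->]; [exact (Ord_trans O1 Hy Hz)|exact Hz]. }
    apply (VF_ord O2 HV I1); [exact (Ord_elem O1 z1)|exact z1]. }
  (* If no ordinal below θ moved, all ordinals up to e + 1 would be fixed, and with them all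
     elements of P. *)
  assert (Kex : exists k, Ord k /\ (k ∈ theta /\ app J k <> k) /\ forall b, b ∈ k -> ~ (b ∈ theta /\ app J b <> b)).
  { apply (Ord_min (P := fun k => k ∈ theta /\ app J k <> k)); [dfn|]. apply NNPP. intro No.
    destruct Mv as (x & Hx & Nx). apply Nx. rewrite <- (lift_P HE P_trans Pfp Pom Hx).
    apply (levels_pointwise_fixed (MD := MD) Oe HV HP FX); [|exact Hx].
    intros y Hy. apply NNPP. intro Ny. apply No. exists y. split; [exact (Ord_elem O2 Hy)|]. split; [now apply Low|exact Ny]. }
  destruct Kex as (k & Ok & [Tk Mk] & Mink).
  assert (C : Core H J X theta D k).
  { split; auto.
    - exact Ord_theta.
    - exact thetaE.
    - exact Xfp.
    - exact Xom.
    - intros a Ha. apply NNPP. intro Na. apply (Mink a Ha). split; [exact (Ord_trans Ord_theta Tk Ha)|exact Na]. }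
  apply (no_injection C (f := f)).
  - exact (isfn_H (MD := MD) Ff Hth HP Vf).
  - intros a b Ha Hb E. apply If; auto. apply ext. intro u. split; intro Hu.
    + apply E; [|exact Hu]. exact (proj1 (P_Pow _) (Vf a Ha) u Hu).
    + apply E; [|exact Hu]. exact (proj1 (P_Pow _) (Vf b Hb) u Hu).
Qed.

(** V_{e+1} is an element of V_{e+2} that includes all the others, so the supremum is attained
    there. *)
Lemma theta_is_theta : is_V (succ (succ e)) P -> is_theta (succ (succ e)) theta.
Proof.
  intro HVP. exists P. split; [exact HVP|].
  assert (Up : forall a, Ord a -> sle a X -> subset (succ a) theta).
  { intros a Oa S z Hz. apply succE in Hz as [Hz| ->]; [|now apply thetaE].
    apply (Ord_trans Ord_theta (x := a)); [now apply thetaE|exact Hz]. }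
  assert (Top : forall x, x ∈ P -> forall b, is_aleph_star x b -> subset b theta).
  { intros x Hx b (Ob & _ & Lb). apply is_ordinal_iff in Ob. apply ord_le_iff; [exact Ob|exact Ord_theta|].
    apply Lb; [apply is_ordinal_iff, Ord_theta|]. intros c (a & Oa & Sa & Ec). apply is_succ_iff in Ec as ->.
    apply is_ordinal_iff in Oa. apply ord_le_iff; [now apply Ord_succ|exact Ord_theta|].
    apply Up; [exact Oa|]. apply surj_le_iff in Sa. exact (sle_sub_r (proj1 (P_Pow x) Hx) Sa). }
  split; [apply is_ordinal_iff, Ord_theta|]. split.
  - intros b (x & Hx & Hb). assert (Ob := proj1 Hb). apply is_ordinal_iff in Ob.
    apply ord_le_iff; [exact Ob|exact Ord_theta|]. exact (Top x Hx b Hb).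
  - intros t Ot Ht. apply Ht. exists X. split; [apply P_Pow; intros z; auto|].
    split; [apply is_ordinal_iff, Ord_theta|]. split.
    + intros c (a & Oa & Sa & Ec). apply is_succ_iff in Ec as ->. apply is_ordinal_iff in Oa.
      apply ord_le_iff; [now apply Ord_succ|exact Ord_theta|]. apply Up; [exact Oa|now apply surj_le_iff].
    + intros u Ou Hu. apply is_ordinal_iff in Ou. apply ord_le_iff; [exact Ord_theta|exact Ou|].
      intros a Ha. assert (Ha' := Ha). apply thetaE in Ha' as [Oa Sa].
      assert (K : ord_le (succ a) u).
      { apply Hu. exists a. rewrite is_ordinal_iff, surj_le_iff, is_succ_iff. auto. }
      apply ord_le_iff in K; [|now apply Ord_succ|exact Ou]. apply K, succE. auto.
Qed.

(** The preimages of points under a partial surjection from X are nonempty and pairwise disjoint,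
    hence distinct subsets of X. *)
Lemma theta_injects a : a ∈ theta -> injects a P.
Proof.
  intro Ha. apply thetaE in Ha as [Oa (g & Fg & Sg)].
  destruct (@lam_fn M HZF a (fun y => sep X (fun x => opair x y ∈ g))) as [F E]; [dfn|].
  exists (lam a (fun y => sep X (fun x => opair x y ∈ g))). split.
  - apply is_function_iff. split; [exact F|]. intros y Hy. rewrite E by exact Hy. apply P_Pow.
    intros x Hx. now rewrite sepE in Hx by dfn.
  - intros y y' z A B. rewrite pair_in_iff in A, B. apply (isfn_pair _ _ F) in A as [Hy ->], B as [Hy' B].
    rewrite !E in B by auto. destruct (Sg y Hy) as (x & Hx & K).
    assert (L : x ∈ sep X (fun x => opair x y ∈ g)) by (rewrite sepE by dfn; auto).
    rewrite B in L. rewrite sepE in L by dfn. exact (Fg _ _ _ K (proj2 L)).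
Qed.

Theorem infinite_case : is_V (succ (succ e)) P -> coded H J hV e -> (exists x, x ∈ P /\ app j x <> x) ->
  is_hartogs P theta /\ is_theta (succ (succ e)) theta.
Proof.
  intros HVP Co Mv. split; [|now apply theta_is_theta].
  split; [apply is_ordinal_iff, Ord_theta|]. split.
  - intros (f & Ff & If). apply is_function_iff in Ff as [Ff Vf]. apply (theta_core Ff Vf); auto.
    intros a b Ha Hb E. apply (If a b (app f a)); apply pair_in_iff, (isfn_pair _ _ Ff); auto.
  - intros a Oa Na. apply is_ordinal_iff in Oa. apply ord_le_iff; [exact Ord_theta|exact Oa|].
    destruct (Ord_le_or Ord_theta Oa) as [S|S]; [exact S|]. destruct Na. now apply theta_injects.
Qed.
End Infinite.
End Assembly.

Theorem theorem5p1 (M : SetStructure) (HZF : ZF M)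
  (e e2 e3 V2 V3 : M)
  (e_even : is_even e)
  (He2 : is_succ_iter 2 e e2) (He3 : is_succ_iter 3 e e3)
  (HV2 : is_V e2 V2) (HV3 : is_V e3 V3)
  (Hj : exists j : M, is_elementary_embedding j V3 V3 /\ is_nontrivial j) :
  exists k : M, is_hartogs V2 k /\ is_theta e2 k.
Proof.
  apply is_succ_iter_iff in He2, He3. simpl in He2, He3. subst e2 e3.
  destruct Hj as (j & Ej & (x0 & y0 & Hxy & Nxy)).
  destruct (is_even_spec e_even) as (g & m & h & Hg & Hm & Em & h0 & hS & he).
  assert (Om := Ord_elem Ord_omega Hm).
  assert (Og : Ord g) by (destruct Hg as [-> |[Og _]]; [exact Ord_emp|exact Og]).
  assert (K : forall k, k ∈ omega -> k ∈ succ m -> Ord (app h k) /\ subset g (app h k) /\ (g = emp -> app h k ∈ omega)).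
  { apply (nat_ind_ (P := fun k => k ∈ succ m -> Ord (app h k) /\ subset g (app h k) /\ (g = emp -> app h k ∈ omega))); [dfn| |].
    - intros _. rewrite h0. split; [exact Og|]. split; [intros z; auto|]. intros ->. apply omega_emp.
    - intros k Hk IH Sk. assert (km : k ∈ m).
      { apply succE in Sk as [Sk|Sk]; [apply (Ord_trans Om Sk), succE; auto|rewrite <- Sk; apply succE; auto]. }
      destruct IH as (A & B & C); [apply succE; auto|]. rewrite hS by exact km. split; [now apply Ord_succ|].
      split; [intros z Hz; apply succE; auto|]. intro E. apply omega_succ. auto. }
  destruct (K m Hm) as (Oe & Sg & Fin); [apply succE; auto|]. rewrite he in Oe, Sg, Fin.
  assert (O2 := Ord_succ (Ord_succ Oe)).
  destruct (is_V_VF HV2 O2) as (hV & VF2 & ->).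
  destruct (is_V_VF HV3 (Ord_succ O2)) as (hV3 & VF3 & ->).
  assert (NE : app hV3 (succ (succ (succ e))) = Pow (app hV (succ (succ e)))).
  { apply ext. intro z. rewrite PowE.
    rewrite (VF_succ (Ord_succ O2) VF3) by (apply succE; auto).
    now rewrite (VF_unique (Ord_succ O2) O2 VF3 VF2 (x := succ (succ e))) by
      (try exact O2; repeat (apply succE; (right; reflexivity) || left)). }
  rewrite NE in Ej. destruct (elementary_formulas Ej) as (Fj & Vj & Tj).
  assert (HE : Elem (Pow (app hV (succ (succ e)))) j) by (split; [exact Vj|exact Tj]).
  assert (Mv : ~ forall x, x ∈ Pow (app hV (succ (succ e))) -> app j x = x).
  { intro A. apply Nxy. apply pair_in_iff, (isfn_pair _ _ Fj) in Hxy as [Hx ->]. symmetry. now apply A. }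
  destruct Hg as [-> |Lg].
  (* With limit part 0, e is a natural number. *)
  - destruct Mv. exact (finite_trivial Oe VF2 HE (Fin eq_refl)).
  - assert (We : subset omega e) by exact (subset_trans (Lim_omega Lg) Sg).
    exists (theta hV e). apply (infinite_case Oe VF2 HE We HV2).
    + assert (MD := hull_model Oe VF2 HE We).
      exact (coded_even (MD := MD) Oe VF2 (Hull_P (P_trans Oe VF2) (Pfp Oe VF2 We) (Pom Oe VF2 We))
        (hull_X Oe VF2 HE We) (hull_omega Oe VF2 We) Lg Hm Em h0 hS he).
    (* If j fixed all elements of P, it would fix all subsets of P, that is, all of N. *)
    + apply NNPP. intro Nx. apply Mv. intros x Hx.
      apply (elem_fix_subset HE (N_trans (P_trans Oe VF2)) (emp_N _) (fixed_P HE (P_trans Oe VF2))); [|exact Hx|now apply PowE].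
      intros y Hy. apply NNPP. intro Ny. apply Nx. eauto.
Qed.
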